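(* The piecewise linear holomorphic system $$\begin{cases}\dot z=\left(i+\frac38\right)z-\frac{14333}{2000}+i\,\frac{1159}{1000},&\text{when }\operatorname{Im}(z)>0,\\[4pt] \dot z=\left(i-\frac15\right)z-\frac{51}{50}+i\,\frac1{250},&\text{when }\operatorname{Im}(z)<0,\end{cases}$$ has at least $3$ nested limit cycles surrounding the real focus $(x,y)=\left(-\frac15,-\frac{49}{50}\right)$.
   Context: $z=x+iy$. Orbits on the discontinuity line $\operatorname{Im} z=0$ are defined by the Filippov convention. A limit cycle is an isolated periodic orbit. The focus $(-1/5,-49/50)$ is the equilibrium of the lower equation; it is ''real'' in the sense that it lies in the half-plane $\operatorname{Im} z<0$ where that equation applies. *)

(* Defs.v *)
From HB Require Import structures.
From mathcomp Require Import all_boot all_order all_algebra.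
From mathcomp Require Import complex.
From mathcomp Require Import all_classical all_reals all_analysis.

Set Implicit Arguments.
Unset Strict Implicit.
Unset Printing Implicit Defensive.

Import Order.TTheory GRing.Theory Num.Theory.
Import numFieldNormedType.Exports.

Local Open Scope classical_set_scope.
Local Open Scope ring_scope.
Local Open Scope complex_scope.

(* The plane is [R * R], the point z = x + i y being the pair (x, y). *)

(* The vector field of z' = A z + B. *)
Definition holo_field (R : realType) (A B : R[i]) (p : R * R) : R * R :=
  let w := A * (p.1 +i* p.2) + B in (complex.Re w, complex.Im w).

(* The value at p of Filippov's differential inclusion for the field [Xup] on
   y > 0 and [Xlow] on y < 0: on y = 0 it is the segment joining the two
   vectors, which accounts at once for crossing, sliding and escaping. *)
Definition filippov (R : realType) (Xup Xlow : R * R -> R * R) (p : R * R) :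
    set (R * R) :=
  if 0 < p.2 then [set Xup p]
  else if p.2 < 0 then [set Xlow p]
  else [set v | exists2 s : R, 0 <= s <= 1 & v = s *: Xup p + (1 - s) *: Xlow p].

Definition absolutely_continuous_on (R : realType) (a b : R)
    (f : R -> R * R) : Prop :=
  forall e : R, 0 < e -> exists2 d : R, 0 < d &
    forall (n : nat) (l r : 'I_n -> R),
      (forall i, [/\ a <= l i, l i <= r i & r i <= b]) ->
      (forall i j, i != j -> r i <= l j \/ r j <= l i) ->
      \sum_(i < n) (r i - l i) < d ->
      \sum_(i < n) `|f (r i) - f (l i)| < e.

Definition filippov_solution (R : realType) (Xup Xlow : R * R -> R * R)
    (g : R -> R * R) : Prop :=
  (forall a b : R, absolutely_continuous_on a b g) /\
  {ae (@lebesgue_measure R), forall t : R,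
    derivable g t 1 /\ filippov Xup Xlow (g t) ('D_1 g t)}.

Definition periodic_orbit (R : realType) (Xup Xlow : R * R -> R * R)
    (G : set (R * R)) : Prop :=
  exists (g : R -> R * R) (T : R),
    [/\ filippov_solution Xup Xlow g, 0 < T, forall t, g (t + T) = g t,
        exists t, g t != g 0 & G = range g].

Definition limit_cycle (R : realType) (Xup Xlow : R * R -> R * R)
    (G : set (R * R)) : Prop :=
  periodic_orbit Xup Xlow G /\
  exists U : set (R * R), [/\ open U, G `<=` U &
    forall G', periodic_orbit Xup Xlow G' -> G' `<=` U -> G' = G].

(* The points surrounded by a closed curve G: those in a bounded component of
   its complement.  [~ G p] is needed since [connected_component (~` G) p] is
   empty for p on G. *)
Definition inside (R : realType) (G : set (R * R)) : set (R * R) :=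
  [set p | ~ G p /\ bounded_set (connected_component (~` G) p)].

(* The Jacobian of z |-> A z + B has eigenvalues Re A +- i Im A. *)
Definition focus (R : realType) (A B : R[i]) (p : R * R) : Prop :=
  [/\ holo_field A B p = 0, complex.Re A != 0 & complex.Im A != 0].

(* Main.v *)
(* Away from y = 0 the flows are explicit spirals.  An upper arc is determined by its flight
   time t, which gives its ends x = Aup t > 0 and x = Bup t < 0 on the line y = 0; a lower arc
   is determined likewise by s, with flight time 2 pi - s.  Crossing cycles are thus the
   intersections of the two curves (Aup, Bup) and (Alow, Blow), and comparing ends shows
   that these curves cross in three boxes.  In each box a combination B + kappa A is
   monotone, in opposite directions along the two curves, so the return map strictly moves
   points away from the crossing (first and third box) or towards it (second box).

   For isolation among all Filippov orbits, note that solutions follow the smooth flow off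
   y = 0 because an absolutely continuous function with nonnegative derivative almost
   everywhere is nondecreasing.  A periodic orbit near the cycle therefore obeys the return
   map, and its extremal crossing has to lie on the cycle.

   Each cycle goes down once and up once, so that the points strictly between its two
   branches form an open set whose union with the cycle is compact; this yields the
   inside, and the inner cycles lie there because they are connected and disjoint from the
   outer ones. *)

Require Import Defs.
From HB Require Import structures.
From mathcomp Require Import all_boot all_order all_algebra.
From mathcomp Require Import complex.
From mathcomp Require Import all_classical all_reals all_analysis.
From mathcomp Require Import ring lra.

Set Implicit Arguments.
Unset Strict Implicit.
Unset Printing Implicit Defensive.

Import Order.TTheory GRing.Theory Num.Theory.
Import numFieldNormedType.Exports.

Local Open Scope classical_set_scope.
Local Open Scope ring_scope.
Local Open Scope complex_scope.

(** * Calculus and absolutely continuous functions *)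

(** Filippov solutions of this system are not unique: on the line y = 0, for x between -1159/1000
    and -1/250, the upper field points up and the lower one points down, so that an orbit may slide
    there and leave on either side at any time. No return map exists near this segment. The cycles
    avoid it: they meet the line only at x > 0 and at x < -2, where both fields point to the same
    side, and the neighbourhoods used for isolation meet the line only in two windows inside these
    ranges. The crossings of the two curves are not known exactly, so no derivative of the return
    map is evaluated at them. That derivative is the quotient of the slopes dB/dA of the upper and
    of the lower curve, and kappa separates the two values of -dB/dA throughout a box. This decides
    both the direction of the motion and uniqueness, and it is checked at one end of each curve,
    because the functions that carry the signs are monotone in the flight time. What remains is a
    finite list of rational inequalities. *)

Section Calculus.
Context {R : realType}.
Implicit Types (f df : R -> R) (a b x y : R).

Lemma is_derive_continuous (f : R -> R) (df x : R) :
  is_derive x 1 f df -> {for x, continuous f}.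
Proof.
by move=> h; apply/differentiable_continuous/derivable1_diffP/(@ex_derive _ _ _ _ _ _ _ h).
Qed.

Lemma mean_value f df a b : a < b ->
  (forall x, a <= x <= b -> is_derive x 1 f (df x)) ->
  exists2 c, a < c < b & f b - f a = df c * (b - a).
Proof.
move=> ab fd.
have fd' x : x \in `]a, b[ -> is_derive x 1 f (df x).
  by rewrite in_itv /= => /andP[ax xb]; apply: fd; rewrite !ltW.
have [|c] := MVT ab fd'; last by rewrite in_itv /= => cab ->; exists c.
apply: continuous_in_subspaceT => x; rewrite inE /= in_itv /= => xab.
exact: is_derive_continuous (fd _ xab).
Qed.

Lemma derive_gt0_lt f df a b :
  (forall x, a <= x <= b -> is_derive x 1 f (df x)) ->
  (forall x, a < x < b -> 0 < df x) ->
  forall x y, a <= x -> x < y -> y <= b -> f x < f y.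
Proof.
move=> fd dfp x y ax xy yb.
have [|c /andP[xc cy] E] := @mean_value f df x y xy.
  by move=> z /andP[xz zy]; apply: fd; rewrite (le_trans ax) // (le_trans zy).
rewrite -subr_gt0 E mulr_gt0 ?subr_gt0 // dfp //.
by rewrite (le_lt_trans ax) // (lt_le_trans cy).
Qed.

Lemma derive_ge0_le f df a b :
  (forall x, a <= x <= b -> is_derive x 1 f (df x)) ->
  (forall x, a < x < b -> 0 <= df x) -> a <= b -> f a <= f b.
Proof.
move=> fd dfp; rewrite le_eqVlt => /predU1P[->//|ab].
have [c cab E] := mean_value ab fd.
by rewrite -subr_ge0 E mulr_ge0 ?subr_ge0 ?(ltW ab) // dfp.
Qed.

Lemma ivt_le f a b v : a <= b -> {in `[a, b], continuous f} -> f a <= v <= f b ->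
  exists2 c, a <= c <= b & f c = v.
Proof.
move=> ab cf /andP[fav vfb].
have cf' : {within `[a, b], continuous f}.
  by apply: continuous_in_subspaceT => x; rewrite inE; apply: cf.
have [|c] := IVT ab cf' (v := v); first by rewrite ge_min fav le_max vfb orbT.
by rewrite in_itv /= => cab E; exists c.
Qed.

Lemma ivt_ge f a b v : a <= b -> {in `[a, b], continuous f} -> f b <= v <= f a ->
  exists2 c, a <= c <= b & f c = v.
Proof.
move=> ab cf /andP[fav vfb].
have cf' : {within `[a, b], continuous f}.
  by apply: continuous_in_subspaceT => x; rewrite inE; apply: cf.
have [|c] := IVT ab cf' (v := v); first by rewrite ge_min fav orbT le_max vfb.
by rewrite in_itv /= => cab E; exists c.
Qed.

(** The zero is the infimum of the points where [f <= 0]. Positivity before it is what identifies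
    the moment at which an orbit comes back to the line. *)
Lemma first_zero f a b : a <= b -> {in `[a, b], continuous f} ->
  0 < f a -> f b <= 0 ->
  exists c, [/\ a < c <= b, f c = 0 & forall x, a <= x < c -> 0 < f x].
Proof.
move=> ab cf fa fb.
pose S := [set t | a <= t <= b /\ f t <= 0].
have Sb : S b by split; rewrite ?ab ?lexx.
have hS : has_inf S by split; [exists b|exists a => t [/andP[]]].
pose c := inf S.
have ac : a <= c by apply: lb_le_inf; [exists b|move=> t [/andP[]]].
have cb : c <= b by apply: ge_inf => //; case: hS.
have pos x : a <= x < c -> 0 < f x.
  move=> /andP[ax xc]; rewrite ltNge; apply/negP => fx.
  have : c <= x by apply: ge_inf; [case: hS|split; rewrite ?ax ?(le_trans (ltW xc))].
  by rewrite leNgt xc.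
have cfc : {for c, continuous f} by apply: cf; rewrite in_itv /= ac cb.
have fc_le : f c <= 0.
  rewrite leNgt; apply/negP => fc.
  have : \forall t \near c, 0 < f t by apply: (cfc [set y | 0 < y]); apply: lt_nbhsr.
  move=> /nbhs_ballP[e /= e0 he].
  have [t [/andP[at_ tb] ft] tlt] := inf_adherent e0 hS.
  have ct : c <= t by apply: ge_inf; [case: hS|split; rewrite ?at_ ?tb].
  suff : 0 < f t by rewrite ltNge ft.
  apply: he; rewrite /ball /= distrC ger0_norm ?subr_ge0 //.
  by rewrite ltrBlDl.
have aNc : a < c.
  by rewrite lt_neqAle ac andbT; apply/eqP => E; move: fc_le; rewrite -E leNgt fa.
have fc_ge : 0 <= f c.
  rewrite leNgt; apply/negP => fc.
  have : \forall t \near c, f t < 0 by apply: (cfc [set y | y < 0]); apply: lt_nbhsl.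
  move=> /nbhs_ballP[e /= e0 he].
  pose t := Num.max a (c - e / 2).
  have tc : t < c by rewrite gt_max aNc ltrBlDr ltrDl divr_gt0.
  have : f t < 0.
    apply: he; rewrite /ball /= gtr0_norm ?subr_gt0 // ltrBlDl -ltrBlDr.
    by apply: (lt_le_trans (y := c - e / 2)); [lra|rewrite le_max lexx orbT].
  by apply/negP; rewrite -leNgt ltW // pos // tc le_max lexx.
exists c; split=> //; first by rewrite aNc cb.
by apply/eqP; rewrite eq_le fc_le fc_ge.
Qed.

End Calculus.

(** * Monotonicity of absolutely continuous functions *)

Section AbsolutelyContinuous.
Context {R : realType}.
Implicit Types (f g : R -> R) (a b : R).

Definition ac_on a b f := forall e : R, 0 < e -> exists2 d : R, 0 < d &
    forall (n : nat) (l r : 'I_n -> R),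
      (forall i, [/\ a <= l i, l i <= r i & r i <= b]) ->
      (forall i j, i != j -> r i <= l j \/ r j <= l i) ->
      \sum_(i < n) (r i - l i) < d ->
      \sum_(i < n) `|f (r i) - f (l i)| < e.

(** Cousin's lemma: the supremum of the points reachable from [a] by a chain of good steps is itself
    reachable, by a step around it, and can be passed unless it equals [b]. *)
Lemma cousin (Q : R -> R -> Prop) a b : a <= b ->
  (forall t, a <= t <= b -> exists2 d, 0 < d & forall u v, a <= u -> v <= b ->
     t - d < u -> u <= t -> t <= v -> v < t + d -> Q u v) ->
  exists s : seq R, path (fun u v => (u <= v) && `[<Q u v>]) a s /\ last a s = b.
Proof.
move=> ab hQ; set e := (X in path X).
pose S := [set t | a <= t <= b /\ exists s, path e a s /\ last a s = t].
have Sa : S a by split; [rewrite lexx|exists [::]].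
have hS : has_sup S by split; [exists a|exists b => t [/andP[]]].
have up t : S t -> t <= sup S by move=> ?; apply: ub_le_sup => //; case: hS.
have lb : sup S <= b by apply: ge_sup; [exists a|move=> t [/andP[]]].
have aS : a <= sup S by apply: up.
have [|d d0 hd] := hQ (sup S); first by rewrite aS lb.
have [t St tlt] := sup_adherent d0 hS.
case: (St) => /andP[at_ tb] [s [ps ls]].
have ext v : sup S <= v -> v <= b -> v < sup S + d -> S v.
  move=> sv vb vd; split; first by rewrite vb (le_trans aS).
  exists (rcons s v); rewrite rcons_path last_rcons ps ls; split=> //=.
  rewrite /e (le_trans (up _ St)) //=; apply/asboolP; apply: hd => //.
  exact: up.
have [->|bS] := eqVneq b (sup S).
  by case: (ext (sup S)) => //; rewrite ltrDl.
have bgt : sup S < b by rewrite lt_neqAle eq_sym bS lb.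
pose v := Num.min b (sup S + d / 2).
have vgt : sup S < v by rewrite lt_min bgt ltrDl divr_gt0.
have : S v.
  apply: ext; rewrite ?(ltW vgt) // ?ge_min ?lexx //.
  by rewrite gt_min; apply/orP; right; lra.
by move/up; rewrite leNgt vgt.
Qed.

(** Neighbouring intervals may share endpoints, so half-open ones are used to make the family
    disjoint. Inclusion in [U] concerns only nondegenerate intervals, because the application
    collapses some of them to points. *)
Lemma sum_itv_le (n : nat) (l r : 'I_n -> R) (U : set R) : open U ->
  (forall i, l i <= r i) ->
  (forall i j, i != j -> r i <= l j \/ r j <= l i) ->
  (forall i, l i < r i -> `[l i, r i] `<=` U) ->
  ((\sum_(i < n) (r i - l i))%:E <= lebesgue_measure U)%E.
Proof.
move=> oU lr sep lrU; pose mu : {measure set (measurableTypeR R) -> \bar R} := @lebesgue_measure R; rewrite -[lebesgue_measure U]/(mu U).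
pose F i : set (measurableTypeR R) := [set` `]l i, r i]].
have tF : trivIset setT F.
  apply/trivIsetP => i j _ _ ij; apply/disjoints_subset => z /=.
  rewrite /F /= !in_itv /= => /andP[lz zr] /andP[lz' zr'].
  case: (sep _ _ ij) => h; first by move: (lt_le_trans lz' (le_trans zr h)); rewrite ltxx.
  by move: (lt_le_trans lz (le_trans zr' h)); rewrite ltxx.
have mF i : measurable (F i) by exact: measurable_itv.
have : mu (\big[setU/set0]_(i < n) F i) = (\sum_(i < n) (r i - l i))%:E.
  transitivity (\sum_(i < n) mu (F i))%E.
    by rewrite measure_semi_additive_ord //; exact: bigsetU_measurable.
  rewrite -sumEFin; apply: eq_bigr => i _.
  rewrite [mu _]lebesgue_measure_itv /= lte_fin; case: ltP => // h.
  by have -> : r i = l i; [apply/eqP; rewrite eq_le lr h|rewrite subrr].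
move=> <-; apply: le_measure; rewrite ?inE.
- exact: bigsetU_measurable.
- exact: measurable_realfun.open_measurable.
- apply: (big_ind (fun A => A `<=` U)) => //; first by move=> A B AU BU z [/AU|/BU].
  move=> i _ z; rewrite /F /= in_itv /= => /andP[lz zr].
  by apply: (lrU i (lt_le_trans lz zr)); rewrite /= in_itv /= (ltW lz).
Qed.

(* Given [e > 0], cover the exceptional null set by an open set U of small measure.  Every
   point has small neighbourhoods on which f decreases at rate at most e, or which lie in
   U; on a Cousin partition the intervals of the second kind contribute little by absolute
   continuity. *)
Lemma ac_on_derive_ge0 f a b : a <= b -> ac_on a b f ->
  {ae (@lebesgue_measure R), forall t, a < t < b -> derivable f t 1 /\ 0 <= 'D_1 f t} ->
  f a <= f b.
Proof.
move=> ab acf aef; rewrite leNgt; apply/negP => fab.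
set D := f a - f b.
have D0 : 0 < D by rewrite subr_gt0.
pose e := D / (2 * (b - a + 1)).
have e0 : 0 < e by rewrite divr_gt0 // mulr_gt0 //; lra.
have eD : e * (b - a) < D / 2.
  have -> : D / 2 = e * (b - a) + e by rewrite /e; field; lra.
  by rewrite ltrDl.
have [d d0 hd] := acf _ (divr_gt0 D0 (ltr0n _ 2)).
case: aef => B [mB B0 subB].
(* The endpoints join the exceptional set, since the derivative is controlled only on the open
   interval. *)
pose B' := B `|` [set a; b].
have mB' : measurable B' by apply: measurableU => //; apply: measurableU.
have B'0 : lebesgue_measure B' = 0%E.
  rewrite /B'; apply/eqP; rewrite eq_le measure_ge0 andbT.
  apply: le_trans (measureU2 _ _ _) _ => //; first exact: measurableU.
  rewrite [X in (X + _ <= _)%E]B0 add0e; apply: le_trans (measureU2 _ _ _) _ => //.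
  rewrite [X in (X + _ <= _)%E]lebesgue_measure_set1.
  by rewrite [X in (_ + X <= _)%E]lebesgue_measure_set1 adde0.
have [U [oU B'U muU]] : exists U, [/\ open U, B' `<=` U & (lebesgue_measure U < d%:E)%E].
  have B'lt : (lebesgue_measure B' < +oo)%E by rewrite [X in (X < _)%E]B'0 ltry.
  have [U [oU B'U muU]] := lebesgue_regularity_outer mB' B'lt d0.
  exists U; split=> //.
  have mU : measurable U by exact: measurable_realfun.open_measurable.
  rewrite -(setDUK B'U).
  apply: (le_lt_trans (measureU2 _ _ _)) => //; first exact: measurableD.
  by rewrite [X in (X + _ < _)%E]B'0 add0e.
pose Q u v := (- e * (v - u) <= f v - f u) \/ (`[u, v] `<=` U).
have [s [ps ls]] : exists s, path (fun u v => (u <= v) && `[<Q u v>]) a s /\ last a s = b.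
  apply: cousin => // t tab.
  have [Ut|nUt] := pselect (U t).
    have /nbhs_ballP[r /= r0 hr] := open_nbhs_nbhs (conj oU Ut).
    exists r => // u v _ _ tu ut tv vt; right => x /=; rewrite in_itv /= => /andP[ux xv].
    by apply: hr; rewrite /ball /= ltr_norml; apply/andP; split; lra.
  have nB't : ~ B' t by move=> /B'U.
  have tab' : a < t < b.
    move: tab; rewrite !le_eqVlt => /andP[/predU1P[E|->] /predU1P[E'|->]] //;
    by case: nB't; right; rewrite /= ?E -?E'; tauto.
  have [dft Dft] : derivable f t 1 /\ 0 <= 'D_1 f t.
    by apply: contrapT => h; apply: nB't; left; apply: subB => /= /(_ tab').
  have /cvgrPdist_lt/(_ _ e0) := dft.
  rewrite near_withinE => /nbhs_ballP[r /= r0 hr].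
  have key h : h != 0 -> `|h| < r -> - e < h^-1 * (f (h + t) - f t).
    move=> h0 hlt; have := hr h; rewrite /ball /= sub0r normrN => /(_ hlt h0).
    rewrite ltr_norml /= => /andP[_]; rewrite /GRing.scale /= mulr1 ltrBlDr.
    rewrite -/('D_1 f t) => h1; have := le_lt_trans Dft h1.
    by rewrite -ltrBlDl sub0r.
  exists r => // u v _ _ tu ut tv vt; left.
  have h1 : - e * (v - t) <= f v - f t.
    move: tv; rewrite le_eqVlt => /predU1P[->|tv]; first by rewrite !subrr mulr0.
    have vt0 : 0 < v - t by rewrite subr_gt0.
    have := key (v - t); rewrite gt_eqF // gtr0_norm // subrK => /(_ isT).
    rewrite ltrBlDl => /(_ vt); rewrite mulrC ltr_pdivlMr // => /ltW.
    by [].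
  have h2 : - e * (t - u) <= f t - f u.
    move: ut; rewrite le_eqVlt => /predU1P[->|ut]; first by rewrite !subrr mulr0.
    have ut0 : u - t < 0 by rewrite subr_lt0.
    have := key (u - t); rewrite lt_eqF // ltr0_norm // opprB subrK => /(_ isT).
    have tur : t - u < r by lra.
    move=> /(_ tur); rewrite mulrC ltr_ndivlMr // => /ltW; lra.
  lra.
pose x i := nth a (a :: s) i.
have xS i : (i < size s)%N -> (x i <= x i.+1) /\ Q (x i) (x i.+1).
  move=> si; have := (pathP a ps) i si; rewrite -/(x i) => /andP[h /asboolP]; split=> //.
have x0 : x 0%N = a by [].
have xn : x (size s) = b by rewrite /x -last_nth ls.
have xle i j : (i <= j <= size s)%N -> x i <= x j.
  move=> /andP[ij js]; elim: j ij js => [|j IH].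
    by rewrite leqn0 => /eqP ->.
  rewrite leq_eqVlt => /predU1P[->//|ij] js.
  by apply: le_trans (IH _ (ltnW js)) _ => //; case: (xS j).
pose bad (i : 'I_(size s)) := ~~ (- e * (x i.+1 - x i) <= f (x i.+1) - f (x i)).
pose l (i : 'I_(size s)) := x i.
(* Good steps are collapsed to points, so that absolute continuity applies to the family over all
   indices. *)
pose r (i : 'I_(size s)) := if bad i then x i.+1 else x i.
have lr i : l i <= r i by rewrite /l /r; case: ifP => // _; case: (xS i).
have rx i : r i <= x i.+1 by rewrite /r; case: ifP => // _; case: (xS i).
have rl (i j : 'I_(size s)) : (i < j)%N -> r i <= l j.
  move=> ij; apply: le_trans (rx i) _; apply: xle; rewrite ij /=.
  exact: ltnW (ltn_ord j).
have sep i j : i != j -> r i <= l j \/ r j <= l i.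
  move=> ij; have := ij; rewrite -val_eqE neq_ltn => /orP[] h; [left|right]; exact: rl.
have lrU i : bad i -> `[l i, r i] `<=` U.
  rewrite /r /l => bi; rewrite bi; case: (xS i) => // _ [h|//].
  by move: bi; rewrite /bad h.
have sumd : \sum_i (r i - l i) < d.
  rewrite -lte_fin; apply: le_lt_trans muU.
  apply: sum_itv_le => // i lri; apply: lrU.
  by move: lri; rewrite /l /r; case: ifP => //; rewrite ltxx.
have arb i : [/\ a <= l i, l i <= r i & r i <= b].
  split=> //; first by rewrite -x0; apply: xle; rewrite /= ltnW.
  by apply: le_trans (rx i) _; rewrite -xn; apply: xle; rewrite ltn_ord leqnn.
have := hd _ l r arb sep sumd.
have tel (h : R -> R) : \sum_(i < size s) (h (x i.+1) - h (x i)) = h b - h a.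
  rewrite -(big_mkord xpredT (fun i => h (x i.+1) - h (x i))) telescope_sumr //.
  by rewrite xn x0.
have : \sum_(i < size s) (- e * (x i.+1 - x i) - `|f (r i) - f (l i)|) <= f b - f a.
  rewrite -tel; apply: ler_sum => i _; rewrite /r /l; case: ifPn => bi.
    have : - e * (x i.+1 - x i) <= 0 by rewrite mulNr oppr_le0 mulr_ge0 ?(ltW e0) // subr_ge0; case: (xS i).
    have := ler_norm (- (f (x i.+1) - f (x i))); rewrite normrN; lra.
  by rewrite subrr normr0 subr0; apply: contraNT bi.
rewrite sumrB -mulr_sumr (tel id) -/D.
move: eD; rewrite /D; lra.
Qed.

End AbsolutelyContinuous.

(** * Derivatives of explicit functions and of pairs *)

Section Derivatives.
Context {R : realType}.
Implicit Types (f g : R -> R).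

Lemma is_derive_constant (c x : R) : is_derive x 1 (fun=> c) 0.
Proof. exact: is_derive_cst. Qed.

Lemma is_derive_ident (x : R) : is_derive x 1 (fun t => t) 1.
Proof. exact: is_derive_id. Qed.

Lemma is_derive_opp f df (x : R) :
  is_derive x 1 f df -> is_derive x 1 (fun t => - f t) (- df).
Proof. by move=> ?; exact: is_deriveN. Qed.

Lemma is_derive_add f g df dg (x : R) : is_derive x 1 f df -> is_derive x 1 g dg ->
  is_derive x 1 (fun t => f t + g t) (df + dg).
Proof. by move=> ? ?; exact: is_deriveD. Qed.

Lemma is_derive_mul f g df dg (x : R) : is_derive x 1 f df -> is_derive x 1 g dg ->
  is_derive x 1 (fun t => f t * g t) (df * g x + f x * dg).
Proof.
move=> fd gd; apply: (is_derive_eq (f' := f x *: dg + g x *: df)).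
by rewrite /GRing.scale /= addrC [df * _]mulrC.
Qed.

Lemma is_derive_inv f df (x : R) : f x != 0 -> is_derive x 1 f df ->
  is_derive x 1 (fun t => (f t)^-1) (- df / f x ^+ 2).
Proof.
move=> f0 fd; have fd' := @ex_derive _ _ _ _ _ _ _ fd.
apply: DeriveDef; first exact: derivableV.
by rewrite deriveV // derive_val /GRing.scale /= mulrC mulrN mulNr.
Qed.

Lemma is_derive_exp f df (x : R) : is_derive x 1 f df ->
  is_derive x 1 (fun t => expR (f t)) (expR (f x) * df).
Proof. by move=> ?; exact: is_derive1_comp. Qed.

Lemma is_derive_sinus f df (x : R) : is_derive x 1 f df ->
  is_derive x 1 (fun t => sin (f t)) (cos (f x) * df).
Proof. by move=> ?; exact: is_derive1_comp. Qed.

Lemma is_derive_cosinus f df (x : R) : is_derive x 1 f df ->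
  is_derive x 1 (fun t => cos (f t)) (- sin (f x) * df).
Proof. by move=> ?; exact: is_derive1_comp. Qed.

Lemma is_derive_pair (f g : R -> R) (df dg x : R) :
  is_derive x 1 f df -> is_derive x 1 g dg ->
  is_derive x 1 (fun t => (f t, g t)) (df, dg).
Proof.
move=> fd gd.
have fd' := @ex_derive _ _ _ _ _ _ _ fd; have gd' := @ex_derive _ _ _ _ _ _ _ gd.
have h : (fun h => h^-1 *: (((f (h *: 1 + x)), (g (h *: 1 + x))) - (f x, g x)))
    @ 0^' --> ('D_1 f x, 'D_1 g x).
  exact: (cvg_pair fd' gd').
apply: DeriveDef; first by apply/cvg_ex; exists ('D_1 f x, 'D_1 g x).
rewrite -(@derive_val _ _ _ _ _ _ _ fd) -(@derive_val _ _ _ _ _ _ _ gd).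
exact: (cvg_lim (@norm_hausdorff _ _) h).
Qed.

Lemma is_derive_fst (g : R -> R * R) (x : R) : derivable g x 1 ->
  is_derive x 1 (fun t => (g t).1) ('D_1 g x).1.
Proof.
move=> gd.
have h : (fun h => h^-1 *: ((g (h *: 1 + x)).1 - (g x).1)) @ 0^' --> ('D_1 g x).1.
  apply: (@cvg_comp _ _ _ (fun h => h^-1 *: (g (h *: 1 + x) - g x)) fst _ _ _ gd).
  exact: cvg_fst.
apply: DeriveDef; first by apply/cvg_ex; exists ('D_1 g x).1.
exact: (cvg_lim (@norm_hausdorff _ _) h).
Qed.

Lemma is_derive_snd (g : R -> R * R) (x : R) : derivable g x 1 ->
  is_derive x 1 (fun t => (g t).2) ('D_1 g x).2.
Proof.
move=> gd.
have h : (fun h => h^-1 *: ((g (h *: 1 + x)).2 - (g x).2)) @ 0^' --> ('D_1 g x).2.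
  apply: (@cvg_comp _ _ _ (fun h => h^-1 *: (g (h *: 1 + x) - g x)) snd _ _ _ gd).
  exact: cvg_snd.
apply: DeriveDef; first by apply/cvg_ex; exists ('D_1 g x).2.
exact: (cvg_lim (@norm_hausdorff _ _) h).
Qed.

End Derivatives.

(** The derivative is first built as an unknown from the shape of the function and then compared
    with the wanted one, so that [derive_tac] leaves a single algebraic identity. *)
Lemma is_derive_by (R : realType) (f : R -> R) (x df f' : R) :
  (unit -> is_derive x 1 f f') -> f' = df -> is_derive x 1 f df.
Proof. by move=> h <-; exact: (h tt). Qed.

Ltac derive_tac := eapply is_derive_by;
  [intros _; repeat first
    [ eassumption
    | eapply is_derive_constant | eapply is_derive_ident
    | eapply is_derive_opp | eapply is_derive_add | eapply is_derive_mul
    | eapply is_derive_exp | eapply is_derive_sinus | eapply is_derive_cosinus ]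
  | cbv beta ].

(** * Sums, products and Lipschitz bounds for absolute continuity *)

Section AbsoluteContinuityAlgebra.
Context {R : realType}.
Implicit Types (f g : R -> R) (a b : R).

Lemma le_norm_fst (z : R * R) : `|z.1| <= `|z|.
Proof. by rewrite prod_normE le_max lexx. Qed.

Lemma le_norm_snd (z : R * R) : `|z.2| <= `|z|.
Proof. by rewrite prod_normE le_max lexx orbT. Qed.

Lemma ac_on_fst a b (g : R -> R * R) :
  absolutely_continuous_on a b g -> ac_on a b (fun t => (g t).1).
Proof.
move=> acg e e0; have [d d0 hd] := acg e e0; exists d => // n l r lr sep lt.
apply: le_lt_trans (hd n l r lr sep lt); apply: ler_sum => i _.
by apply: le_trans (le_norm_fst _).
Qed.

Lemma ac_on_snd a b (g : R -> R * R) :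
  absolutely_continuous_on a b g -> ac_on a b (fun t => (g t).2).
Proof.
move=> acg e e0; have [d d0 hd] := acg e e0; exists d => // n l r lr sep lt.
apply: le_lt_trans (hd n l r lr sep lt); apply: ler_sum => i _.
by apply: le_trans (le_norm_snd _).
Qed.

Lemma lipschitz_ac M a b (g : R -> R * R) :
  (forall x y, a <= x -> x <= y -> y <= b -> `|g y - g x| <= M * (y - x)) ->
  absolutely_continuous_on a b g.
Proof.
move=> lip e e0; pose K := `|M| + 1.
have K0 : 0 < K by rewrite ltr_wpDl.
exists (e / K); first exact: divr_gt0.
move=> n l r lr _; rewrite ltr_pdivlMr // => lt; apply: le_lt_trans lt.
rewrite mulr_suml; apply: ler_sum => i _; case: (lr i) => al lri rb.
apply: le_trans (lip _ _ al lri rb) _; rewrite mulrC ler_wpM2l ?subr_ge0 //.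
by rewrite /K; have := ler_norm M; lra.
Qed.

Lemma ac_on_lipschitz M a b f :
  (forall x y, a <= x -> x <= y -> y <= b -> `|f y - f x| <= M * (y - x)) ->
  ac_on a b f.
Proof.
move=> lip e e0; pose K := `|M| + 1.
have K0 : 0 < K by rewrite ltr_wpDl.
exists (e / K); first exact: divr_gt0.
move=> n l r lr _; rewrite ltr_pdivlMr // => lt; apply: le_lt_trans lt.
rewrite mulr_suml; apply: ler_sum => i _; case: (lr i) => al lri rb.
apply: le_trans (lip _ _ al lri rb) _; rewrite mulrC ler_wpM2l ?subr_ge0 //.
by rewrite /K; have := ler_norm M; lra.
Qed.

Lemma ac_onD a b f g : ac_on a b f -> ac_on a b g -> ac_on a b (fun t => f t + g t).
Proof.
move=> hf hg e e0; have e20 : 0 < e / 2 by rewrite divr_gt0.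
have [d d0 hd] := hf _ e20; have [d' d'0 hd'] := hg _ e20.
exists (Num.min d d') => [|n l r lr sep]; first by rewrite lt_min d0 d'0.
rewrite lt_min => /andP[lt lt'].
have h1 := hd n l r lr sep lt; have h2 := hd' n l r lr sep lt'.
rewrite [e]splitr; apply: le_lt_trans (ltrD h1 h2).
rewrite -big_split; apply: ler_sum => i _ /=.
by rewrite opprD addrACA ler_normD.
Qed.

Lemma ac_onN a b f : ac_on a b f -> ac_on a b (fun t => - f t).
Proof.
move=> hf e e0; have [d d0 hd] := hf _ e0; exists d => // n l r lr sep lt.
apply: le_lt_trans (hd n l r lr sep lt); apply: ler_sum => i _ /=.
by rewrite -opprD normrN.
Qed.

Lemma ac_on_continuous a b f t : ac_on a b f -> a < t < b -> {for t, continuous f}.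
Proof.
move=> acf /andP[at_ tb]; apply/cvgrPdist_lt => e e0.
have [d d0 hd] := acf _ e0.
have key u v : a <= u -> u <= v -> v <= b -> v - u < d -> `|f v - f u| < e.
  move=> au uv vb uvd; have := hd 1%N (fun=> u) (fun=> v).
  rewrite !big_ord1; apply=> //.
  by move=> i j; rewrite !ord1.
apply/nbhs_ballP; exists (Num.min d (Num.min (t - a) (b - t))) => /=.
  by rewrite !lt_min d0 !subr_gt0 at_ tb.
move=> s; rewrite /ball /= !lt_min => /and3P[sd sa sb].
have [st|ts] := leP s t.
  apply: key => //; try by apply: ltW.
    by move: sa; rewrite ger0_norm ?subr_ge0 //; lra.
  by move: sd; rewrite ger0_norm ?subr_ge0.
rewrite distrC; apply: key => //; try by apply: ltW.
  by move: sb; rewrite ltr0_norm ?subr_lt0 //; lra.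
by move: sd; rewrite ltr0_norm ?subr_lt0 //; lra.
Qed.

Lemma continuous_bounded a b f : {in `[a, b], continuous f} ->
  exists2 M, 0 <= M & forall t, a <= t <= b -> `|f t| <= M.
Proof.
move=> cf; have [ab|ba] := leP a b; last first.
  by exists 0 => // t /andP[/le_trans h /h]; rewrite leNgt ba.
have cf' : {within `[a, b], continuous f}.
  by apply: continuous_in_subspaceT => x; rewrite inE; apply: cf.
have [c _ hc] := EVT_max ab cf'; have [d _ hd] := EVT_min ab cf'.
exists (`|f c| + `|f d|) => [|t tab]; first by rewrite addr_ge0.
rewrite ler_norml; apply/andP; split.
  have := hd t; rewrite in_itv /= => /(_ tab).
  by have := ler_norm (- f d); rewrite normrN; have := normr_ge0 (f c); lra.
have := hc t; rewrite in_itv /= => /(_ tab).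
by have := ler_norm (f c); have := normr_ge0 (f d); lra.
Qed.

Lemma ac_onM a b f g : {in `[a, b], continuous f} -> {in `[a, b], continuous g} ->
  ac_on a b f -> ac_on a b g -> ac_on a b (fun t => f t * g t).
Proof.
move=> /continuous_bounded[M M0 hM] /continuous_bounded[N N0 hN] hf hg e e0.
have e1 : 0 < e / 2 / (N + 1) by rewrite !divr_gt0 // ltr_wpDl.
have e2 : 0 < e / 2 / (M + 1) by rewrite !divr_gt0 // ltr_wpDl.
have [d d0 hd] := hf _ e1; have [d' d'0 hd'] := hg _ e2.
exists (Num.min d d') => [|n l r lr sep]; first by rewrite lt_min d0 d'0.
rewrite lt_min => /andP[lt lt'].
have := hd n l r lr sep lt; rewrite ltr_pdivlMr ?ltr_wpDl // => h2.
have := hd' n l r lr sep lt'; rewrite ltr_pdivlMr ?ltr_wpDl // => h1.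
rewrite [e]splitr; apply: le_lt_trans (ltrD h1 h2).
rewrite !mulr_suml -big_split; apply: ler_sum => i _ /=.
case: (lr i) => al lri rb.
have -> : f (r i) * g (r i) - f (l i) * g (l i) =
  (g (r i) - g (l i)) * f (r i) + (f (r i) - f (l i)) * g (l i) by ring.
apply: le_trans (ler_normD _ _) _; rewrite !normrM.
apply: lerD; apply: ler_wpM2l => //.
  by apply: le_trans (hM _ _) _; rewrite ?(le_trans al) // lerDl.
by apply: le_trans (hN _ _) _; rewrite ?al ?(le_trans lri) // lerDl.
Qed.

Lemma C1_lipschitz f (df : R -> R) a b : (forall x : R, is_derive x 1 f (df x)) -> continuous df ->
  exists2 M, 0 <= M &
    forall x y, a <= x -> x <= y -> y <= b -> `|f y - f x| <= M * (y - x).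
Proof.
move=> fd cdf; have [|M M0 hM] := @continuous_bounded a b df.
  by move=> x _; exact: cdf.
exists M => // x y ax; rewrite le_eqVlt => /predU1P[->|xy] yb.
  by rewrite !subrr normr0 mulr0.
have [c /andP[xc cy] ->] := mean_value xy (fun z _ => fd z).
rewrite normrM (gtr0_norm (x := y - x)) ?subr_gt0 //.
apply: ler_wpM2r; first by rewrite subr_ge0 ltW.
by apply: hM; rewrite (le_trans ax (ltW xc)) (le_trans (ltW cy)).
Qed.

Lemma ae_subset (P Q : R -> Prop) : {ae (@lebesgue_measure R), forall t, P t} ->
  (forall t, P t -> Q t) -> {ae (@lebesgue_measure R), forall t, Q t}.
Proof.
move=> [B [mB B0 PB]] PQ; exists B; split=> // t /= nQ; apply: PB => /= Pt.
exact/nQ/PQ.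
Qed.

Lemma ac_on_const f a b : a <= b -> ac_on a b f ->
  {ae (@lebesgue_measure R), forall t, a < t < b -> is_derive t 1 f 0} ->
  f a = f b.
Proof.
move=> ab acf aef; apply/eqP; rewrite eq_le; apply/andP; split.
  apply: ac_on_derive_ge0 => //; apply: (ae_subset aef) => t h /h h'.
  by split; [exact: ex_derive|rewrite derive_val].
rewrite -lerN2; apply: (ac_on_derive_ge0 (f := fun t => - f t)) => //.
  exact: ac_onN.
apply: (ae_subset aef) => t h /h h'.
have hN := is_derive_opp h'.
by split; [exact: ex_derive|rewrite derive_val oppr0].
Qed.

End AbsoluteContinuityAlgebra.

(** * Solutions of a linear focus *)

Section Spiral.
Context {R : realType}.
Implicit Types (m u v t : R) (q : R * R).

Definition spiral_field m u v q : R * R :=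
  (m * (q.1 - u) - (q.2 - v), (q.1 - u) + m * (q.2 - v)).

Definition spiral m u v q t : R * R :=
  (u + expR (m * t) * ((q.1 - u) * cos t - (q.2 - v) * sin t),
   v + expR (m * t) * ((q.1 - u) * sin t + (q.2 - v) * cos t)).

Lemma spiral0 m u v q : spiral m u v q 0 = q.
Proof.
rewrite /spiral mulr0 expR0 cos0 sin0 !mulr1 !mulr0 subr0 add0r !mul1r.
by rewrite !(addrC _ (_ - _)) !subrK; case: q.
Qed.

Lemma spiral_derive1 m u v q t :
  is_derive t 1 (fun t => (spiral m u v q t).1) (spiral_field m u v (spiral m u v q t)).1.
Proof. rewrite /=; derive_tac; rewrite /=; ring. Qed.

Lemma spiral_derive2 m u v q t :
  is_derive t 1 (fun t => (spiral m u v q t).2) (spiral_field m u v (spiral m u v q t)).2.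
Proof. rewrite /=; derive_tac; rewrite /=; ring. Qed.

(** With z the position relative to the centre, z exp(-(m + i)(t - a)) is absolutely continuous with
    derivative 0 almost everywhere, hence has the same value at both ends. [P] and [Q] are its real
    and imaginary parts; the end of the proof undoes the rotation. *)
Lemma spiral_unique m u v (g : R -> R * R) a b : a <= b ->
  (forall a b, absolutely_continuous_on a b g) ->
  {ae (@lebesgue_measure R), forall t, a < t < b ->
     derivable g t 1 /\ 'D_1 g t = spiral_field m u v (g t)} ->
  g b = spiral m u v (g a) (b - a).
Proof.
move=> ab acg aeg.
pose c t := expR (- m * (t - a)) * cos (t - a).
pose s t := expR (- m * (t - a)) * sin (t - a).
have cd t : is_derive t 1 c (- m * c t - s t).
  by rewrite /c /s; derive_tac; ring.
have sd t : is_derive t 1 s (- m * s t + c t).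
  by rewrite /c /s; derive_tac; ring.
have cc : continuous c by move=> t; exact: is_derive_continuous (cd t).
have cs : continuous s by move=> t; exact: is_derive_continuous (sd t).
pose X t := (g t).1 - u; pose Y t := (g t).2 - v.
have acX (p q : R) : ac_on p q X.
  apply: ac_onD; first exact: ac_on_fst.
  by apply: (ac_on_lipschitz (M := 0)) => *; rewrite subrr normr0 mul0r.
have acY (p q : R) : ac_on p q Y.
  apply: ac_onD; first exact: ac_on_snd.
  by apply: (ac_on_lipschitz (M := 0)) => *; rewrite subrr normr0 mul0r.
have cX : continuous X.
  move=> t; by apply: (ac_on_continuous (acX (t - 1) (t + 1))); apply/andP; split; lra.
have cY : continuous Y.
  move=> t; by apply: (ac_on_continuous (acY (t - 1) (t + 1))); apply/andP; split; lra.
have acc (p q : R) : ac_on p q c.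
  have [|M _ /ac_on_lipschitz//] := C1_lipschitz p q cd.
  by move=> t; apply: cvgB; [apply: cvgMr; exact: cc|exact: cs].
have acs (p q : R) : ac_on p q s.
  have [|M _ /ac_on_lipschitz//] := C1_lipschitz p q sd.
  by move=> t; apply: cvgD; [apply: cvgMr; exact: cs|exact: cc].
have acM (f h : R -> R) : continuous f -> continuous h -> ac_on a b f ->
    ac_on a b h -> ac_on a b (fun t => f t * h t).
  by move=> cf ch; apply: ac_onM => t _.
have P : X a * c a + Y a * s a = X b * c b + Y b * s b.
  apply: (ac_on_const (f := fun t => X t * c t + Y t * s t)) => //.
    by apply: ac_onD; apply: acM.
  apply: (ae_subset aeg) => t h /h[gd Dg].
  have Xd : is_derive t 1 X ('D_1 g t).1.
    by have ? := is_derive_fst gd; derive_tac; rewrite addr0.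
  have Yd : is_derive t 1 Y ('D_1 g t).2.
    by have ? := is_derive_snd gd; derive_tac; rewrite addr0.
  have ? := cd t; have ? := sd t.
  by derive_tac; rewrite Dg /= /X /Y; ring.
have Q : - X a * s a + Y a * c a = - X b * s b + Y b * c b.
  apply: (ac_on_const (f := fun t => - X t * s t + Y t * c t)) => //.
    apply: ac_onD; apply: acM => //; last exact: ac_onN.
    by move=> t; apply: cvgN; exact: cX.
  apply: (ae_subset aeg) => t h /h[gd Dg].
  have Xd : is_derive t 1 X ('D_1 g t).1.
    by have ? := is_derive_fst gd; derive_tac; rewrite addr0.
  have Yd : is_derive t 1 Y ('D_1 g t).2.
    by have ? := is_derive_snd gd; derive_tac; rewrite addr0.
  have ? := cd t; have ? := sd t.
  by derive_tac; rewrite Dg /= /X /Y; ring.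
move: P Q; rewrite /c /s subrr mulr0 expR0 cos0 sin0 !mulr1 !mulr0 addr0 add0r.
set E := expR (- m * (b - a)); rewrite /spiral.
have EE : expR (m * (b - a)) * E = 1.
  by rewrite /E -expRD mulNr subrr expR0.
have CS := cos2Dsin2 (b - a).
move: EE CS; set F := expR _; set C := cos _; set S := sin _ => EE CS.
rewrite -/(X a) -/(Y a) => -> ->.
rewrite [LHS]surjective_pairing; congr pair.
  transitivity (u + (F * E) * (C ^+ 2 + S ^+ 2) * X b); last by ring.
  by rewrite EE CS /X; ring.
transitivity (v + (F * E) * (C ^+ 2 + S ^+ 2) * Y b); last by ring.
by rewrite EE CS /Y; ring.
Qed.

End Spiral.

(** * Filippov solutions of the system *)

Section System.
Context {R : realType}.
Implicit Types (g : R -> R * R) (q : R * R) (t x : R).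

(* The fields are written about their equilibria; that of the upper one lies below the
   line y = 0, so it is virtual. *)
Definition Xup : R * R -> R * R := spiral_field (3 / 8) (67 / 50) (- (833 / 125)).
Definition Xlow : R * R -> R * R := spiral_field (- (1 / 5)) (- (1 / 5)) (- (49 / 50)).
Definition flow_up := @spiral R (3 / 8) (67 / 50) (- (833 / 125)).
Definition flow_low := @spiral R (- (1 / 5)) (- (1 / 5)) (- (49 / 50)).

Lemma holo_field_up :
  holo_field ((3 / 8) +i* 1) ((- (14333 / 2000)) +i* (1159 / 1000)) = Xup.
Proof.
by apply/funext => -[x y]; rewrite /holo_field /Xup /spiral_field /=; congr pair; lra.
Qed.

Lemma holo_field_low :
  holo_field ((- (1 / 5)) +i* 1) ((- (51 / 50)) +i* (1 / 250)) = Xlow.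
Proof.
by apply/funext => -[x y]; rewrite /holo_field /Xlow /spiral_field /=; congr pair; lra.
Qed.

Lemma Xup2 q : (Xup q).2 = q.1 + 3 / 8 * q.2 + 1159 / 1000.
Proof. rewrite /Xup /=; lra. Qed.

Lemma Xlow2 q : (Xlow q).2 = q.1 - 1 / 5 * q.2 + 1 / 250.
Proof. rewrite /Xlow /=; lra. Qed.

Local Notation sol := (filippov_solution Xup Xlow).

Lemma sol_continuous1 g : sol g -> continuous (fun t => (g t).1).
Proof.
move=> [acg _] t; apply: (ac_on_continuous (ac_on_fst (acg (t - 1) (t + 1)))).
by apply/andP; split; lra.
Qed.

Lemma sol_continuous2 g : sol g -> continuous (fun t => (g t).2).
Proof.
move=> [acg _] t; apply: (ac_on_continuous (ac_on_snd (acg (t - 1) (t + 1)))).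
by apply/andP; split; lra.
Qed.

Lemma sol_up g : sol g -> {ae (@lebesgue_measure R), forall t, 0 < 1 * (g t).2 ->
  derivable g t 1 /\ 'D_1 g t = spiral_field (3 / 8) (67 / 50) (- (833 / 125)) (g t)}.
Proof.
move=> [_ aeg]; apply: (ae_subset aeg) => t [gd]; rewrite /filippov mul1r.
by case: ifP.
Qed.

Lemma sol_low g : sol g -> {ae (@lebesgue_measure R), forall t, 0 < -1 * (g t).2 ->
  derivable g t 1 /\ 'D_1 g t = spiral_field (- (1 / 5)) (- (1 / 5)) (- (49 / 50)) (g t)}.
Proof.
move=> [_ aeg]; apply: (ae_subset aeg) => t [gd]; rewrite /filippov mulN1r oppr_gt0.
by move=> + h; rewrite h ltNge ltW.
Qed.

Lemma filippov_convex q w : filippov Xup Xlow q w ->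
  exists2 s : R, 0 <= s <= 1 & w = s *: Xup q + (1 - s) *: Xlow q.
Proof.
rewrite /filippov; case: ifP => _; first by move=> ->; exists 1;
  rewrite ?ler01 ?lexx // subrr scale0r addr0 scale1r.
case: ifP => // _ ->; exists 0; first by rewrite ler01 lexx.
by rewrite subr0 scale0r add0r scale1r.
Qed.

Lemma follow m u v (e : R) g t0 t1 : sol g -> t0 <= t1 ->
  {ae (@lebesgue_measure R), forall t, 0 < e * (g t).2 ->
     derivable g t 1 /\ 'D_1 g t = spiral_field m u v (g t)} ->
  (forall t, t0 < t < t1 -> 0 < e * (g t).2) ->
  g t1 = spiral m u v (g t0) (t1 - t0).
Proof.
move=> [acg _] t01 aeg pos; apply: spiral_unique => //.
by apply: (ae_subset aeg) => t h /pos.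
Qed.

(** Near [t0] both fields have vertical speed above [c] towards the side [e], hence so does every
    convex combination of them, whatever weight the inclusion selects. So e y - c t is
    nondecreasing, and the solution departs at once. *)
Lemma leave (e : R) g t0 : sol g -> (g t0).2 = 0 ->
  0 < e * (Xup (g t0)).2 -> 0 < e * (Xlow (g t0)).2 ->
  exists2 d, 0 < d & forall t, t0 < t <= t0 + d -> 0 < e * (g t).2.
Proof.
move=> sg g0 up low.
pose c := Num.min (e * (Xup (g t0)).2) (e * (Xlow (g t0)).2) / 2.
have c0 : 0 < c by rewrite divr_gt0 // lt_min up low.
have cup : c < e * (Xup (g t0)).2.
  have : 2 * c <= e * (Xup (g t0)).2 by rewrite mulrC divfK ?ge_min ?lexx.
  lra.
have clow : c < e * (Xlow (g t0)).2.
  have : 2 * c <= e * (Xlow (g t0)).2 by rewrite mulrC divfK ?ge_min ?lexx ?orbT.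
  lra.
have c1 := sol_continuous1 sg; have c2 := sol_continuous2 sg.
have cu : continuous (fun t => e * (Xup (g t)).2).
  move=> t; apply: cvgMr; apply: cvgD; first by apply: cvgB; [exact: c1|exact: cvg_cst].
  by apply: cvgMr; apply: cvgB; [exact: c2|exact: cvg_cst].
have cl : continuous (fun t => e * (Xlow (g t)).2).
  move=> t; apply: cvgMr; apply: cvgD; first by apply: cvgB; [exact: c1|exact: cvg_cst].
  by apply: cvgMr; apply: cvgB; [exact: c2|exact: cvg_cst].
have : \forall t \near t0, c < e * (Xup (g t)).2 /\ c < e * (Xlow (g t)).2.
  by apply: filterI; [apply: (cu t0 [set y | c < y])|apply: (cl t0 [set y | c < y])];
    apply: lt_nbhsr.
move=> /nbhs_ballP[r /= r0 hr].
exists (r / 2); first by rewrite divr_gt0.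
move=> t /andP[t0t tr].
have [acg aeg] := sg.
suff : e * (g t0).2 - c * t0 <= e * (g t).2 - c * t.
  have : 0 < c * (t - t0) by rewrite mulr_gt0 ?subr_gt0.
  by rewrite g0; lra.
apply: (ac_on_derive_ge0 (f := fun t => e * (g t).2 - c * t)); first exact: ltW.
  have lip (k : R) : ac_on t0 t (fun s => k * s).
    apply: (ac_on_lipschitz (M := `|k|)) => x y _ xy _.
    by rewrite -mulrBr normrM (ger0_norm (x := y - x)) ?subr_ge0.
  apply: ac_onD; last by apply: ac_onN.
  move=> k k0; have [d d0 hd] := ac_on_snd (acg t0 t) (divr_gt0 k0 (ltr_wpDl (normr_ge0 e) ltr01)).
  exists d => // n l r' lr sep lt; have := hd n l r' lr sep lt.
  rewrite ltr_pdivlMr ?ltr_wpDl // => h; apply: le_lt_trans h.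
  rewrite mulr_suml; apply: ler_sum => i _.
  by rewrite -mulrBr normrM mulrC ler_wpM2l // lerDl.
apply: (ae_subset aeg) => s [gd /filippov_convex[w /andP[w0 w1] E]] /andP[t0s st].
have ? := is_derive_snd gd.
have D : is_derive s 1 (fun t => e * (g t).2 - c * t) (e * ('D_1 g s).2 - c).
  by derive_tac; ring.
split; first exact: ex_derive.
rewrite derive_val E /=.
have [|hu hl] := hr s.
  by rewrite /ball /= ltr0_norm ?subr_lt0 //; lra.
have -> : e * (w *: (Xup (g s)).2 + (1 - w) *: (Xlow (g s)).2) - c =
  w * (e * (Xup (g s)).2 - c) + (1 - w) * (e * (Xlow (g s)).2 - c).
  by rewrite /GRing.scale /=; ring.
by rewrite addr_ge0 // mulr_ge0 // subr_ge0 // ltW.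
Qed.

(** [leave] takes the solution off the line. Were it back before time [T], it would have followed
    the spiral up to its first return, at which the height of the spiral would vanish too early. *)
Lemma follow_arc m u v (e : R) g t0 T : sol g -> (g t0).2 = 0 ->
  {ae (@lebesgue_measure R), forall t, 0 < e * (g t).2 ->
     derivable g t 1 /\ 'D_1 g t = spiral_field m u v (g t)} ->
  0 < e * (Xup (g t0)).2 -> 0 < e * (Xlow (g t0)).2 ->
  (forall s, 0 < s < T -> 0 < e * (spiral m u v (g t0) s).2) ->
  forall s, 0 <= s <= T -> g (t0 + s) = spiral m u v (g t0) s.
Proof.
move=> sg g0 aeg up low arc.
have [d d0 hd] := leave sg g0 up low.
have pos t : t0 < t < t0 + T -> 0 < e * (g t).2.
  move=> /andP[t0t tT]; rewrite ltNge; apply/negP => neg.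
  (* The search for a zero has to start strictly after [t0], where the height is still 0. *)
  pose s0 := t0 + Num.min d ((t - t0) / 2).
  have s0t0 : t0 < s0 by rewrite ltrDl lt_min d0 divr_gt0 // subr_gt0.
  have s0d : s0 <= t0 + d by rewrite lerD2l ge_min lexx.
  have s0t : s0 <= t.
    apply: (@le_trans _ _ (t0 + (t - t0) / 2)); last lra.
    by rewrite lerD2l ge_min lexx orbT.
  have [||c [/andP[s0c ct] gc hc]] := @first_zero _ (fun t => e * (g t).2) s0 t s0t _ _ neg.
  - by move=> z _; apply: cvgMr; exact: sol_continuous2.
  - by apply: hd; rewrite s0t0 s0d.
  have Ec : g c = spiral m u v (g t0) (c - t0).
    apply: (follow sg _ aeg); first by rewrite ltW // (lt_trans s0t0).
    move=> z /andP[z0 zc]; have [zd|dz] := leP z s0.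
      by apply: hd; rewrite z0 (le_trans zd).
    by apply: hc; rewrite zc ltW.
  have := arc (c - t0); rewrite -Ec gc ltxx; suff -> : 0 < c - t0 < T by move/(_ isT).
  by apply/andP; split; lra.
move=> s /andP[s0 sT].
have -> : spiral m u v (g t0) s = spiral m u v (g t0) (t0 + s - t0) by rewrite addrC addKr.
apply: (follow sg _ aeg); first by rewrite lerDl.
by move=> t /andP[h1 h2]; apply: pos; rewrite h1 (lt_le_trans h2) // lerD2l.
Qed.

(** On the line the vertical component changes sign at -1159/1000 for the upper field and at -1/250
    for the lower one. To the right of both points each field points up; to the left of both, as in
    [follow_low], each points down. *)
Lemma follow_up g t0 x T : sol g -> g t0 = (x, 0) -> 0 < x ->
  (forall s, 0 < s < T -> 0 < (flow_up (x, 0) s).2) ->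
  forall s, 0 <= s <= T -> g (t0 + s) = flow_up (x, 0) s.
Proof.
move=> sg E x0 arc s sT; rewrite -E in arc *.
have g0 : (g t0).2 = 0 by rewrite E.
have up : 0 < 1 * (Xup (g t0)).2 by rewrite Xup2 E /=; lra.
have low : 0 < 1 * (Xlow (g t0)).2 by rewrite Xlow2 E /=; lra.
have pos z : 0 < z < T -> 0 < 1 * (flow_up (g t0) z).2 by rewrite mul1r; apply: arc.
exact: (follow_arc sg g0 (sol_up sg) up low pos sT).
Qed.

Lemma follow_low g t0 x T : sol g -> g t0 = (x, 0) -> x < - (1159 / 1000) ->
  (forall s, 0 < s < T -> (flow_low (x, 0) s).2 < 0) ->
  forall s, 0 <= s <= T -> g (t0 + s) = flow_low (x, 0) s.
Proof.
move=> sg E x0 arc s sT; rewrite -E in arc *.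
have g0 : (g t0).2 = 0 by rewrite E.
have up : 0 < -1 * (Xup (g t0)).2 by rewrite Xup2 E /=; lra.
have low : 0 < -1 * (Xlow (g t0)).2 by rewrite Xlow2 E /=; lra.
have pos z : 0 < z < T -> 0 < -1 * (flow_low (g t0) z).2.
  by rewrite mulN1r oppr_gt0; apply: arc.
exact: (follow_arc sg g0 (sol_low sg) up low pos sT).
Qed.

(** The upper focus lies below the line, and half a turn around it takes a point above the focus to
    one below it. *)
Lemma sol_not_up g : sol g -> ~ (forall t, 0 < (g t).2).
Proof.
move=> sg pos.
have E : g pi = flow_up (g 0) (pi - 0).
  by apply: (follow (e := 1) sg (pi_ge0 R) (sol_up sg)) => t _; rewrite mul1r.
have := pos pi; rewrite E /flow_up /spiral /= subr0 sinpi cospi mulr0 add0r mulrN1 mulrN.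
have := pos 0; move: (g 0).2 (expR_gt0 (3 / 8 * pi : R)) => y e0 y0 /=.
have e1 : 0 < expR (3 / 8 * pi) * (y - - (833 / 125)) by apply: mulr_gt0; lra.
by lra.
Qed.

(* Such a solution follows the lower flow, along which the distance to the focus decays. *)
Lemma sol_periodic_low g T : sol g -> 0 < T -> (forall t, g (t + T) = g t) ->
  (forall t, (g t).2 < 0) -> forall t, g t = (- (1 / 5), - (49 / 50)).
Proof.
move=> sg T0 per neg t.
have E : g (t + T) = flow_low (g t) (t + T - t).
  apply: (follow (e := -1) sg _ (sol_low sg)); first by rewrite lerDl ltW.
  by move=> z _; rewrite mulN1r oppr_gt0.
move: E; rewrite per addrC addKr /flow_low /spiral.
set X := (g t).1 - _; set Y := (g t).2 - _; set k := expR _ => E.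
have k1 : k < 1 by rewrite -expR0 ltr_expR; nra.
have k0 : 0 < k := expR_gt0 _.
have EX : X = k * (X * cos T - Y * sin T) by rewrite {1}/X E /=; ring.
have EY : Y = k * (X * sin T + Y * cos T) by rewrite {1}/Y E /=; ring.
have CS := cos2Dsin2 T.
have N : X ^+ 2 + Y ^+ 2 = k ^+ 2 * (X ^+ 2 + Y ^+ 2).
  transitivity ((k * (X * cos T - Y * sin T)) ^+ 2 + (k * (X * sin T + Y * cos T)) ^+ 2).
    by rewrite -EX -EY.
  transitivity (k ^+ 2 * ((X ^+ 2 + Y ^+ 2) * (cos T ^+ 2 + sin T ^+ 2))); first by ring.
  by rewrite CS mulr1.
have k2 : k ^+ 2 < 1 by rewrite expr_lt1 // ltW.
have /eqP : X ^+ 2 + Y ^+ 2 = 0.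
  have : (1 - k ^+ 2) * (X ^+ 2 + Y ^+ 2) = 0 by rewrite mulrBl mul1r -N subrr.
  by move/eqP; rewrite mulf_eq0 subr_eq0 gt_eqF //= => /eqP.
rewrite paddr_eq0 ?sqr_ge0 // !sqrf_eq0 !subr_eq0 => /andP[/eqP EX' /eqP EY'].
by rewrite [g t]surjective_pairing EX' EY'.
Qed.

End System.

(** * Half-return maps *)

Section CurveCrossing.
Context {R : realType}.

(* Each curve is an increasing graph that starts and ends on opposite sides of the other. *)
Lemma curves_cross (A1 B1 A2 B2 : R -> R) (p1 p2 q1 q2 : R) : p1 < p2 -> q1 < q2 ->
  {in `[p1, p2], continuous A1} -> {in `[p1, p2], continuous B1} ->
  {in `[q1, q2], continuous A2} -> {in `[q1, q2], continuous B2} ->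
  (forall x y : R, p1 <= x -> x < y -> y <= p2 -> A1 x < A1 y) ->
  (forall x y : R, q1 <= x -> x < y -> y <= q2 -> A2 x < A2 y) ->
  (forall x y : R, q1 <= x -> x < y -> y <= q2 -> B2 x < B2 y) ->
  A2 q1 < A1 p1 -> A1 p2 < A2 q2 -> B1 p1 < B2 q1 -> B2 q2 < B1 p2 ->
  exists p q, [/\ p1 < p < p2, q1 < q < q2, A1 p = A2 q & B1 p = B2 q].
Proof.
move=> p12 q12 cA1 cB1 cA2 cB2 iA1 iA2 iB2 a1 a2 b1 b2.
have rng p : p1 <= p <= p2 -> A2 q1 < A1 p < A2 q2.
  move=> /andP[]; rewrite !le_eqVlt => /predU1P[<-|h1] /predU1P[E|h2].
  - by move: p12; rewrite E ltxx.
  - by rewrite a1 (lt_trans _ a2) // iA1.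
  - by rewrite E a2 (lt_trans a1) // iA1.
  - by rewrite (lt_trans a1) ?(lt_trans _ a2) // iA1 // ltW.
(* [g] is the inverse of [A2]; the default [q1] occurs only for values that [A2] does not take. *)
pose g v := xget q1 [set q | q1 <= q <= q2 /\ A2 q = v].
have gP v : A2 q1 < v < A2 q2 -> q1 < g v < q2 /\ A2 (g v) = v.
  move=> /andP[v1 v2].
  have [|q qq Eq] := @ivt_le _ A2 q1 q2 v (ltW q12) cA2; first by rewrite !ltW.
  have : [set q | q1 <= q <= q2 /\ A2 q = v] (g v) by apply: (xgetPex q1 (ex_intro _ q (conj qq Eq))).
  move=> [/andP[g1 g2] E]; split=> //; apply/andP; split; rewrite lt_neqAle ?g1 ?g2 andbT.
    by apply/eqP => h; move: v1; rewrite -E -h ltxx.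
  by apply/eqP => h; move: v2; rewrite -E h ltxx.
have inj x y : q1 <= x <= q2 -> q1 <= y <= q2 -> A2 x = A2 y -> x = y.
  move=> /andP[x1 x2] /andP[y1 y2] E; have [h|h|//] := ltgtP x y.
    by move: (iA2 _ _ x1 h y2); rewrite E ltxx.
  by move: (iA2 _ _ y1 h x2); rewrite E ltxx.
have gK : {in `[q1, q2], cancel A2 g}.
  move=> q; rewrite in_itv /= => hq.
  have [h1 h2] : [set q' | q1 <= q' <= q2 /\ A2 q' = A2 q] (g (A2 q)).
    by apply: (xgetPex q1); exists q.
  exact: inj.
have cA2' : {within `[q1, q2], continuous A2}.
  by apply: continuous_in_subspaceT => x; rewrite inE; apply: cA2.
have cg v : A2 q1 < v < A2 q2 -> {for v, continuous g}.
  move=> hv.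
  have : {within `]A2 q1, A2 q2[, continuous g}.
    apply: continuous_subspaceW (segment_can_le_continuous (ltW q12) cA2' gK).
    exact: subset_itv_oo_cc.
  rewrite continuous_open_subspace; last exact: interval_open.
  by apply; rewrite inE /= in_itv.
have D1 : B1 p1 < B2 (g (A1 p1)).
  have pp : p1 <= p1 <= p2 by rewrite lexx ltW.
  have [/andP[h1 h2] _] := gP _ (rng _ pp).
  by apply: (lt_trans b1); apply: iB2 => //; exact: ltW.
have D2 : B2 (g (A1 p2)) < B1 p2.
  have pp : p1 <= p2 <= p2 by rewrite lexx ltW.
  have [/andP[h1 h2] _] := gP _ (rng _ pp).
  by apply: (lt_trans _ b2); apply: iB2 => //; exact: ltW.
(* The second curve is read as a graph over the values of A, and the difference of the two graphs
   changes sign. *)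
have [||p pp E] := @ivt_le _ (fun p => B1 p - B2 (g (A1 p))) p1 p2 0 (ltW p12).
- move=> p; rewrite in_itv /= => pp; have [hg _] := gP _ (rng _ pp).
  apply: cvgB; first by apply: cB1; rewrite in_itv.
  apply: (@continuous_comp _ _ _ (fun p => g (A1 p)) B2).
    apply: (@continuous_comp _ _ _ A1 g); first by apply: cA1; rewrite in_itv.
    by apply: cg; apply: rng.
  by apply: cB2; rewrite in_itv /=; case/andP: hg => *; rewrite !ltW.
- by rewrite subr_le0 subr_ge0 !ltW.
have [hg Eg] := gP _ (rng _ pp); exists p, (g (A1 p)); split=> //; last first.
  by apply/eqP; rewrite -subr_eq0 E.
case/andP: pp => pp1 pp2; apply/andP; split; rewrite lt_neqAle ?pp1 ?pp2 andbT; apply/eqP => Ep.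
  by move: D1; rewrite -subr_lt0 Ep E ltxx.
by move: D2; rewrite -subr_gt0 -Ep E ltxx.
Qed.

End CurveCrossing.

(** * Arcs of a spiral parametrized by flight time *)

Section FlightTime.
Context {R : realType}.
Implicit Types (k m t u v c x : R).

(* On the spiral of rate [m] about a centre at depth [c] below the line y = 0, the
   abscissae (relative to the centre) of the two ends of an arc of flight time [t] are
   [c * flight 1 (- m) t] and [- c * flight 1 m t]; other values of [k] account for
   additional turns. *)
Definition flight k m t := (k * expR (m * t) - cos t) / sin t.
Definition flight_slope k m t := 1 + k * expR (m * t) * (m * sin t - cos t).

Lemma flight_derive k m t : sin t != 0 ->
  is_derive t 1 (flight k m) (flight_slope k m t / sin t ^+ 2).
Proof.
move=> s0; rewrite /flight /flight_slope.
have d1 : is_derive t 1 (fun t => (sin t)^-1) (- cos t / sin t ^+ 2).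
  by apply: is_derive_inv => //; exact: is_derive_sin.
derive_tac.
transitivity ((cos t ^+ 2 + sin t ^+ 2 + k * expR (m * t) * (m * sin t - cos t)) / sin t ^+ 2).
  by field.
by rewrite cos2Dsin2.
Qed.

Lemma flight_slope_derive k m t :
  is_derive t 1 (flight_slope k m) (k * (1 + m ^+ 2) * expR (m * t) * sin t).
Proof. rewrite /flight_slope; derive_tac; ring. Qed.

Lemma sin_pi_gt0 t : 0 < t -> t < pi -> 0 < sin t.
Proof. by move=> t0 tp; apply: sin_gt0_pi; rewrite t0 tp. Qed.

(** The derivative of [flight_slope] has the sign of sin, so a sign found at one point of [0, pi)
    persists to its right. *)
Lemma flight_slope_gt0 k m t0 t : 0 < k -> 0 <= t0 -> t0 < t -> t < pi ->
  0 <= flight_slope k m t0 -> 0 < flight_slope k m t.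
Proof.
move=> k0 t00 t0t tp J0; apply: le_lt_trans J0 _.
apply: (derive_gt0_lt (a := t0) (b := t) (fun x _ => flight_slope_derive k m x)) => //.
move=> x /andP[x0 xt]; apply: mulr_gt0; last first.
  by apply: sin_pi_gt0; [exact: le_lt_trans x0|exact: lt_trans tp].
by rewrite !mulr_gt0 ?expR_gt0 // ltr_wpDr ?sqr_ge0.
Qed.

(** At time 0 the slope equals 1 - k. This covers three of the four curves; the start of a lower arc
    has k = [klow] >= 1 and is treated from pi / 2 on. *)
Lemma flight_slope_small k m t : 0 < k <= 1 -> 0 < t -> t < pi ->
  0 < flight_slope k m t.
Proof.
move=> /andP[k0 k1] t0 tp; apply: (@flight_slope_gt0 _ _ 0) => //.
by rewrite /flight_slope mulr0 expR0 sin0 cos0 mulr0 sub0r mulr1 mulrN1 subr_ge0.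
Qed.

Lemma flight_lt k m s t : 0 < s -> s < t -> t < pi ->
  (forall x, s < x < t -> 0 < flight_slope k m x) -> flight k m s < flight k m t.
Proof.
move=> s0 st tp J0.
have sp x : s <= x <= t -> 0 < sin x.
  by move=> /andP[sx xt]; apply: sin_pi_gt0; [exact: lt_le_trans sx|exact: le_lt_trans tp].
have fd x : s <= x <= t ->
    is_derive x 1 (flight k m) (flight_slope k m x / sin x ^+ 2).
  by move=> /sp/lt0r_neq0; exact: flight_derive.
have := derive_gt0_lt fd; apply; [|exact: lexx|exact: st|exact: lexx].
move=> x /andP[sx xt]; apply: divr_gt0; first by apply: J0; rewrite sx.
by rewrite exprn_gt0 // sp // !ltW.
Qed.

Lemma flight_continuous k m t : 0 < t < pi -> {for t, continuous (flight k m)}.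
Proof.
move=> /andP[t0 tp]; have s0 : sin t != 0 by rewrite gt_eqF // sin_pi_gt0.
exact: (is_derive_continuous (flight_derive k m s0)).
Qed.

(** The height at a given time is affine in the starting abscissa, and its root is the abscissa
    whose arc lands at that time. This is how [flight] arises. *)
Lemma spiral_height m u c x t : sin t != 0 ->
  (spiral m u (- c) (x, 0) t).2 =
  expR (m * t) * sin t * (x - (u + c * flight 1 (- m) t)).
Proof.
move=> s0; rewrite /spiral /flight /=.
have : expR (m * t) * expR (- m * t) = 1 by rewrite -expRD mulNr subrr expR0.
move: (expR (m * t)) (expR (- m * t)) => E F EF.
rewrite sub0r opprK.
transitivity (- c * (E * F) + E * ((x - u) * sin t + c * cos t)).
  by rewrite EF mulr1.
by field.
Qed.

Lemma spiral_return m u c t : sin t != 0 ->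
  spiral m u (- c) (u + c * flight 1 (- m) t, 0) t = (u - c * flight 1 m t, 0).
Proof.
move=> s0; rewrite [LHS]surjective_pairing; congr pair; last first.
  by rewrite spiral_height // subrr mulr0.
rewrite /spiral /flight /=.
have : expR (m * t) * expR (- m * t) = 1 by rewrite -expRD mulNr subrr expR0.
move: (expR (m * t)) (expR (- m * t)) => E F EF.
rewrite sub0r opprK; transitivity (u + c * ((E * F) * cos t -
    E * (cos t ^+ 2 + sin t ^+ 2)) / sin t); first by field.
by rewrite EF cos2Dsin2; field.
Qed.

Lemma sin_turn t : sin (2 * pi - t) = - sin t.
Proof. by rewrite addrC mulr_natl sinD2pi sinN. Qed.

Lemma cos_turn t : cos (2 * pi - t) = cos t.
Proof. by rewrite addrC mulr_natl cosD2pi cosN. Qed.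

(** A lower arc takes more than half a turn. Writing its flight time as 2 pi - t keeps the parameter
    in (0, pi), at the price of reversing m and of a factor exp(2 m pi): the origin of [klow]. *)
Lemma flight_turn k m t : flight k m (2 * pi - t) =
  - flight (k * expR (2 * m * pi)) (- m) t.
Proof.
rewrite /flight sin_turn cos_turn invrN mulrN; congr (- (_ / _)); congr (_ - _).
by rewrite -mulrA -expRD; congr (_ * expR _); ring.
Qed.

(* Up to a positive factor, the derivative of kappa A + B, where A and B are the two ends of
   the arc (see [flight_comb_lt]). *)
Definition slope_gap kappa k m t :=
  kappa * flight_slope k (- m) t - flight_slope k^-1 m t.

Lemma slope_gap_le kappa k m s t : 0 < k -> 0 <= s -> s <= t -> t <= pi ->
  (forall x, s < x < t -> kappa * (k * expR (- m * x)) <= k^-1 * expR (m * x)) ->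
  slope_gap kappa k m t <= slope_gap kappa k m s.
Proof.
move=> k0 s0 st tp h; rewrite -lerN2.
apply: (@derive_ge0_le R (fun t => - slope_gap kappa k m t) (fun t => (1 + m ^+ 2) * sin t *
  (k^-1 * expR (m * t) - kappa * (k * expR (- m * t)))) s t) => //.
- move=> x _; rewrite /slope_gap.
  have ? := flight_slope_derive k (- m) x; have ? := flight_slope_derive k^-1 m x.
  by derive_tac; ring.
- move=> x /andP[sx xt]; apply: mulr_ge0; last by rewrite subr_ge0 h // sx.
  apply: mulr_ge0; first by rewrite addr_ge0 // sqr_ge0.
  by apply/ltW/sin_pi_gt0; [exact: le_lt_trans sx|exact: lt_le_trans tp].
Qed.

Lemma flight_comb_derive kappa k m t : sin t != 0 ->
  is_derive t 1 (fun t => kappa * flight k (- m) t - flight k^-1 m t)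
    (slope_gap kappa k m t / sin t ^+ 2).
Proof.
move=> s0; have ? := flight_derive k (- m) s0; have ? := flight_derive k^-1 m s0.
by derive_tac; rewrite /slope_gap; field.
Qed.

Lemma flight_comb_lt (e kappa k m s t : R) : 0 < s -> s < t -> t < pi ->
  (forall x, s < x < t -> 0 < e * slope_gap kappa k m x) ->
  e * (kappa * flight k (- m) s - flight k^-1 m s) <
  e * (kappa * flight k (- m) t - flight k^-1 m t).
Proof.
move=> s0 st tp h.
have sp x : s <= x <= t -> 0 < sin x.
  by move=> /andP[sx xt]; apply: sin_pi_gt0; [exact: lt_le_trans sx|exact: le_lt_trans tp].
have fd x : s <= x <= t ->
    is_derive x 1 (fun t => e * (kappa * flight k (- m) t - flight k^-1 m t))
      (e * slope_gap kappa k m x / sin x ^+ 2).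
  move=> /sp/lt0r_neq0 sx; have ? := flight_comb_derive kappa k m sx.
  by derive_tac; ring.
have := derive_gt0_lt fd; apply; [|exact: lexx|exact: st|exact: lexx].
move=> x /andP[sx xt]; apply: divr_gt0; first by apply: h; rewrite sx.
by rewrite exprn_gt0 // sp // !ltW.
Qed.

End FlightTime.

(** * The half-returns of the two given fields *)

Section HalfReturns.
Context {R : realType}.
Implicit Types (s t x : R).

(* [Aup t] and [Bup t] are the abscissae of the start and of the end of the arc of flight
   time [t] in the upper half-plane; [Blow s] and [Alow s] those of the start and of the end
   of the arc of flight time [2 * pi - s] in the lower one. *)
Definition Aup t : R := 67 / 50 + 833 / 125 * flight 1 (- (3 / 8)) t.
Definition Bup t : R := 67 / 50 - 833 / 125 * flight 1 (3 / 8) t.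
Definition klow : R := expR (2 / 5 * pi).
Definition Alow s : R := - (1 / 5) + 49 / 50 * flight klow^-1 (1 / 5) s.
Definition Blow s : R := - (1 / 5) - 49 / 50 * flight klow (- (1 / 5)) s.

Lemma pi_lt4 : pi < 4 :> R.
Proof. have := @pihalf_lt2 R; lra. Qed.

Lemma klow_gt0 : 0 < klow.
Proof. exact: expR_gt0. Qed.

Lemma klow_ge1 : 1 <= klow.
Proof.
rewrite /klow -[leLHS]expR0 ler_expR; apply: mulr_ge0; [lra|exact: pi_ge0].
Qed.

Lemma klowV : klow^-1 = expR (- (2 / 5 * pi)).
Proof. by rewrite /klow expRN. Qed.

Lemma sin_neq0 t : 0 < t < pi -> sin t != 0.
Proof. by move=> /andP[t0 tp]; rewrite gt_eqF // sin_pi_gt0. Qed.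

Lemma up_height x t : 0 < t < pi ->
  (flow_up (x, 0) t).2 = expR (3 / 8 * t) * sin t * (x - Aup t).
Proof. by move=> /sin_neq0 s0; rewrite /flow_up spiral_height. Qed.

Lemma up_return t : 0 < t < pi -> flow_up (Aup t, 0) t = (Bup t, 0).
Proof. by move=> /sin_neq0 s0; exact: spiral_return. Qed.

Lemma sin_turn_neq0 s : 0 < s < pi -> sin (2 * pi - s) != 0.
Proof. by move=> /sin_neq0; rewrite sin_turn oppr_eq0. Qed.

Lemma low_height x s : 0 < s < pi -> (flow_low (x, 0) (2 * pi - s)).2 =
  - (expR (- (1 / 5) * (2 * pi - s)) * sin s) * (x - Blow s).
Proof.
move=> /sin_turn_neq0 s0; rewrite /flow_low spiral_height // sin_turn opprK flight_turn.
have -> : Blow s = - (1 / 5) + 49 / 50 * - flight (1 * expR (2 * (1 / 5) * pi)) (- (1 / 5)) s.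
  by rewrite [1 * expR _]mul1r mulrN (_ : 2 * (1 / 5) * pi = 2 / 5 * pi); [|lra].
by rewrite mulrN mulNr.
Qed.

Lemma low_return s : 0 < s < pi -> flow_low (Blow s, 0) (2 * pi - s) = (Alow s, 0).
Proof.
move=> /sin_turn_neq0 s0.
have := spiral_return (- (1 / 5)) (- (1 / 5)) (49 / 50) s0.
rewrite !opprK !flight_turn !opprK ![1 * expR _]mul1r.
have -> : 2 * (1 / 5) * pi = 2 / 5 * pi :> R by lra.
have -> : 2 * - (1 / 5) * pi = - (2 / 5 * pi) :> R by lra.
by rewrite /Blow /Alow klowV !mulrN opprK.
Qed.

Lemma Aup_lt s t : 0 < s -> s < t -> t < pi -> Aup s < Aup t.
Proof.
move=> s0 st tp; have : flight 1 (- (3 / 8)) s < flight 1 (- (3 / 8)) t.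
  apply: flight_lt => // x /andP[sx xt]; apply: flight_slope_small.
  - by rewrite ltr01 lexx.
  - exact: lt_trans sx.
  - exact: lt_trans tp.
rewrite /Aup; lra.
Qed.

Lemma Bup_lt s t : 0 < s -> s < t -> t < pi -> Bup t < Bup s.
Proof.
move=> s0 st tp; have : flight 1 (3 / 8) s < flight 1 (3 / 8) t.
  apply: flight_lt => // x /andP[sx xt]; apply: flight_slope_small.
  - by rewrite ltr01 lexx.
  - exact: lt_trans sx.
  - exact: lt_trans tp.
rewrite /Bup; lra.
Qed.

Lemma Alow_lt s t : 0 < s -> s < t -> t < pi -> Alow s < Alow t.
Proof.
move=> s0 st tp; have : flight klow^-1 (1 / 5) s < flight klow^-1 (1 / 5) t.
  apply: flight_lt => // x /andP[sx xt]; apply: flight_slope_small.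
  - by rewrite invr_gt0 klow_gt0 invf_le1 ?klow_gt0 // klow_ge1.
  - exact: lt_trans sx.
  - exact: lt_trans tp.
rewrite /Alow; lra.
Qed.

(** Since 1 - [klow] < 0, the slope is negative for small times. Its sign at pi / 2 makes [Blow]
    monotone from there on, which is why lower arcs are parametrized with pi / 2 <= s. *)
Lemma flight_slope_low_pihalf : 0 <= flight_slope klow (- (1 / 5)) (pi / 2).
Proof.
rewrite /flight_slope /klow sin_pihalf cos_pihalf subr0 mulr1 -expRD.
have : expR (2 / 5 * pi + - (1 / 5) * (pi / 2)) <= 5 :> R; last lra.
(* With a quarter of the exponent, the crude bounds 1 + x <= exp x and pi < 4 suffice: (10/7)^4 <
   5. *)
have E : 2 / 5 * pi + - (1 / 5) * (pi / 2) = 3 / 40 * pi *+ 4 :> R by rewrite -mulr_natr; lra.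
rewrite E -mulr_natr mulrC expRM_natl.
have q0 := expR_gt0 (- (3 / 40 * pi) : R).
have h : 7 / 10 <= expR (- (3 / 40 * pi) : R).
  by apply: le_trans (expR_ge1Dx _); have := pi_lt4; lra.
have h2 : expR (3 / 40 * pi : R) <= 10 / 7.
  have := expR_gt0 (3 / 40 * pi : R); have := expRN (3 / 40 * pi : R).
  move: (expR (- (3 / 40 * pi))) h => F h; move: (expR _) => G EF G0.
  have : F * G = 1 by rewrite EF mulVf // gt_eqF.
  nra.
have h3 := expR_gt0 (3 / 40 * pi : R).
move: (expR (3 / 40 * pi)) h2 h3 => G h2 h3.
have h4 : G ^+ 2 <= 100 / 49 by rewrite expr2; nra.
have h5 : 0 <= G ^+ 2 by rewrite sqr_ge0.
have -> : G ^+ 4 = (G ^+ 2) * (G ^+ 2) by ring.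
nra.
Qed.

Lemma Blow_lt s t : pi / 2 <= s -> s < t -> t < pi -> Blow t < Blow s.
Proof.
move=> s0 st tp; have p0 := @pi_gt0 R.
have : flight klow (- (1 / 5)) s < flight klow (- (1 / 5)) t.
  apply: flight_lt => //; first by apply: lt_le_trans s0; lra.
  move=> x /andP[sx xt]; apply: (@flight_slope_gt0 _ _ _ (pi / 2)).
  - exact: klow_gt0.
  - lra.
  - exact: le_lt_trans sx.
  - exact: lt_trans tp.
  - exact: flight_slope_low_pihalf.
rewrite /Blow; lra.
Qed.

Lemma up_arc t : 0 < t < pi -> forall s, 0 < s < t -> 0 < (flow_up (Aup t, 0) s).2.
Proof.
move=> /andP[t0 tp] s /andP[s0 st].
have sp := lt_trans st tp.
rewrite up_height ?s0 //; apply: mulr_gt0.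
  by apply: mulr_gt0; [exact: expR_gt0|exact: sin_pi_gt0].
by rewrite subr_gt0 Aup_lt.
Qed.

Lemma Blow_lt0 s : pi / 2 <= s < pi -> Blow s < - (1 / 5).
Proof.
move=> /andP[s0 sp]; have p0 := @pi_gt0 R.
have h : 0 < flight klow (- (1 / 5)) s; last by rewrite /Blow; lra.
apply: divr_gt0; last by apply: sin_pi_gt0 => //; lra.
have c0 : cos s <= 0.
  have -> : s = s - pi / 2 + pi / 2 by rewrite subrK.
  rewrite cosDpihalf oppr_le0 sin_ge0_pi //; apply/andP; split; lra.
have := mulr_gt0 klow_gt0 (expR_gt0 (- (1 / 5) * s)); lra.
Qed.

(** During the first half-turn the arc stays below the line because it starts to the left of the
    focus and the spiral contracts. Afterwards the time is 2 pi - s' with s' > s, and the height has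
    the sign of [Blow s'] - [Blow s]. *)
Lemma low_arc s : pi / 2 <= s < pi ->
  forall r, 0 < r < 2 * pi - s -> (flow_low (Blow s, 0) r).2 < 0.
Proof.
move=> spi r /andP[r0 rs]; have p0 := @pi_gt0 R.
have Bs := Blow_lt0 spi; move: (spi) => /andP[s0 sp].
have [rp|pr] := leP r pi.
  rewrite /flow_low /spiral /= sub0r opprK.
  have e0 := expR_gt0 (- (1 / 5) * r).
  have e1 : expR (- (1 / 5) * r) < 1 by rewrite -[ltRHS]expR0 ltr_expR; lra.
  have c1 : cos r <= 1 by exact: cos_le1.
  have sr : 0 <= sin r by apply: sin_ge0_pi; rewrite (ltW r0).
  move: (expR _) e0 e1 (Blow s) Bs (cos r) c1 (sin r) sr => E e0 e1 B Bs C c1 S sr.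
  have h1 : (B - - (1 / 5)) * S <= 0 by apply: mulr_le0_ge0; lra.
  have h2 : E * ((B - - (1 / 5)) * S + 49 / 50 * C) <= E * (49 / 50).
    by apply: ler_wpM2l; lra.
  lra.
have sr : 0 < 2 * pi - r < pi by apply/andP; split; lra.
have -> : r = 2 * pi - (2 * pi - r) by ring.
rewrite low_height // mulNr oppr_lt0; apply: mulr_gt0.
  by case/andP: sr => *; apply: mulr_gt0; [exact: expR_gt0|exact: sin_pi_gt0].
by rewrite subr_gt0; apply: Blow_lt; lra.
Qed.

Definition gap_up (kappa t : R) := slope_gap kappa 1 (3 / 8) t.
Definition gap_low (kappa s : R) := slope_gap kappa klow^-1 (- (1 / 5)) s.

Lemma up_comb_lt (e kappa s t : R) : 0 < s -> s < t -> t < pi ->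
  (forall x, s < x < t -> 0 < e * gap_up kappa x) ->
  e * (Bup s + kappa * Aup s) < e * (Bup t + kappa * Aup t).
Proof.
move=> s0 st tp h; have := flight_comb_lt s0 st tp h.
rewrite invr1 /Aup /Bup; move: (flight _ _ _) (flight _ _ _) (flight _ _ _) (flight _ _ _).
move=> a b c d; lra.
Qed.

Lemma low_comb_lt (e kappa s t : R) : 0 < s -> s < t -> t < pi ->
  (forall x, s < x < t -> 0 < e * gap_low kappa x) ->
  e * (Blow s + kappa * Alow s) < e * (Blow t + kappa * Alow t).
Proof.
move=> s0 st tp h; have := flight_comb_lt s0 st tp h.
rewrite invrK opprK /Alow /Blow; move: (flight _ _ _) (flight _ _ _) (flight _ _ _) (flight _ _ _).
move=> a b c d; lra.
Qed.

Lemma Aup_continuous t : 0 < t < pi -> {for t, continuous Aup}.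
Proof.
move=> tp; apply: cvgD; first exact: cvg_cst.
by apply: cvgMr; exact: flight_continuous.
Qed.

Lemma Bup_continuous t : 0 < t < pi -> {for t, continuous Bup}.
Proof.
move=> tp; apply: cvgB; first exact: cvg_cst.
by apply: cvgMr; exact: flight_continuous.
Qed.

Lemma Alow_continuous t : 0 < t < pi -> {for t, continuous Alow}.
Proof.
move=> tp; apply: cvgD; first exact: cvg_cst.
by apply: cvgMr; exact: flight_continuous.
Qed.

Lemma Blow_continuous t : 0 < t < pi -> {for t, continuous Blow}.
Proof.
move=> tp; apply: cvgB; first exact: cvg_cst.
by apply: cvgMr; exact: flight_continuous.
Qed.

End HalfReturns.

(** * Limit cycles as crossings of two curves *)

Section Cycles.
Context {R : realType}.
Implicit Types (g : R -> R * R) (s t x : R).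

Local Notation sol := (filippov_solution (@Xup R) (@Xlow R)).

(* [e = 1] for a repelling cycle, [e = -1] for an attracting one. *)
Record cycle_box (e kappa t1 t2 s1 s2 : R) : Prop := CycleBox {
  box_e : e = 1 \/ e = -1;
  box_kappa : 0 < kappa;
  box_t : [/\ 0 < t1, t1 < t2 & t2 < pi];
  box_s : [/\ pi / 2 <= s1, s1 < s2 & s2 < pi];
  box_A1 : 0 < e * (Aup t1 - Alow s1);
  box_A2 : 0 < e * (Alow s2 - Aup t2);
  box_B1 : 0 < e * (Bup t1 - Blow s1);
  box_B2 : 0 < e * (Blow s2 - Bup t2);
  box_gap_up : forall x, t1 < x < t2 -> 0 < - e * gap_up kappa x;
  box_gap_low : forall x, s1 < x < s2 -> 0 < e * gap_low kappa x;
  box_right : 0 < Alow s1;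
  box_left : Bup t1 < - 2 }.

(** The last two conditions keep both crossings away from the escaping segment, with -2 <
    -1159/1000, so that solutions through them are determined forwards. *)
Record crossing_cycle t s : Prop := CrossingCycle {
  cyc_t : 0 < t < pi;
  cyc_s : pi / 2 <= s < pi;
  cyc_A : Aup t = Alow s;
  cyc_B : Bup t = Blow s;
  cyc_right : 0 < Aup t;
  cyc_left : Bup t < - 2 }.

(** The upper and the lower arc share their left ends b and b'. Adding the two inequalities
    eliminates these and compares the displacements of the right ends. *)
Lemma displacement_lt (e kappa b b' x x' y y' : R) : 0 < kappa ->
  - e * (b + kappa * x) < - e * (b' + kappa * x') ->
  e * (b + kappa * y) < e * (b' + kappa * y') -> e * (x' - x) < e * (y' - y).
Proof.
move=> k0 h1 h2; rewrite -(ltr_pM2l k0); lra.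
Qed.

Section Box.
Variables e kappa t1 t2 s1 s2 : R.
Hypothesis bx : cycle_box e kappa t1 t2 s1 s2.

Lemma box_up_range x : t1 <= x <= t2 -> 0 < x < pi.
Proof.
by case: bx => _ _ [h1 _ h2] _ _ _ _ _ _ _ _ _ /andP[x1 x2]; rewrite (lt_le_trans h1) ?(le_lt_trans x2).
Qed.

Lemma box_low_range x : s1 <= x <= s2 -> pi / 2 <= x < pi.
Proof.
by case: bx => _ _ _ [h1 _ h2] _ _ _ _ _ _ _ _ /andP[x1 x2]; rewrite (le_trans h1) ?(le_lt_trans x2).
Qed.

Lemma box_low_range0 x : s1 <= x <= s2 -> 0 < x < pi.
Proof.
by move=> /box_low_range/andP[h ->]; rewrite (lt_le_trans _ h) // divr_gt0 // pi_gt0.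
Qed.

Lemma box_Aup_lt x y : t1 <= x -> x < y -> y <= t2 -> Aup x < Aup y.
Proof.
move=> x1 xy y2; have /andP[x0 _] : 0 < x < pi.
  by apply: box_up_range; rewrite x1 (le_trans (ltW xy)).
have /andP[_ yp] : 0 < y < pi by apply: box_up_range; rewrite y2 (le_trans x1) // ltW.
exact: Aup_lt.
Qed.

Lemma box_Bup_lt x y : t1 <= x -> x < y -> y <= t2 -> Bup y < Bup x.
Proof.
move=> x1 xy y2; have /andP[x0 _] : 0 < x < pi.
  by apply: box_up_range; rewrite x1 (le_trans (ltW xy)).
have /andP[_ yp] : 0 < y < pi by apply: box_up_range; rewrite y2 (le_trans x1) // ltW.
exact: Bup_lt.
Qed.

Lemma box_Alow_lt x y : s1 <= x -> x < y -> y <= s2 -> Alow x < Alow y.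
Proof.
move=> x1 xy y2; have /andP[x0 _] : 0 < x < pi.
  by apply: box_low_range0; rewrite x1 (le_trans (ltW xy)).
have /andP[_ yp] : 0 < y < pi by apply: box_low_range0; rewrite y2 (le_trans x1) // ltW.
exact: Alow_lt.
Qed.

Lemma box_Blow_lt x y : s1 <= x -> x < y -> y <= s2 -> Blow y < Blow x.
Proof.
move=> x1 xy y2; have /andP[x0 _] : pi / 2 <= x < pi.
  by apply: box_low_range; rewrite x1 (le_trans (ltW xy)).
have /andP[_ yp] : pi / 2 <= y < pi by apply: box_low_range; rewrite y2 (le_trans x1) // ltW.
exact: Blow_lt.
Qed.

Lemma box_Bup_left x : t1 < x -> x <= t2 -> Bup x < - 2.
Proof. by move=> x1 x2; apply: lt_trans (box_left bx); exact: box_Bup_lt. Qed.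

Lemma box_Alow_right x : s1 < x -> x <= s2 -> 0 < Alow x.
Proof. by move=> x1 x2; apply: (lt_trans (box_right bx)); exact: box_Alow_lt. Qed.

Lemma box_up_comb_lt x y : t1 <= x -> x < y -> y <= t2 ->
  - e * (Bup x + kappa * Aup x) < - e * (Bup y + kappa * Aup y).
Proof.
move=> x1 xy y2; have /andP[x0 _] : 0 < x < pi.
  by apply: box_up_range; rewrite x1 (le_trans (ltW xy)).
have /andP[_ yp] : 0 < y < pi by apply: box_up_range; rewrite y2 (le_trans x1) // ltW.
apply: up_comb_lt => // z /andP[xz zy]; apply: (box_gap_up bx).
by rewrite (le_lt_trans x1) // (lt_le_trans zy).
Qed.

Lemma box_low_comb_lt x y : s1 <= x -> x < y -> y <= s2 ->
  e * (Blow x + kappa * Alow x) < e * (Blow y + kappa * Alow y).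
Proof.
move=> x1 xy y2; have /andP[x0 _] : 0 < x < pi.
  by apply: box_low_range0; rewrite x1 (le_trans (ltW xy)).
have /andP[_ yp] : 0 < y < pi by apply: box_low_range0; rewrite y2 (le_trans x1) // ltW.
apply: low_comb_lt => // z /andP[xz zy]; apply: (box_gap_low bx).
by rewrite (le_lt_trans x1) // (lt_le_trans zy).
Qed.

Lemma box_exists :
  exists t s, [/\ t1 < t < t2, s1 < s < s2, Aup t = Alow s & Bup t = Blow s].
Proof.
have cA : {in `[t1, t2], continuous (@Aup R)}.
  by move=> x; rewrite in_itv => /box_up_range; exact: Aup_continuous.
have cB : {in `[t1, t2], continuous (fun x => - Bup x)}.
  by move=> x; rewrite in_itv => /box_up_range h; apply: cvgN; exact: Bup_continuous.
have cA' : {in `[s1, s2], continuous (@Alow R)}.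
  by move=> x; rewrite in_itv => /box_low_range0; exact: Alow_continuous.
have cB' : {in `[s1, s2], continuous (fun x => - Blow x)}.
  by move=> x; rewrite in_itv => /box_low_range0 h; apply: cvgN; exact: Blow_continuous.
have iB x y : t1 <= x -> x < y -> y <= t2 -> - Bup x < - Bup y.
  by rewrite ltrN2; exact: box_Bup_lt.
have iB' x y : s1 <= x -> x < y -> y <= s2 -> - Blow x < - Blow y.
  by rewrite ltrN2; exact: box_Blow_lt.
have [he _ [_ t12 _] [_ s12 _] A1 A2 B1 B2 _ _ _ _] := bx.
(* B is negated to become increasing, and for e = -1 the two curves exchange their roles. *)
case: he => E; move: A1 A2 B1 B2; rewrite E ?mul1r ?mulN1r ?oppr_gt0 ?subr_gt0 ?subr_lt0 => A1 A2 B1 B2.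
  have [||||t [s [ht hs EA EB]]] :=
    curves_cross t12 s12 cA cB cA' cB' box_Aup_lt box_Alow_lt iB'; try by rewrite ?ltrN2.
  by exists t, s; split=> //; apply: oppr_inj.
have [||||s [t [hs ht EA EB]]] :=
  curves_cross s12 t12 cA' cB' cA cB box_Alow_lt box_Aup_lt iB; try by rewrite ?ltrN2.
by exists t, s; split=> //; apply: oppr_inj.
Qed.

Variables t s : R.
Hypotheses (ht : t1 < t < t2) (hs : s1 < s < s2).
Hypotheses (EA : Aup t = Alow s) (EB : Bup t = Blow s).

Lemma box_crossing_cycle : crossing_cycle t s.
Proof.
case/andP: (ht) (hs) => ht1 ht2 /andP[hs1 hs2]; split=> //.
- by apply: box_up_range; rewrite !ltW.
- by apply: box_low_range; rewrite !ltW.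
- by rewrite EA; apply: box_Alow_right => //; exact: ltW.
- by apply: box_Bup_left => //; exact: ltW.
Qed.

(* The derivatives of B + kappa A have opposite signs on the two curves, so along the
   return map the displacement of A grows when [e = 1] and shrinks when [e = -1]. *)
Lemma box_return t' s' : t1 < t' < t2 -> s1 < s' < s2 -> Bup t' = Blow s' ->
  Aup t' != Aup t -> e * `|Aup t' - Aup t| < e * `|Alow s' - Aup t|.
Proof.
have [he k0 _ _ _ _ _ _ _ _ _ _] := bx; case/andP: (ht) (hs) => ht1 ht2 /andP[hs1 hs2].
move=> /andP[ht1' ht2'] /andP[hs1' hs2'] EB' neq.
have mono x y : s1 <= y -> x <= s2 -> Blow y < Blow x -> x < y.
  move=> y1 x2; apply: contraTT; rewrite -!leNgt le_eqVlt => /predU1P[->//|h].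
  by apply/ltW/box_Blow_lt.
have [tt|tt|tt] := ltgtP t t'; last by move: neq; rewrite tt eqxx.
  have a1 : Aup t < Aup t' by apply: box_Aup_lt; rewrite ?ltW.
  have b1 : Bup t' < Bup t by apply: box_Bup_lt; rewrite ?ltW.
  have ss : s < s' by apply: mono; rewrite ?(ltW hs1') ?(ltW hs2) // -EB -EB'.
  have a2 : Alow s < Alow s' by apply: box_Alow_lt; rewrite ?ltW.
  have h1 := box_up_comb_lt (ltW ht1) tt (ltW ht2').
  have h2 := box_low_comb_lt (ltW hs1) ss (ltW hs2').
  rewrite !gtr0_norm ?subr_gt0 //; last by rewrite EA.
  by rewrite -EB' -EB in h2; rewrite [in X in _ < X]EA; exact: displacement_lt k0 h1 h2.
have a1 : Aup t' < Aup t by apply: box_Aup_lt; rewrite ?ltW.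
have b1 : Bup t < Bup t' by apply: box_Bup_lt; rewrite ?ltW.
have ss : s' < s by apply: mono; rewrite ?(ltW hs1) ?(ltW hs2') // -EB -EB'.
have a2 : Alow s' < Alow s by apply: box_Alow_lt; rewrite ?ltW.
have h1 := box_up_comb_lt (ltW ht1') tt (ltW ht2).
have h2 := box_low_comb_lt (ltW hs1') ss (ltW hs2).
rewrite !ltr0_norm ?subr_lt0 ?opprB //; last by rewrite EA.
by rewrite -EB' -EB in h2; rewrite [in X in _ < X]EA; exact: displacement_lt k0 h1 h2.
Qed.

End Box.

Definition loop t s : set (R * R) :=
  [set z | exists2 r, 0 <= r <= t & z = flow_up (Aup t, 0) r] `|`
  [set z | exists2 r, 0 <= r <= 2 * pi - s & z = flow_low (Bup t, 0) r].

Lemma half_up g tau t : sol g -> 0 < t < pi -> 0 < Aup t -> g tau = (Aup t, 0) ->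
  forall r, 0 <= r <= t -> g (tau + r) = flow_up (Aup t, 0) r.
Proof.
move=> sg tp A0 E; apply: follow_up => //; exact: up_arc.
Qed.

Lemma half_low g tau s : sol g -> pi / 2 <= s < pi -> Blow s < - 2 ->
  g tau = (Blow s, 0) ->
  forall r, 0 <= r <= 2 * pi - s -> g (tau + r) = flow_low (Blow s, 0) r.
Proof.
move=> sg sp B0 E; apply: follow_low => //; [lra|exact: low_arc].
Qed.

Lemma up_end g tau t : sol g -> 0 < t < pi -> 0 < Aup t -> g tau = (Aup t, 0) ->
  g (tau + t) = (Bup t, 0).
Proof.
move=> sg tp A0 E; rewrite (half_up sg tp A0 E) ?up_return //.
by case/andP: tp => t0 _; rewrite lexx ltW.
Qed.

Lemma low_end g tau s : sol g -> pi / 2 <= s < pi -> Blow s < - 2 ->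
  g tau = (Blow s, 0) -> g (tau + (2 * pi - s)) = (Alow s, 0).
Proof.
move=> sg sp B0 E; have p0 := @pi_gt0 R.
rewrite (half_low sg sp B0 E) ?low_return //; case/andP: sp => s0 s1.
  by apply/andP; split; lra.
by rewrite lexx andbT; lra.
Qed.

Lemma periodic_int g (P : R) : (forall t, g (t + P) = g t) ->
  forall (n : int) t, g (t + P * n%:~R) = g t.
Proof.
move=> per; have perN (n : nat) t : g (t + P * n%:R) = g t.
  elim: n t => [|n IH] t; first by rewrite mulr0 addr0.
  by rewrite -natr1 mulrDr mulr1 addrA per IH.
case=> n t; first by rewrite -pmulrn perN.
by rewrite -(perN n.+1 (t + _)) NegzE mulrNz -pmulrn mulrN subrK.
Qed.

Lemma periodic_reduce g (P : R) : 0 < P -> (forall t, g (t + P) = g t) ->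
  forall a t, exists2 r, 0 <= r < P & g (a + r) = g t.
Proof.
move=> P0 per a t; pose n := Num.floor ((t - a) / P).
have /andP[h1 h2] := floor_itv ((t - a) / P); rewrite -/n in h1 h2.
exists (t - a - P * n%:~R).
  move: h1 h2; rewrite ler_pdivlMr // ltr_pdivrMr // intrD mulrDl mul1r mulrC => h1 h2.
  by apply/andP; split; lra.
have -> : a + (t - a - P * n%:~R) = t + P * (- n)%:~R by rewrite mulrNz; ring.
exact: periodic_int.
Qed.

(** From a point of the cycle the solution is forced along the upper arc, then along the lower one,
    and so on for all later times. The given period [P] is not assumed to be the duration [T] of the
    loop. *)
Lemma cycle_range g P tau t s : sol g -> 0 < P -> (forall t, g (t + P) = g t) ->
  crossing_cycle t s -> g tau = (Aup t, 0) -> range g = loop t s.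
Proof.
move=> sg P0 per [tp sp EA EB A0 B0] E.
have p0 := @pi_gt0 R.
have B0' : Blow s < - 2 by rewrite -EB.
pose T := t + (2 * pi - s).
have T0 : 0 < T by case/andP: tp sp => t0 _ /andP[_ s0]; rewrite /T; lra.
have upE tau' : g tau' = (Aup t, 0) -> g (tau' + t) = (Blow s, 0).
  by move=> E'; rewrite (up_end sg tp A0 E') EB.
have perT tau' : g tau' = (Aup t, 0) -> g (tau' + T) = (Aup t, 0).
  by move=> /upE E'; rewrite addrA (low_end sg sp B0' E') EA.
have perTn (n : nat) : g (tau + T * n%:R) = (Aup t, 0).
  elim: n => [|n IH]; first by rewrite mulr0 addr0.
  by rewrite -natr1 mulrDr mulr1 addrA perT.
apply/seteqP; split=> [z [t' _ <-]|z].
  (* Only times after [tau] are controlled, and the period [P] brings every other time there. *)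
  have [r /andP[r0 _] <-] := periodic_reduce P0 per tau t'.
  pose n := Num.floor (r / T).
  have /andP[h1 h2] := floor_itv (r / T); rewrite -/n in h1 h2.
  have n0 : 0 <= n by rewrite floor_ge0 divr_ge0 // ltW.
  move: n n0 h1 h2 => [n|//] _; rewrite intrD -!pmulrn => h1 h2.
  move: h1 h2; rewrite ler_pdivlMr // ltr_pdivrMr // mulrDl mul1r mulrC => h1 h2.
  pose r' := r - T * n%:R.
  have -> : tau + r = tau + T * n%:R + r' by rewrite /r'; ring.
  have E' := perTn n; have [rt|tr] := leP r' t.
    left; exists r'; first by rewrite rt andbT /r'; lra.
    by apply: half_up => //; rewrite rt andbT /r'; lra.
  have rT : 0 <= r' - t <= 2 * pi - s.
    by move: tr; rewrite /r' /T in h2 *; move=> tr; apply/andP; split; lra.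
  right; exists (r' - t) => //; rewrite EB -(half_low sg sp B0' (upE _ E') rT).
  by congr g; ring.
case=> [[r hr ->]|[r hr ->]].
  by exists (tau + r) => //; apply: half_up.
by exists (tau + t + r) => //; rewrite EB; apply: half_low => //; exact: upE.
Qed.

(** Both open half-planes are included whole: an orbit is constrained only where it meets the line,
    namely in one window with x > 0 and one with x < -2 when the parameters come from a [cycle_box].
    The escaping segment is left out. *)
Definition box_nbhd t1 t2 s1 s2 : set (R * R) :=
  [set z | [\/ z.2 < 0, 0 < z.2,
    [/\ Aup t1 < z.1, z.1 < Aup t2, Alow s1 < z.1 & z.1 < Alow s2] |
    [/\ Bup t2 < z.1, z.1 < Bup t1, Blow s2 < z.1 & z.1 < Blow s1]]].

Lemma continuous_fst : continuous (fun z : R * R => z.1).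
Proof. by move=> z; exact: cvg_fst. Qed.

Lemma continuous_snd : continuous (fun z : R * R => z.2).
Proof. by move=> z; exact: cvg_snd. Qed.

Lemma open_fst_gt (a : R) : open [set z : R * R | a < z.1].
Proof.
by apply: (@open_comp _ _ (fun z : R * R => z.1) [set x | a < x]);
  [move=> z _; exact: continuous_fst|exact: open_gt].
Qed.

Lemma open_fst_lt (a : R) : open [set z : R * R | z.1 < a].
Proof.
by apply: (@open_comp _ _ (fun z : R * R => z.1) [set x | x < a]);
  [move=> z _; exact: continuous_fst|exact: open_lt].
Qed.

Lemma open_snd_gt (a : R) : open [set z : R * R | a < z.2].
Proof.
by apply: (@open_comp _ _ (fun z : R * R => z.2) [set x | a < x]);
  [move=> z _; exact: continuous_snd|exact: open_gt].
Qed.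

Lemma open_snd_lt (a : R) : open [set z : R * R | z.2 < a].
Proof.
by apply: (@open_comp _ _ (fun z : R * R => z.2) [set x | x < a]);
  [move=> z _; exact: continuous_snd|exact: open_lt].
Qed.

Lemma open_box_nbhd t1 t2 s1 s2 : open (box_nbhd t1 t2 s1 s2).
Proof.
pose strip (a b c d : R) : set (R * R) := ([set z | a < z.1] `&` [set z | z.1 < b]) `&`
  ([set z | c < z.1] `&` [set z | z.1 < d]).
have ostrip a b c d : open (strip a b c d).
  apply: openI; apply: openI;
    do ?[exact: open_fst_gt|exact: open_fst_lt].
have -> : box_nbhd t1 t2 s1 s2 = ([set z | z.2 < 0] `|` [set z | 0 < z.2]) `|`
   (strip (Aup t1) (Aup t2) (Alow s1) (Alow s2) `|`
    strip (Bup t2) (Bup t1) (Blow s2) (Blow s1)).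
  apply/seteqP; split=> z /=.
    by case=> [h|h|[h1 h2 h3 h4]|[h1 h2 h3 h4]]; [left; left|left; right|right; left|right; right].
  by case=> [[h|h]|[[[h1 h2] [h3 h4]]|[[h1 h2] [h3 h4]]]];
    [apply: Or41|apply: Or42|apply: Or43|apply: Or44].
apply: openU; apply: openU => //; [exact: open_snd_lt|exact: open_snd_gt].
Qed.

Lemma loop_sub_nbhd e kappa t1 t2 s1 s2 t s : cycle_box e kappa t1 t2 s1 s2 ->
  t1 < t < t2 -> s1 < s < s2 -> Aup t = Alow s -> Bup t = Blow s ->
  loop t s `<=` box_nbhd t1 t2 s1 s2.
Proof.
move=> bx ht hs EA EB; have [tp sp _ _ A0 B0] := box_crossing_cycle bx ht hs EA EB.
case/andP: ht hs => ht1 ht2 /andP[hs1 hs2].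
have A : box_nbhd t1 t2 s1 s2 (Aup t, 0).
  apply: Or43; split=> /=; try by apply: (box_Aup_lt bx); rewrite ?lexx ?ltW.
    by rewrite EA; apply: (box_Alow_lt bx); rewrite ?lexx ?ltW.
  by rewrite EA; apply: (box_Alow_lt bx); rewrite ?lexx ?ltW.
have B : box_nbhd t1 t2 s1 s2 (Bup t, 0).
  apply: Or44; split=> /=; try by apply: (box_Bup_lt bx); rewrite ?lexx ?ltW.
    by rewrite EB; apply: (box_Blow_lt bx); rewrite ?lexx ?ltW.
  by rewrite EB; apply: (box_Blow_lt bx); rewrite ?lexx ?ltW.
move=> z [[r /andP[]]|[r /andP[]]].
  rewrite le_eqVlt => /predU1P[<- _ ->|r0]; first by rewrite /flow_up spiral0.
  rewrite le_eqVlt => /predU1P[-> ->|rt ->]; first by rewrite up_return.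
  by apply: Or42; apply: up_arc => //; rewrite r0.
rewrite le_eqVlt => /predU1P[<- _ ->|r0]; first by rewrite /flow_low spiral0.
rewrite le_eqVlt EB => /predU1P[-> ->|rt ->].
  by rewrite low_return -?EA //; apply/andP; split; lra.
by apply: Or41; apply: low_arc => //; rewrite r0.
Qed.

(* Look at the crossing of y = 0, x >= 0, at which the periodic orbit is the farthest from the
   cycle (the closest to it if [e = -1]): unless it is on the cycle, its return contradicts
   [box_return]. *)
Lemma box_unique e kappa t1 t2 s1 s2 t s G : cycle_box e kappa t1 t2 s1 s2 ->
  t1 < t < t2 -> s1 < s < s2 -> Aup t = Alow s -> Bup t = Blow s ->
  periodic_orbit (@Xup R) (@Xlow R) G -> G `<=` box_nbhd t1 t2 s1 s2 -> G = loop t s.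
Proof.
move=> bx ht hs EA EB [g [P [sg P0 per [t' gt'] EG]]] GU.
have cyc := box_crossing_cycle bx ht hs EA EB.
have [_ _ [_ t12 _] [_ s12 _] _ _ _ _ _ _ A0 B0] := bx.
have inU tau : box_nbhd t1 t2 s1 s2 (g tau) by apply: GU; rewrite EG; exists tau.
have onA tau : (g tau).2 = 0 -> 0 <= (g tau).1 ->
    exists t s, [/\ t1 < t < t2, s1 < s < s2, g tau = (Aup t, 0) & g tau = (Alow s, 0)].
  move=> y0 x0; case: (inU tau); rewrite ?y0 ?ltxx // => -[h1 h2 h3 h4]; last first.
    by move: x0 h2 B0; clear; lra.
  have [||z /andP[z1 z2] Ez] := @ivt_le _ (@Aup R) t1 t2 (g tau).1 (ltW t12).
  - by move=> x; rewrite in_itv => /(box_up_range bx); exact: Aup_continuous.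
  - by rewrite !ltW.
  have [||w /andP[w1 w2] Ew] := @ivt_le _ (@Alow R) s1 s2 (g tau).1 (ltW s12).
  - by move=> x; rewrite in_itv => /(box_low_range0 bx); exact: Alow_continuous.
  - by rewrite !ltW.
  exists z, w; rewrite Ez Ew -y0 -surjective_pairing; split=> //.
    rewrite !lt_neqAle z1 z2 !andbT; apply/andP; split; apply/eqP => h.
      by move: h1; rewrite -Ez h ltxx.
    by move: h2; rewrite -Ez h ltxx.
  rewrite !lt_neqAle w1 w2 !andbT; apply/andP; split; apply/eqP => h.
    by move: h3; rewrite -Ew h ltxx.
  by move: h4; rewrite -Ew h ltxx.
have onB tau : (g tau).2 = 0 -> (g tau).1 < 0 ->
    exists2 s, s1 < s < s2 & g tau = (Blow s, 0).
  move=> y0 x0; case: (inU tau); rewrite ?y0 ?ltxx // => -[h1 h2 h3 h4].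
    by move: x0 h3 A0; clear; lra.
  have [||w /andP[w1 w2] Ew] := @ivt_ge _ (@Blow R) s1 s2 (g tau).1 (ltW s12).
  - by move=> x; rewrite in_itv => /(box_low_range0 bx); exact: Blow_continuous.
  - by rewrite !ltW.
  exists w; last by rewrite Ew -y0 -surjective_pairing.
  rewrite !lt_neqAle w1 w2 !andbT; apply/andP; split; apply/eqP => h.
    by move: h4; rewrite -Ew h ltxx.
  by move: h3; rewrite -Ew h ltxx.
have toA tau s' : s1 < s' < s2 -> g tau = (Blow s', 0) -> (g tau).1 < - 2 ->
    g (tau + (2 * pi - s')) = (Alow s', 0) /\ 0 < Alow s'.
  move=> /andP[h1 h2] E B; split; last by apply: (box_Alow_right bx) => //; exact: ltW.
  by apply: low_end => //; [apply: (box_low_range bx); rewrite !ltW|rewrite E in B].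
have onB' tau : (g tau).2 = 0 -> (g tau).1 < 0 -> (g tau).1 < - 2.
  move=> y0 x0; case: (inU tau); rewrite ?y0 ?ltxx // => -[h1 h2 h3 h4].
    by move: x0 h3 A0; clear; lra.
  exact: lt_trans B0.
(* An orbit that misses the line keeps one sign. Above the line the virtual focus forbids this;
   below it the orbit would be the constant focus. *)
have [tau ytau] : exists tau, (g tau).2 = 0.
  apply: contrapT => /forallNP nz.
  have sgn (e' : R) a b : 0 < e' * (g a).2 -> e' != 0 -> a <= b -> 0 < e' * (g b).2.
    move=> ea e0 ab; rewrite ltNge; apply/negP => eb.
    have [|c [_ + _]] := first_zero (f := fun x => e' * (g x).2) ab _ ea eb.
      by move=> z _; apply: cvgMr; exact: sol_continuous2.
    by move/eqP; rewrite mulf_eq0 (negbTE e0) /= => /eqP/nz.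
  have all (e' : R) : e' != 0 -> 0 < e' * (g 0).2 -> forall x, 0 < e' * (g x).2.
    move=> e0 h x; have [r /andP[r0 _] <-] := periodic_reduce P0 per 0 x.
    by apply: (sgn _ 0) => //; rewrite add0r.
  have [h|h|/nz//] := ltgtP (g 0).2 0.
    have neg x : (g x).2 < 0.
      rewrite -oppr_gt0 -mulN1r; apply: all; last by rewrite mulN1r oppr_gt0.
      by rewrite oppr_eq0 oner_neq0.
    by move: gt'; rewrite !(sol_periodic_low sg P0 per neg) eqxx.
  by apply: (sol_not_up sg) => x; rewrite -[X in _ < X]mul1r; apply: all;
    rewrite ?oner_neq0 ?mul1r.
(* The weak inequality makes this set of crossing times closed; inside the neighbourhood no crossing
   has abscissa 0. *)
pose Z := [set x | 0 <= x <= P /\ ((g x).2 = 0 /\ 0 <= (g x).1)].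
have Zex x : (g x).2 = 0 -> 0 <= (g x).1 -> exists2 y, Z y & g y = g x.
  move=> y0 x0; have [r /andP[r0 rP] E] := periodic_reduce P0 per 0 x.
  by exists r; rewrite add0r in E; rewrite /Z /= E //; rewrite r0 ltW.
have Z0 : Z !=set0.
  have [x0|x0] := leP 0 (g tau).1.
    by have [y Zy _] := Zex _ ytau x0; exists y.
  have [s' hs' E] := onB _ ytau x0.
  have [E' pos] := toA _ _ hs' E (onB' _ ytau x0).
  have [||y Zy _] := Zex (tau + (2 * pi - s')); rewrite ?E' //=; first exact: ltW.
  by exists y.
have cZ : compact Z.
  apply: (subclosed_compact _ (@segment_compact R 0 P)); last first.
    by move=> x [h _] /=; rewrite in_itv.
  have -> : Z = [set` `[0, P]] `&` (((fun x => (g x).2) @^-1` [set y | y = 0]) `&`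
                             ((fun x => (g x).1) @^-1` [set y | 0 <= y])).
    by apply/seteqP; split=> x /=; rewrite in_itv.
  apply: closedI; first exact: interval_closed.
  apply: closedI; apply: preimage_closed.
  - by move=> x _; exact: sol_continuous2.
  - exact: closed_eq.
  - by move=> x _; exact: sol_continuous1.
  - exact: closed_ge.
have ch : {within Z, continuous (fun x => e * `|(g x).1 - Aup t|)}.
  apply: continuous_subspaceT => x; apply: cvgMr; apply: cvg_norm; apply: cvgB.
    exact: sol_continuous1.
  exact: cvg_cst.
have [c] := compact_EVT_max Z0 cZ ch.
rewrite inE => -[_ [yc xc]] hmax.
have [t'' [s'' [ht'' hs'' Ec1 Ec2]]] := onA _ yc xc.
have Ec : Aup t'' = Aup t.
  apply/eqP/negPn/negP => neq.
  case/andP: (ht'') (hs'') => t1t'' t''t2 /andP[s1s'' s''s2].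
  have t''p : 0 < t'' < pi by apply: (box_up_range bx); rewrite !ltW.
  have At'' : 0 < Aup t''.
    by move: Ec1; rewrite Ec2 => -[<-]; apply: (box_Alow_right bx) => //; exact: ltW.
  have Bt'' : Bup t'' < - 2 by apply: (box_Bup_left bx) => //; exact: ltW.
  have E1 := up_end sg t''p At'' Ec1.
  have yB : (g (c + t'')).2 = 0 by rewrite E1.
  have xB : (g (c + t'')).1 < 0 by rewrite E1 /=; move: Bt''; clear; lra.
  have [w hw Ew] := onB _ yB xB.
  have EBw : Bup t'' = Blow w by move: Ew; rewrite E1 => -[].
  have [E2 pos] := toA _ _ hw Ew (onB' _ yB xB).
  have lt := box_return bx ht hs EA EB ht'' hw EBw neq.
  have yC : (g (c + t'' + (2 * pi - w))).2 = 0 by rewrite E2.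
  have xC : 0 <= (g (c + t'' + (2 * pi - w))).1 by rewrite E2 ltW.
  have [y Zy Ey] := Zex _ yC xC.
  have := hmax y; rewrite inE => /(_ Zy).
  by rewrite Ey E2 Ec1 leNgt lt.
by rewrite EG; apply: (cycle_range sg P0 per cyc (tau := c)); rewrite Ec1 Ec.
Qed.

End Cycles.

(** * Realization of a crossing cycle by a periodic Filippov solution *)

Section PeriodicSolution.
Context {R : realType}.
Implicit Types (s t x y : R).

Definition lipschitz_on M a b (g : R -> R * R) :=
  forall x y, a <= x -> x <= y -> y <= b -> `|g y - g x| <= M * (y - x).

Lemma spiral_lipschitz m u v q a b :
  exists2 M, 0 <= M & lipschitz_on M a b (spiral m u v q).
Proof.
have c1 : continuous (fun t => (spiral m u v q t).1).
  by move=> t; exact: (is_derive_continuous (spiral_derive1 m u v q t)).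
have c2 : continuous (fun t => (spiral m u v q t).2).
  by move=> t; exact: (is_derive_continuous (spiral_derive2 m u v q t)).
have [|M1 M10 h1] := C1_lipschitz a b (spiral_derive1 m u v q).
  move=> t; apply: cvgB; first apply: cvgMr; apply: cvgB; try exact: cvg_cst.
    exact: c1.
  exact: c2.
have [|M2 M20 h2] := C1_lipschitz a b (spiral_derive2 m u v q).
  move=> t; apply: cvgD; last apply: cvgMr; apply: cvgB; try exact: cvg_cst.
    exact: c1.
  exact: c2.
exists (M1 + M2) => [|x y ax xy yb]; first exact: addr_ge0.
have k1 := h1 _ _ ax xy yb; have k2 := h2 _ _ ax xy yb.
have xy0 : 0 <= y - x by rewrite subr_ge0.
rewrite prod_normE ge_max mulrDl; apply/andP; split.
  by apply: le_trans k1 _; rewrite lerDl mulr_ge0.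
by apply: le_trans k2 _; rewrite lerDr mulr_ge0.
Qed.

Lemma lipschitz_glue M a b c (g : R -> R * R) :
  lipschitz_on M a c g -> lipschitz_on M c b g -> lipschitz_on M a b g.
Proof.
move=> h1 h2 x y ax xy yb; have [yc|cy] := leP y c; first exact: h1.
have [cx|xc] := leP c x; first exact: h2.
rewrite -(subrKA (g c)) -[y - x](subrKA c) mulrDr.
apply: le_trans (ler_normD _ _) _; apply: lerD.
  by apply: h2 => //; exact: ltW.
by apply: h1 => //; exact: ltW.
Qed.

Lemma lipschitz_on_eq M a b (g h : R -> R * R) : lipschitz_on M a b g ->
  (forall x, a <= x <= b -> g x = h x) -> lipschitz_on M a b h.
Proof.
move=> lg gh x y ax xy yb; rewrite -!gh ?ax ?yb ?andbT //; first exact: lg.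
  exact: le_trans yb.
exact: le_trans xy.
Qed.

Lemma lipschitz_on_le M N a b (g : R -> R * R) : M <= N -> lipschitz_on M a b g ->
  lipschitz_on N a b g.
Proof.
move=> MN h x y ax xy yb; apply: le_trans (h _ _ ax xy yb) _.
by rewrite ler_wpM2r // subr_ge0.
Qed.

Definition periodize (T : R) (h : R -> R * R) x := h (x - T * (Num.floor (x / T))%:~R).

Lemma periodize_period (T : R) h x : 0 < T -> periodize T h (x + T) = periodize T h x.
Proof.
move=> T0; rewrite /periodize.
have -> : Num.floor ((x + T) / T) = Num.floor (x / T) + 1.
  apply: floor_def; rewrite mulrDl divff ?gt_eqF // !intrD !lerD2r !ltrD2r.
  by have := floor_itv (x / T); rewrite intrD.
by congr h; rewrite intrD; ring.
Qed.

Lemma periodize_rem (T : R) x : 0 < T -> 0 <= x - T * (Num.floor (x / T))%:~R < T.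
Proof.
move=> T0; have := floor_itv (x / T); rewrite intrD ler_pdivlMr // ltr_pdivrMr //.
by rewrite mulrDl mul1r mulrC => /andP[h1 h2]; apply/andP; split; lra.
Qed.

Lemma periodizeE (T : R) h (n : int) x : 0 < T -> T * n%:~R <= x < T * (n%:~R + 1) ->
  periodize T h x = h (x - T * n%:~R).
Proof.
move=> T0 /andP[h1 h2]; rewrite /periodize; congr (h (_ - _ * _%:~R)).
apply: floor_def; rewrite intrD ler_pdivlMr // ltr_pdivrMr // mulrC h1 /=.
by rewrite mulrC.
Qed.

(** For times in different periods, the value [h T = h 0] serves as an intermediate point: the rest
    of the first period and the elapsed part of the last one add up to at most y - x, so the
    constant is preserved. *)
Lemma periodize_lipschitz (T M : R) h : 0 < T -> 0 <= M -> h T = h 0 ->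
  lipschitz_on M 0 T h -> forall a b, lipschitz_on M a b (periodize T h).
Proof.
move=> T0 M0 hT lip a b x y _ xy _; rewrite /periodize.
have /andP[rx0 rxT] := periodize_rem x T0; have /andP[ry0 ryT] := periodize_rem y T0.
set n := Num.floor (x / T) in rx0 rxT *; set k := Num.floor (y / T) in ry0 ryT *.
set rx := x - _ in rx0 rxT *; set ry := y - _ in ry0 ryT *.
have nk : n <= k.
  rewrite /k floor_ge_int; apply: le_trans (floor_le _) _.
  by rewrite ler_pM2r ?invr_gt0.
move: nk; rewrite le_eqVlt => /predU1P[E|nk].
  have -> : y - x = ry - rx by rewrite /rx /ry E; ring.
  by apply: lip => //; [rewrite /rx /ry E lerD2r|exact: ltW].
have nk1 : n%:~R + 1 <= k%:~R :> R by rewrite -(intrD _ n 1) ler_int lezD1.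
have d : (T - rx) + ry <= y - x.
  have : T * (n%:~R + 1) <= T * k%:~R by rewrite ler_pM2l.
  by rewrite /rx /ry; lra.
rewrite -(subrKA (h 0)); apply: le_trans (ler_normD _ _) _.
apply: (@le_trans _ _ (M * (T - rx + ry))); last by rewrite ler_wpM2l.
rewrite addrC mulrDr; apply: lerD.
  by rewrite -hT; apply: lip => //; exact: ltW.
by have := lip 0 ry; rewrite subr0; apply => //; exact: ltW.
Qed.

Lemma spiral_shift_derive m u v q k x :
  is_derive x 1 (fun y => spiral m u v q (y - k)) (spiral_field m u v (spiral m u v q (x - k))).
Proof. apply: is_derive_pair; derive_tac; rewrite /=; ring. Qed.

Lemma near_shift_derive m u v q k (g : R -> R * R) a b x : a < x < b ->
  (forall y, a < y < b -> g y = spiral m u v q (y - k)) ->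
  derivable g x 1 /\ 'D_1 g x = spiral_field m u v (g x).
Proof.
move=> xab E; rewrite (E _ xab).
suff h : is_derive x 1 g (spiral_field m u v (spiral m u v q (x - k))).
  by split; [exact: ex_derive|exact: derive_val].
apply: near_eq_is_derive (spiral_shift_derive m u v q k x).
have : `]a, b[%classic x by rewrite /= in_itv.
have /open_nbhs_nbhs h : open_nbhs x `]a, b[%classic.
  by split; [exact: interval_open|rewrite /= in_itv].
move=> _; apply: filterS h => y /=; rewrite in_itv /= => yab.
by rewrite E.
Qed.

Variables (t s : R).
Hypothesis cyc : crossing_cycle t s.

Let T := t + (2 * pi - s).

Definition arc_pair x : R * R :=
  if x <= t then flow_up (Aup t, 0) x else flow_low (Bup t, 0) (x - t).

Definition cycle_sol := periodize T arc_pair.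

Lemma period_gt0 : 0 < T.
Proof.
have p0 := @pi_gt0 R; case: cyc => /andP[t0 _] /andP[_ sp] _ _ _ _.
by rewrite /T; lra.
Qed.

Lemma arc_pair0 : arc_pair 0 = (Aup t, 0).
Proof.
case: cyc => /andP[t0 _] _ _ _ _ _.
by rewrite /arc_pair ltW // /flow_up spiral0.
Qed.

Lemma arc_pair_low x : t <= x -> arc_pair x = flow_low (Bup t, 0) (x - t).
Proof.
case: cyc => tp _ _ _ _ _; rewrite /arc_pair le_eqVlt => /predU1P[<-|tx].
  by rewrite lexx subrr /flow_low spiral0 up_return.
by rewrite leNgt tx.
Qed.

Lemma arc_pairT : arc_pair T = arc_pair 0.
Proof.
have p0 := @pi_gt0 R; case: (cyc) => tp /andP[s0 sp] EA EB _ _.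
rewrite arc_pair0 arc_pair_low; last by rewrite /T; lra.
rewrite /T addrC addKr EB low_return ?EA //; apply/andP; split; lra.
Qed.

Lemma arc_pair_lipschitz : exists2 M, 0 <= M & lipschitz_on M 0 T arc_pair.
Proof.
have [M1 M10 h1] := @spiral_lipschitz (3 / 8) (67 / 50) (- (833 / 125)) (Aup t, 0) 0 t.
have [M2 M20 h2] := @spiral_lipschitz (- (1 / 5)) (- (1 / 5)) (- (49 / 50)) (Bup t, 0) 0 (2 * pi - s).
exists (M1 + M2); first exact: addr_ge0.
apply: (@lipschitz_glue _ 0 T t).
  apply: (@lipschitz_on_le M1); first by rewrite lerDl.
  by apply: lipschitz_on_eq h1 _ => x /andP[_ xt]; rewrite /arc_pair xt.
apply: (@lipschitz_on_le M2); first by rewrite lerDr.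
move=> x y tx xy yT; rewrite !arc_pair_low //; last exact: le_trans xy.
have := h2 (x - t) (y - t); rewrite opprB addrA subrK; apply.
- by rewrite subr_ge0.
- by rewrite lerD2r.
- by rewrite lerBlDr addrC.
Qed.

Lemma cycle_sol_filippov : filippov_solution (@Xup R) (@Xlow R) cycle_sol.
Proof.
have T0 := period_gt0; have p0 := @pi_gt0 R.
have [tp sp EA EB _ _] := cyc.
have tT : t < T by case/andP: sp => _ ?; rewrite /T; lra.
split=> [a b|].
  have [M M0 lip] := arc_pair_lipschitz.
  apply: (lipschitz_ac (M := M)).
  exact: (periodize_lipschitz T0 M0 arc_pairT lip).
(* The exceptional times are the countably many switching times, at the starts of the upper
   ([false]) and of the lower ([true]) arcs. *)
pose f (nb : int * bool) : R := T * nb.1%:~R + (if nb.2 then t else 0).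
have cf : countable (range f).
  by apply: sub_countable (card_image_le f setT) (countableP setT).
exists (range f); split.
- by apply: countable_measurable => // x; exact: measurable_set1.
- exact: countable_lebesgue_measure0.
move=> x /= bad; apply: contrapT => nE; apply: bad.
set n := Num.floor (x / T).
have /andP[] := periodize_rem x T0; rewrite -/n le_eqVlt => /predU1P[h|r0] rT.
  by case: nE; exists (n, false) => //; rewrite /f /=; lra.
have gx : cycle_sol x = arc_pair (x - T * n%:~R) by [].
have [rt|tr|E] := ltgtP (x - T * n%:~R) t; last first.
- by case: nE; exists (n, true) => //; rewrite /f /= -E; ring.
- have h y : T * n%:~R + t < y < T * n%:~R + T ->
      cycle_sol y = flow_low (Bup t, 0) (y - (T * n%:~R + t)).
    have t0 : 0 < t by case/andP: tp.
    move=> /andP[h1 h2]; rewrite /cycle_sol (@periodizeE T _ n) //; last first.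
      by rewrite mulrDr mulr1 h2 andbT; lra.
    by rewrite arc_pair_low; [congr flow_low; ring|lra].
  have xab : T * n%:~R + t < x < T * n%:~R + T by apply/andP; split; lra.
  have [dg Dg] := near_shift_derive xab h; split=> //; rewrite Dg.
  have neg : (cycle_sol x).2 < 0.
    rewrite h // EB; apply: low_arc => //; rewrite /T in xab.
    by case/andP: xab => *; rewrite /T; apply/andP; split; lra.
  by rewrite /filippov ltNge (ltW neg) /= neg.
have h y : T * n%:~R < y < T * n%:~R + t ->
    cycle_sol y = flow_up (Aup t, 0) (y - T * n%:~R).
  move=> /andP[h1 h2]; rewrite /cycle_sol (@periodizeE T _ n) //; last first.
    by rewrite mulrDr mulr1; apply/andP; split; lra.
  by rewrite /arc_pair ifT //; lra.
have xab : T * n%:~R < x < T * n%:~R + t by apply/andP; split; lra.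
have [dg Dg] := near_shift_derive xab h; split=> //; rewrite Dg.
have pos : 0 < (cycle_sol x).2.
  rewrite h //; apply: up_arc => //.
  by case/andP: xab => *; apply/andP; split; lra.
by rewrite /filippov pos.
Qed.

Lemma cycle_sol_period x : cycle_sol (x + T) = cycle_sol x.
Proof. exact: periodize_period period_gt0. Qed.

Lemma cycle_sol0 : cycle_sol 0 = (Aup t, 0).
Proof.
by rewrite /cycle_sol (@periodizeE T _ 0) ?period_gt0 // ?mulr0 ?subr0 ?arc_pair0 //
  lexx add0r mulr1 period_gt0.
Qed.

Lemma cycle_sol_arc x : 0 <= x < T -> cycle_sol x = arc_pair x.
Proof.
move=> xT; rewrite /cycle_sol (@periodizeE T _ 0) ?period_gt0 // ?mulr0 ?subr0 //.
by rewrite add0r mulr1.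
Qed.

Lemma range_cycle_sol : range cycle_sol = loop t s.
Proof.
exact: (cycle_range cycle_sol_filippov period_gt0 cycle_sol_period cyc cycle_sol0).
Qed.

Lemma loop_periodic_orbit : periodic_orbit (@Xup R) (@Xlow R) (loop t s).
Proof.
exists cycle_sol, T; split.
- exact: cycle_sol_filippov.
- exact: period_gt0.
- exact: cycle_sol_period.
- exists t; rewrite cycle_sol0 -[t in cycle_sol t]add0r.
  case: (cyc) => tp _ _ _ A0 B0.
  rewrite (up_end cycle_sol_filippov tp A0 cycle_sol0).
  by apply/eqP => -[E]; lra.
- by rewrite range_cycle_sol.
Qed.

End PeriodicSolution.

(** * The inside of a closed curve that goes down once and up once *)

Section BimonotoneLoop.
Context {R : realType}.

(** At every height close to that of z the monotone branch has a point with parameter close to t.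
    Half of the horizontal margin absorbs the variation of x along the branch, the other half that
    of the point z. *)
Lemma open_side (e : R) (x y : R -> R) a b : continuous x -> continuous y ->
  (forall s t, a <= s -> s < t -> t <= b -> y s < y t) ->
  open [set z : R * R | exists t : R, [/\ a < t < b, y t = z.2 & 0 < e * (z.1 - x t)]].
Proof.
move=> cx cy iy; rewrite openE => z [t [/andP[at_ tb] yt ext]].
pose eta := e * (z.1 - x t) / 2.
have eta0 : 0 < eta by rewrite divr_gt0.
have cf : {for t, continuous (fun s => e * (z.1 - x s))}.
  by apply: cvgMr; apply: cvgB; [exact: cvg_cst|exact: cx].
have : \forall s \near t, eta < e * (z.1 - x s).
  by apply: (cf [set y | eta < y]); apply: lt_nbhsr; rewrite /eta; lra.
move=> /nbhs_ballP[r /= r0 hr].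
pose d := Num.min (r / 2) (Num.min ((t - a) / 2) ((b - t) / 2)).
have d0 : 0 < d by rewrite !lt_min !divr_gt0 ?subr_gt0.
have dr : d <= r / 2 by rewrite ge_min lexx.
have da : d <= (t - a) / 2 by rewrite !ge_min lexx !orbT.
have db : d <= (b - t) / 2 by rewrite !ge_min lexx !orbT.
have y1 : y (t - d) < z.2 by rewrite -yt; apply: iy; lra.
have y2 : z.2 < y (t + d) by rewrite -yt; apply: iy; lra.
pose W := ([set w : R * R | y (t - d) < w.2] `&` [set w | w.2 < y (t + d)]) `&`
  (fun w : R * R => e * (w.1 - z.1)) @^-1` [set c | - eta < c].
have oW : open W.
  apply: openI; first by apply: openI; [exact: open_snd_gt|exact: open_snd_lt].
  apply: open_comp; last exact: open_gt.
  move=> w _; apply: cvgMr; apply: cvgB; last exact: cvg_cst.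
  exact: continuous_fst.
have Wz : W z by split; [split|rewrite /= subrr mulr0 oppr_lt0].
apply: filterS (open_nbhs_nbhs (conj oW Wz)) => w [[w1 w2] w3].
have tt : t - d <= t + d by lra.
have [||s /andP[s1 s2] ys] := @ivt_le _ y (t - d) (t + d) w.2 tt.
- by move=> v _; exact: cy.
- by rewrite !ltW.
exists s; split=> //; first by apply/andP; split; lra.
have : eta < e * (z.1 - x s).
  by apply: hr; rewrite /ball /= ltr_norml; apply/andP; split; lra.
by move: w3; rewrite /= => w3; lra.
Qed.

Variables (g : R -> R * R) (p q T : R).
Hypothesis cg1 : continuous (fun t => (g t).1).
Hypothesis cg2 : continuous (fun t => (g t).2).
Hypothesis T0 : 0 < T.
Hypothesis per : forall t, g (t + T) = g t.
Hypothesis pq : p < q.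
Hypothesis qp : q < p + T.
Hypothesis down : forall s t, p <= s -> s < t -> t <= q -> (g t).2 < (g s).2.
Hypothesis up : forall s t, q <= s -> s < t -> t <= p + T -> (g s).2 < (g t).2.

(* The point z lies strictly to the right of the descending branch and to the left of the
   ascending one. *)
Definition between : set (R * R) := [set z |
  (exists t, [/\ p < t < q, (g t).2 = z.2 & (g t).1 < z.1]) /\
  (exists t, [/\ q < t < p + T, (g t).2 = z.2 & z.1 < (g t).1])].

(* A compact set that contains [between] and is contained in its union with the curve. *)
Definition hull : set (R * R) :=
  (fun w : (R * R) * R => ((1 - w.2) * (g w.1.1).1 + w.2 * (g w.1.2).1, (g w.1.1).2)) @`
  ((([set` `[p, q]] `*` [set` `[q, p + T]]) `*` [set` `[0 : R, 1]]) `&`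
   ((fun w => (g w.1.1).2 - (g w.1.2).2) @^-1` [set y | y = 0] `&`
    (fun w => (g w.1.2).1 - (g w.1.1).1) @^-1` [set y | 0 <= y])).

Lemma open_between : open between.
Proof.
(* Time is reversed on the descending branch, so that [open_side] applies to it as well. *)
have c1 : continuous (fun t : R => (g (- t)).1).
  by move=> t; apply: (continuous_comp (f := -%R) (g := fun t => (g t).1));
    [exact: opp_continuous|exact: cg1].
have c2 : continuous (fun t : R => (g (- t)).2).
  by move=> t; apply: (continuous_comp (f := -%R) (g := fun t => (g t).2));
    [exact: opp_continuous|exact: cg2].
have mono (s t : R) : - q <= s -> s < t -> t <= - p -> (g (- s)).2 < (g (- t)).2.
  by move=> qs st tp; apply: down; rewrite ?ltrN2; lra.
have := openI (open_side (e := 1) c1 c2 mono) (open_side (e := -1) cg1 cg2 up).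
set S := (X in open X); suff -> : S = between by [].
apply/seteqP; split=> z [[t [/andP[t1 t2] yt xt]] [t' [t'q yt' xt']]]; split.
- exists (- t); split=> //; last by rewrite -subr_gt0 -[ltRHS]mul1r.
  by apply/andP; split; lra.
- by exists t'; split=> //; move: xt'; lra.
- exists (- t); rewrite opprK mul1r subr_gt0; split=> //.
  by rewrite !ltrN2 t1 t2.
- by exists t'; rewrite mulN1r opprB subr_gt0.
Qed.

Lemma compact_hull : compact hull.
Proof.
have cc (k : R -> R) (f : (R * R) * R -> R) : continuous k -> continuous f ->
    continuous (fun w => k (f w)).
  by move=> ck cf w; apply: (continuous_comp (f := f) (g := k)); [exact: cf|exact: ck].
have c11 : continuous (fun w : (R * R) * R => w.1.1).
  move=> w; apply: (continuous_comp (f := fst) (g := fst)); exact: cvg_fst.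
have c12 : continuous (fun w : (R * R) * R => w.1.2).
  move=> w; apply: (continuous_comp (f := fst) (g := snd)).
    exact: cvg_fst.
  exact: cvg_snd.
have c2 : continuous (fun w : (R * R) * R => w.2) by move=> w; exact: cvg_snd.
apply: continuous_compact.
  have cx : continuous (fun w : (R * R) * R =>
      (1 - w.2) * (g w.1.1).1 + w.2 * (g w.1.2).1).
    move=> w; apply: cvgD; apply: cvgM.
    - by apply: cvgB; [exact: cvg_cst|exact: c2].
    - exact: (cc _ _ cg1 c11).
    - exact: c2.
    - exact: (cc _ _ cg1 c12).
  apply: continuous_subspaceT => w.
  exact: (cvg_pair (cx w) (cc _ _ cg2 c11 w)).
apply: compact_closedI.
  apply: compact_setX; last exact: segment_compact.
  by apply: compact_setX; exact: segment_compact.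
apply: closedI; apply: preimage_closed.
- by move=> w _; apply: cvgB; [exact: (cc _ _ cg2 c11)|exact: (cc _ _ cg2 c12)].
- exact: closed_eq.
- by move=> w _; apply: cvgB; [exact: (cc _ _ cg1 c12)|exact: (cc _ _ cg1 c11)].
- exact: closed_ge.
Qed.

Lemma between_hull : between `<=` hull.
Proof.
move=> z [[t [/andP[t1 t2] yt xt]] [t' [/andP[t1' t2'] yt' xt']]].
have xx : (g t).1 < (g t').1 by exact: lt_trans xt'.
exists ((t, t'), (z.1 - (g t).1) / ((g t').1 - (g t).1)).
  split; last by split=> /=; rewrite ?yt ?yt' ?subrr // subr_ge0 ltW.
  do 2?split; rewrite /= in_itv /= ?(ltW t1) ?(ltW t2) ?(ltW t1') ?(ltW t2') //.
  rewrite divr_ge0 ?subr_ge0 ?(ltW xt) ?(ltW xx) //= ler_pdivrMr ?subr_gt0 //.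
  by rewrite mul1r lerD2r ltW.
rewrite /= [RHS]surjective_pairing yt; congr pair.
by field; rewrite subr_eq0 gt_eqF.
Qed.

Lemma down_inj s t : p <= s <= q -> p <= t <= q -> (g s).2 = (g t).2 -> s = t.
Proof.
move=> /andP[s1 s2] /andP[t1 t2] E; have [h|h|//] := ltgtP s t.
  by move: (down s1 h t2); rewrite E ltxx.
by move: (down t1 h s2); rewrite E ltxx.
Qed.

Lemma up_inj s t : q <= s <= p + T -> q <= t <= p + T -> (g s).2 = (g t).2 -> s = t.
Proof.
move=> /andP[s1 s2] /andP[t1 t2] E; have [h|h|//] := ltgtP s t.
  by move: (up s1 h t2); rewrite E ltxx.
by move: (up t1 h s2); rewrite E ltxx.
Qed.

(** The degenerate points of the hull lie on the curve: the ends of a horizontal segment do, and at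
    the top and the bottom, where the two branches meet, the segment is a single point. *)
Lemma hull_between z : hull z -> ~ range g z -> between z.
Proof.
move=> [[[t t'] l] /= [[[]]]]; rewrite /= !in_itv /=.
move=> /andP[pt tq] /andP[qt' t'p] /andP[l0 l1] [/= /eqP yy xx] <- ng.
move: yy; rewrite subr_eq0 => /eqP yy; rewrite subr_ge0 in xx.
have lx : (g t).1 < (g t').1.
  rewrite lt_neqAle xx andbT; apply/eqP => E; apply: ng; exists t => //.
  by rewrite [LHS]surjective_pairing -E; congr pair; ring.
have l0' : 0 < l.
  rewrite lt_neqAle l0 andbT; apply/eqP => E; apply: ng; exists t => //.
  by rewrite [LHS]surjective_pairing -E; congr pair; ring.
have l1' : l < 1.
  rewrite lt_neqAle l1 andbT; apply/eqP => E; apply: ng; exists t' => //.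
  by rewrite [LHS]surjective_pairing E -yy; congr pair; ring.
have top : t = p -> False.
  move=> E; have : t' = p + T.
    apply: up_inj; [by rewrite qt'|by rewrite lexx ltW|by rewrite -yy E per].
  by move=> E'; move: lx; rewrite E E' per ltxx.
have bot : t = q -> False.
  move=> E; have : t' = q.
    apply: up_inj; [by rewrite qt'|by rewrite lexx ltW|by rewrite -yy E].
  by move=> E'; move: lx; rewrite E E' ltxx.
have top' : t' = p + T -> False.
  move=> E; apply: top; apply: down_inj.
  - by rewrite pt.
  - by rewrite lexx ltW.
  - by rewrite yy E per.
have bot' : t' = q -> False.
  move=> E; apply: bot; apply: down_inj.
  - by rewrite pt.
  - by rewrite lexx ltW.
  - by rewrite yy E.
split.
  exists t; split=> //=; last by nra.
  by rewrite !lt_neqAle pt tq !andbT; apply/andP; split; apply/eqP => E; [exact: top|exact: bot].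
exists t'; split=> //=; last by nra.
by rewrite !lt_neqAle qt' t'p !andbT; apply/andP; split; apply/eqP => E; [exact: bot'|exact: top'].
Qed.

Lemma between_notin z : between z -> ~ range g z.
Proof.
move=> [[t [/andP[t1 t2] yt xt]] [t' [/andP[t1' t2'] yt' xt']]] [s' _ gs'].
have [r /andP[r0 rT] E] := periodic_reduce T0 per p s'.
have Ez : g (p + r) = z by rewrite E.
have [rq|qr] := leP (p + r) q.
  have Et : p + r = t.
    by apply: down_inj; rewrite ?rq ?(ltW t1) ?(ltW t2) ?andbT //; [lra|rewrite Ez yt].
  by move: xt; rewrite -Et Ez ltxx.
have Et : p + r = t'.
  apply: up_inj; rewrite ?(ltW qr) ?(ltW t1') ?(ltW t2') //; last by rewrite Ez yt'.
  by rewrite /=; lra.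
by move: xt'; rewrite -Et Ez ltxx.
Qed.

(** The trace of [between] on S is open in S, and also closed, because off the curve it coincides
    with the trace of the compact [hull]. *)
Lemma connected_between S : connected S -> S `<=` ~` range g -> S `&` between !=set0 ->
  S `<=` between.
Proof.
move=> cS SG [z [Sz Bz]].
have E : S `&` between = S.
  apply: cS; first by exists z.
    by exists between => //; exact: open_between.
  exists hull; first exact: compact_closed compact_hull.
  apply/seteqP; split=> w [Sw h]; split=> //; first exact: between_hull.
  by apply: hull_between => //; exact: SG.
by move=> w; rewrite -E => -[].
Qed.

Lemma between_inside : between `<=` inside (range g).
Proof.
move=> z Bz; split; first exact: between_notin.
have sub : connected_component (~` range g) z `<=` hull.
  apply: subset_trans between_hull; apply: connected_between.
  - exact: component_connected.
  - exact: connected_component_sub.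
  - by exists z; split=> //; apply: connected_component_refl; exact: between_notin.
have := compact_bounded compact_hull.
by apply: sub_boundedr => A h w /sub; exact: h.
Qed.

End BimonotoneLoop.

(** * Turning points of the cycles, and the position of the focus *)

Section LoopInside.
Context {R : realType}.
Implicit Types (m u v r w t s : R) (q : R * R).

(** The vertical speed along a spiral is an exponential times a sinusoid of period 2 pi. One zero w
    fixes the phase, hence its sign at all times. *)
Lemma spiral_turn m u v q w r : sin w != 0 ->
  (spiral_field m u v (spiral m u v q w)).2 = 0 ->
  (spiral_field m u v (spiral m u v q r)).2 =
  expR (m * r) * ((spiral_field m u v q).2 * (sin (w - r) / sin w)).
Proof.
move=> sw; rewrite /spiral /spiral_field /=.
have e0 : expR (m * w) != 0 by rewrite gt_eqF // expR_gt0.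
set P := q.1 - u; set Q := q.2 - v => h.
have : expR (m * w) * ((P + m * Q) * cos w + (m * P - Q) * sin w) = 0.
  by rewrite -h; ring.
move/eqP; rewrite mulf_eq0 (negbTE e0) /= => /eqP h'.
rewrite sinB; transitivity (expR (m * r) * ((P + m * Q) * cos r + (m * P - Q) * sin r)).
  by ring.
congr (_ * _); apply: (mulfI sw).
transitivity ((P + m * Q) * cos r * sin w + ((m * P - Q) * sin w) * sin r); first by ring.
have -> : (m * P - Q) * sin w = - ((P + m * Q) * cos w).
  by apply/eqP; rewrite -addr_eq0 addrC h'.
by field.
Qed.

Lemma spiral_up_lt m u v q a b :
  (forall r, a < r < b -> 0 < (spiral_field m u v (spiral m u v q r)).2) ->
  forall x y, a <= x -> x < y -> y <= b -> (spiral m u v q x).2 < (spiral m u v q y).2.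
Proof.
move=> h; apply: (derive_gt0_lt (fun x _ => spiral_derive2 m u v q x) h).
Qed.

Lemma spiral_down_lt m u v q a b :
  (forall r, a < r < b -> (spiral_field m u v (spiral m u v q r)).2 < 0) ->
  forall x y, a <= x -> x < y -> y <= b -> (spiral m u v q y).2 < (spiral m u v q x).2.
Proof.
move=> h x y ax xy yb; rewrite -ltrN2.
apply: (derive_gt0_lt (fun x _ => is_derive_opp (spiral_derive2 m u v q x)) _ ax xy yb).
by move=> z /h; rewrite oppr_gt0.
Qed.

Lemma spiral_field2_continuous m u v q :
  continuous (fun r => (spiral_field m u v (spiral m u v q r)).2).
Proof.
move=> r; apply: cvgD; last apply: cvgMr; apply: cvgB; try exact: cvg_cst.
  exact: (is_derive_continuous (spiral_derive1 m u v q r)).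
exact: (is_derive_continuous (spiral_derive2 m u v q r)).
Qed.

Lemma incr_glue (f : R -> R) a c b :
  (forall x y, a <= x -> x < y -> y <= c -> f x < f y) ->
  (forall x y, c <= x -> x < y -> y <= b -> f x < f y) ->
  forall x y, a <= x -> x < y -> y <= b -> f x < f y.
Proof.
move=> h1 h2 x y ax xy yb; have [yc|cy] := leP y c; first exact: h1.
have [cx|xc] := leP c x; first exact: h2.
by apply: (lt_trans (h1 _ _ ax xc (lexx _))); apply: h2.
Qed.

Variables (t s : R).
Hypothesis cyc : crossing_cycle t s.

Lemma up_top : exists w, [/\ 0 < w < t,
  forall r, 0 <= r < w -> 0 < (Xup (flow_up (Aup t, 0) r)).2 &
  forall r, w < r <= t -> (Xup (flow_up (Aup t, 0) r)).2 < 0].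
Proof.
have [/andP[t0 tp] _ _ _ A0 B0] := cyc.
have tpi : 0 < t < pi by rewrite t0.
pose D r := (Xup (flow_up (Aup t, 0) r)).2.
have D0p : 0 < D 0 by rewrite /D /flow_up spiral0 Xup2 /=; lra.
have Dtn : D t < 0 by rewrite /D up_return // Xup2 /=; lra.
have [|||w [/andP[w0 wt] Dw _]] := first_zero (f := D) (ltW t0).
- by move=> x _; exact: spiral_field2_continuous.
- exact: D0p.
- exact: ltW.
have wt' : w < t.
  by rewrite lt_neqAle wt andbT; apply/eqP => E; move: Dtn; rewrite -E Dw ltxx.
have sw : 0 < sin w by apply: sin_pi_gt0 => //; exact: lt_trans tp.
have DE r : D r = expR (3 / 8 * r) * (D 0 * (sin (w - r) / sin w)).
  rewrite /D {2}/flow_up spiral0; apply: spiral_turn => //; exact: lt0r_neq0.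
exists w; split; first by rewrite w0.
  move=> r /andP[r0 rw]; rewrite -/(D r) DE; apply: mulr_gt0; first exact: expR_gt0.
  by apply: mulr_gt0 => //; apply: divr_gt0 => //; apply: sin_pi_gt0; lra.
move=> r /andP[wr rt]; rewrite -/(D r) DE pmulr_rlt0 ?expR_gt0 // pmulr_rlt0 //.
rewrite pmulr_llt0 ?invr_gt0 // -opprB sinN oppr_lt0.
by apply: sin_pi_gt0; lra.
Qed.

Lemma low_bottom : exists w, [/\ 0 < w < pi,
  forall r, 0 <= r < w -> (Xlow (flow_low (Bup t, 0) r)).2 < 0 &
  forall r, w < r <= 2 * pi - s -> 0 < (Xlow (flow_low (Bup t, 0) r)).2].
Proof.
have [_ /andP[s0 sp] EA EB A0 B0] := cyc.
have p0 := @pi_gt0 R.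
pose D r := (Xlow (flow_low (Bup t, 0) r)).2.
have D0n : D 0 < 0 by rewrite /D /flow_low spiral0 Xlow2 /=; lra.
have DT : 0 < D (2 * pi - s).
  by rewrite /D EB low_return ?Xlow2 -?EA /=; [lra|apply/andP; split; lra].
(* Half a turn reverses the vertical speed, so the bottom is reached before time pi. *)
have Dpi : D pi = - (expR (- (1 / 5) * pi) * D 0).
  rewrite /D /Xlow /spiral_field /flow_low spiral0 /spiral /= sinpi cospi; ring.
have Dpip : 0 < D pi by rewrite Dpi -mulrN; apply: mulr_gt0; [exact: expR_gt0|lra].
have [|||w [/andP[w0 wpi] Dw _]] := first_zero (f := fun r => - D r) (ltW p0).
- by move=> x _; apply: cvgN; exact: spiral_field2_continuous.
- by rewrite oppr_gt0.
- by rewrite oppr_le0 ltW.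
have wp : w < pi.
  by rewrite lt_neqAle wpi andbT; apply/eqP => E; move: Dpip; rewrite -E -oppr_lt0 Dw ltxx.
have sw : 0 < sin w by exact: sin_pi_gt0.
have DE r : D r = expR (- (1 / 5) * r) * (D 0 * (sin (w - r) / sin w)).
  rewrite /D {2}/flow_low spiral0; apply: spiral_turn; first exact: lt0r_neq0.
  by apply/eqP; rewrite -oppr_eq0; apply/eqP.
(* The speed is positive for half a turn after w. If the arc lasted longer, it would not be positive
   at the end of the arc, contrary to [DT]. *)
have Tw : 2 * pi - s - w < pi.
  rewrite ltNge; apply/negP => h.
  move: DT; rewrite DE pmulr_rgt0 ?expR_gt0 // nmulr_rgt0 // pmulr_llt0 ?invr_gt0 //.
  rewrite -opprB sinN oppr_lt0 ltNge; apply/negP/negPn.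
  have -> : 2 * pi - s - w = 2 * pi - (2 * pi - (2 * pi - s - w)) by ring.
  by rewrite sin_turn oppr_le0; apply: sin_ge0_pi; apply/andP; split; lra.
exists w; split; first by rewrite w0.
  move=> r /andP[r0 rw]; rewrite -/(D r) DE pmulr_rlt0 ?expR_gt0 // nmulr_rlt0 //.
  by apply: divr_gt0 => //; apply: sin_pi_gt0; lra.
move=> r /andP[wr rT]; rewrite -/(D r) DE pmulr_rgt0 ?expR_gt0 // nmulr_rgt0 //.
rewrite pmulr_llt0 ?invr_gt0 // -opprB sinN oppr_lt0.
by apply: sin_pi_gt0; lra.
Qed.

Let T := t + (2 * pi - s).
Let g := cycle_sol t s.

Lemma sol_on_up r : 0 <= r <= t -> g r = flow_up (Aup t, 0) r.
Proof.
have p0 := @pi_gt0 R; have [_ /andP[s0 sp] _ _ _ _] := cyc.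
move=> /andP[r0 rt]; rewrite /g cycle_sol_arc // /arc_pair ?rt // r0 /=; lra.
Qed.

Lemma sol_on_low r : t <= r <= T -> g r = flow_low (Bup t, 0) (r - t).
Proof.
have [/andP[t0 _] _ _ _ _ _] := cyc.
move=> /andP[tr]; rewrite le_eqVlt => /predU1P[->|rT]; last first.
  have r0T : 0 <= r < t + (2 * pi - s) by rewrite (le_trans (ltW t0) tr) rT.
  by rewrite /g cycle_sol_arc // (arc_pair_low cyc).
rewrite -(arc_pair_low cyc); last first.
  by have p0 := @pi_gt0 R; have [_ /andP[s0 sp] _ _ _ _] := cyc; rewrite /T; lra.
rewrite (arc_pairT cyc) (arc_pair0 cyc) /g -[T]add0r cycle_sol_period //.
exact: cycle_sol0.
Qed.

(** p and q are the times of the top of the upper arc and of the bottom of the lower one. Each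
    monotone piece combines parts of both arcs, glued on the line at time t or T. The signs of the
    lower field serve to locate the focus. *)
Lemma loop_bimonotone : exists p q : R, [/\ 0 < p < t, t < q < t + pi,
  forall x y, p <= x -> x < y -> y <= q -> (g y).2 < (g x).2,
  forall x y, q <= x -> x < y -> y <= p + T -> (g x).2 < (g y).2 &
  (forall x, t < x < q -> (Xlow (g x)).2 < 0) /\
  (forall x, q < x < T -> 0 < (Xlow (g x)).2)].
Proof.
have [/andP[t0 tp] /andP[s0 sp] _ _ _ _] := cyc.
have p0 := @pi_gt0 R.
have [w [/andP[w0 wt] wup wdn]] := up_top.
have [z [/andP[z0 zpi] zdn zup]] := low_bottom.
have zT : z < 2 * pi - s by lra.
exists w, (t + z); split; try by apply/andP; split; lra.
- move=> x y wx xy yz; rewrite -ltrN2.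
  apply: (incr_glue (f := fun x => - (g x).2) (a := w) (b := t + z) (c := t)) => //.
    move=> x' y' wx' xy' yt; rewrite ltrN2 !sol_on_up; try by apply/andP; split; lra.
    apply: (spiral_down_lt (a := w) (b := t)) => // r /andP[r1 r2].
    by apply: wdn; rewrite r1 ltW.
  move=> x' y' tx xy' yz'; rewrite ltrN2 !sol_on_low; try by rewrite /T; apply/andP; split; lra.
  apply: (spiral_down_lt (a := 0) (b := z)); try by lra.
  by move=> r /andP[r1 r2]; apply: zdn; rewrite r2 ltW.
- apply: (incr_glue (c := T)).
    move=> x y zx xy yT; rewrite !sol_on_low; try by rewrite /T in yT *; apply/andP; split; lra.
    apply: (spiral_up_lt (a := z) (b := 2 * pi - s)); rewrite /T in yT; try by lra.
    by move=> r /andP[r1 r2]; apply: zup; rewrite r1 ltW.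
  move=> x y Tx xy yT.
  rewrite -[x](subrK T) -[y](subrK T) /g !cycle_sol_period // -/g.
  rewrite !sol_on_up; try by apply/andP; split; lra.
  apply: (spiral_up_lt (a := 0) (b := w)); try by lra.
  by move=> r /andP[r1 r2]; apply: wup; rewrite r2 ltW.
- split=> x /andP[x1 x2]; rewrite sol_on_low; try by rewrite /T in x2 *; apply/andP; split; lra.
    by apply: zdn; apply/andP; split; lra.
  by apply: zup; rewrite /T in x2; apply/andP; split; lra.
Qed.

Lemma loop_interior : exists I : set (R * R), [/\ I `<=` inside (loop t s),
  forall S, connected S -> S `<=` ~` loop t s -> S `&` I !=set0 -> S `<=` I,
  I (- (1 / 5), - (49 / 50)) &
  forall x, Bup t < x -> x < Aup t -> I (x, 0)].
Proof.
have [/andP[t0 tp] /andP[s0 sp] _ _ _ _] := cyc.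
have tpi : 0 < t < pi by rewrite t0.
have p0 := @pi_gt0 R.
have [p [q [/andP[p_gt0 pt] /andP[tq qpi] down up [left right]]]] := loop_bimonotone.
have sg := cycle_sol_filippov cyc; have T0 := period_gt0 cyc.
have cg1 := sol_continuous1 sg; have cg2 := sol_continuous2 sg.
have per := cycle_sol_period cyc.
have pq : p < q by lra.
have qT : q < T by rewrite /T; lra.
have qpT : q < p + T by lra.
rewrite -(range_cycle_sol cyc).
have gt : g t = (Bup t, 0) by rewrite sol_on_up ?up_return // lexx ltW.
have gT : g T = (Aup t, 0) by rewrite /g -[T]add0r per cycle_sol0.
exists (between g p q T); split.
- exact: (between_inside cg1 cg2 T0 per pq qpT down up).
- by move=> S; exact: (connected_between cg1 cg2 per pq qpT down up).
- have yp : 0 < (g p).2.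
    by have := down p t (lexx _) pt (ltW tq); rewrite gt.
  (* The lower arc starts above the focus, so after half a turn it is below the focus; the bottom is
     lower still. *)
  have yq : (g q).2 < - (49 / 50).
    apply: (@lt_trans _ _ (g (t + pi)).2); first by apply: up; rewrite /T; lra.
    rewrite sol_on_low; last by rewrite /T; apply/andP; split; lra.
    rewrite addrC addrA addNr add0r /flow_low /spiral /= sinpi cospi mulr0 add0r sub0r opprK.
    have := expR_gt0 (- (1 / 5) * pi : R); lra.
  have ypT : 0 < (g (p + T)).2 by rewrite /g per.
  split.
    have [||x /andP[px xq] Ex] := @ivt_ge _ (fun x => (g x).2) p q (- (49 / 50)) (ltW pq).
    + by move=> z _; exact: cg2.
    + by apply/andP; split; lra.
    have xq' : x < q.
      by rewrite lt_neqAle xq andbT; apply/eqP => E; move: yq; rewrite -E Ex ltxx.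
    have tx : t < x.
      rewrite ltNge; apply/negP => xt; have : 0 <= (g x).2.
        move: xt; rewrite le_eqVlt => /predU1P[->|xt]; first by rewrite gt.
        by have := down x t px xt (ltW tq); rewrite gt => /ltW.
      by rewrite Ex; lra.
    exists x; split=> //=; first by rewrite xq' (lt_trans pt).
    (* At the height of the focus the vertical component of the lower field is x + 1/5: a descending
       point lies to the left of the focus, and an ascending one, below, to its right. *)
    by have := left x; rewrite tx xq' Xlow2 Ex => /(_ isT); lra.
  have [||x /andP[qx xp] Ex] := @ivt_le _ (fun x => (g x).2) q (p + T) (- (49 / 50)) (ltW qpT).
  + by move=> z _; exact: cg2.
  + by apply/andP; split; lra.
  have qx' : q < x.
    by rewrite lt_neqAle qx andbT; apply/eqP => E; move: yq; rewrite E Ex ltxx.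
  have xT : x < T.
    rewrite ltNge; apply/negP => Tx; have : 0 <= (g x).2.
      move: Tx; rewrite le_eqVlt => /predU1P[<-|Tx]; first by rewrite gT.
      by have := up T x (ltW qT) Tx xp; rewrite gT => /ltW.
    by rewrite Ex; lra.
  exists x; split=> //=; first by rewrite qx' (lt_trans xT) // ltrDr.
  by have := right x; rewrite qx' xT Xlow2 Ex => /(_ isT); lra.
- move=> x Bx xA; split.
    by exists t; rewrite gt pt tq.
  by exists T; rewrite gT qT ltrDr.
Qed.

Lemma connected_loop : connected (loop t s).
Proof.
rewrite -(range_cycle_sol cyc); apply: connected_continuous_connected.
  by apply/connected_intervalP => x y _ _ z _.
apply: continuous_subspaceT; have sg := cycle_sol_filippov cyc.
have c : continuous (fun x : R => ((cycle_sol t s x).1, (cycle_sol t s x).2)).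
  have c1 := sol_continuous1 sg; have c2 := sol_continuous2 sg.
  by move=> x; exact: (cvg_pair (c1 x) (c2 x)).
suff <- : (fun x => ((cycle_sol t s x).1, (cycle_sol t s x).2)) = cycle_sol t s by [].
by apply/funext => y; case: (cycle_sol t s y).
Qed.

End LoopInside.

(** * Disjointness and nesting of the cycles *)

Section Nested.
Context {R : realType}.
Implicit Types (m u v r w t s : R) (q : R * R).

Lemma spiral_add m u v q a b :
  spiral m u v (spiral m u v q a) b = spiral m u v q (a + b).
Proof.
by rewrite /spiral /= (mulrDr m a b) expRD cosD sinD; congr pair; ring.
Qed.

Lemma loop_up t s z : crossing_cycle t s -> loop t s z -> 0 < z.2 ->
  exists2 r, 0 <= r <= t & z = flow_up (Aup t, 0) r.
Proof.
move=> [_ sp _ EB _ _] [//|[r /andP[]]].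
rewrite le_eqVlt => /predU1P[<- _ ->|r0]; first by rewrite /flow_low spiral0 ltxx.
rewrite le_eqVlt EB => /predU1P[-> ->|rT ->].
  rewrite low_return ?ltxx //.
  by have p0 := @pi_gt0 R; case/andP: sp => *; apply/andP; split; lra.
by move=> h; have := low_arc sp (r := r); rewrite r0 rT => /(_ isT); rewrite ltNge ltW.
Qed.

Lemma loop_low t s z : crossing_cycle t s -> loop t s z -> z.2 < 0 ->
  exists2 r, 0 <= r <= 2 * pi - s & z = flow_low (Bup t, 0) r.
Proof.
move=> [tp _ _ _ _ _] [|//] [r /andP[]].
rewrite le_eqVlt => /predU1P[<- _ ->|r0]; first by rewrite /flow_up spiral0 ltxx.
rewrite le_eqVlt => /predU1P[-> ->|rT ->]; first by rewrite up_return ?ltxx.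
by move=> h; have := up_arc tp (s := r); rewrite r0 rT => /(_ isT); rewrite ltNge ltW.
Qed.

Lemma loop_axis t s z : crossing_cycle t s -> loop t s z -> z.2 = 0 ->
  z = (Aup t, 0) \/ z = (Bup t, 0).
Proof.
move=> [tp sp EA EB _ _] [] [r /andP[]].
  rewrite le_eqVlt => /predU1P[<- _ -> _|r0]; first by left; rewrite /flow_up spiral0.
  rewrite le_eqVlt => /predU1P[-> -> _|rT ->]; first by right; rewrite up_return.
  by move=> h; have := up_arc tp (s := r); rewrite r0 rT => /(_ isT); rewrite h ltxx.
rewrite le_eqVlt => /predU1P[<- _ -> _|r0]; first by right; rewrite /flow_low spiral0.
rewrite le_eqVlt EB => /predU1P[-> -> _|rT ->].
  left; rewrite low_return ?EA //.
  by have p0 := @pi_gt0 R; case/andP: sp => *; apply/andP; split; lra.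
by move=> h; have := low_arc sp (r := r); rewrite r0 rT => /(_ isT); rewrite h ltxx.
Qed.

(** Rewinding a common point by the shorter time r puts the start of one arc on the other arc, which
    meets the line only at its two ends; both are excluded. *)
Lemma up_arcs_disjoint t t' r r' : 0 < t < pi -> 0 < t' < pi -> Aup t != Aup t' ->
  0 < Aup t -> Bup t' < 0 ->
  0 <= r -> r <= r' -> r' <= t' -> flow_up (Aup t, 0) r <> flow_up (Aup t', 0) r'.
Proof.
move=> tp tp' neq A0 B0 r0 rr rt' E.
have : flow_up (Aup t, 0) (r - r) = flow_up (Aup t', 0) (r' - r).
  by rewrite /flow_up -!spiral_add; move: E; rewrite /flow_up => ->.
rewrite subrr {1}/flow_up spiral0.
have : 0 <= r' - r by rewrite subr_ge0.
rewrite le_eqVlt => /predU1P[<-|rr0].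
  by rewrite /flow_up spiral0 => -[] /eqP; rewrite (negbTE neq).
have : r' - r <= t' by lra.
rewrite le_eqVlt => /predU1P[->|rt].
  by rewrite up_return // => -[E']; lra.
move=> E'; have := up_arc tp' (s := r' - r); rewrite rr0 rt -E' => /(_ isT).
by rewrite /= ltxx.
Qed.

Lemma low_arcs_disjoint s s' r r' : pi / 2 <= s < pi -> pi / 2 <= s' < pi ->
  Blow s != Blow s' -> Blow s < 0 -> 0 < Alow s' ->
  0 <= r -> r <= r' -> r' <= 2 * pi - s' ->
  flow_low (Blow s, 0) r <> flow_low (Blow s', 0) r'.
Proof.
move=> tp tp' neq A0 B0 r0 rr rt' E.
have : flow_low (Blow s, 0) (r - r) = flow_low (Blow s', 0) (r' - r).
  by rewrite /flow_low -!spiral_add; move: E; rewrite /flow_low => ->.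
rewrite subrr {1}/flow_low spiral0.
have : 0 <= r' - r by rewrite subr_ge0.
rewrite le_eqVlt => /predU1P[<-|rr0].
  by rewrite /flow_low spiral0 => -[] /eqP; rewrite (negbTE neq).
have : r' - r <= 2 * pi - s' by lra.
rewrite le_eqVlt => /predU1P[->|rt].
  rewrite low_return; first by move=> -[E']; lra.
  by have p0 := @pi_gt0 R; case/andP: tp' => *; apply/andP; split; lra.
move=> E'; have := low_arc tp' (r := r' - r); rewrite rr0 rt -E' => /(_ isT).
by rewrite /= ltxx.
Qed.

Lemma loops_disjoint t s t' s' : crossing_cycle t s -> crossing_cycle t' s' -> t < t' ->
  loop t s `<=` ~` loop t' s'.
Proof.
move=> c c' tt z lz lz'.
have [tp sp EA EB A0 B0] := c; have [tp' sp' EA' EB' A0' B0'] := c'.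
have AA : Aup t < Aup t' by apply: Aup_lt => //; [case/andP: tp|case/andP: tp'].
have BB : Bup t' < Bup t by apply: Bup_lt => //; [case/andP: tp|case/andP: tp'].
have neqA : Aup t != Aup t' by rewrite lt_eqF.
have neqB : Blow s != Blow s' by rewrite -EB -EB' gt_eqF.
have Bt : Bup t < 0 by lra.
have Bt' : Bup t' < 0 by lra.
have Bs : Blow s < 0 by rewrite -EB.
have Bs' : Blow s' < 0 by rewrite -EB'.
have As : 0 < Alow s by rewrite -EA.
have As' : 0 < Alow s' by rewrite -EA'.
have [z0|z0|z0] := ltgtP z.2 0.
- have [r /andP[r1 r2] E] := loop_low c lz z0.
  have [r' /andP[r1' r2'] E'] := loop_low c' lz' z0.
  rewrite EB in E; rewrite EB' in E'.
  have [rr|/ltW rr] := leP r r'.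
    by apply: (low_arcs_disjoint sp sp' neqB Bs As' r1 rr r2'); rewrite -E -E'.
  have neqB' : Blow s' != Blow s by rewrite eq_sym.
  by apply: (low_arcs_disjoint sp' sp neqB' Bs' As r1' rr r2); rewrite -E -E'.
- have [r /andP[r1 r2] E] := loop_up c lz z0.
  have [r' /andP[r1' r2'] E'] := loop_up c' lz' z0.
  have [rr|/ltW rr] := leP r r'.
    by apply: (up_arcs_disjoint tp tp' neqA A0 Bt' r1 rr r2'); rewrite -E -E'.
  have neqA' : Aup t' != Aup t by rewrite eq_sym.
  by apply: (up_arcs_disjoint tp' tp neqA' A0' Bt r1' rr r2); rewrite -E -E'.
- by case: (loop_axis c lz z0) (loop_axis c' lz' z0) => -> [] [E]; lra.
Qed.

Lemma loops_nested t s t' s' : crossing_cycle t s -> crossing_cycle t' s' -> t < t' ->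
  loop t s `<=` inside (loop t' s').
Proof.
move=> c c' tt; have [I [sub con _ ax]] := loop_interior c'.
have [tp sp EA EB A0 B0] := c; have [tp' sp' EA' EB' A0' B0'] := c'.
apply: subset_trans sub; apply: con.
- exact: connected_loop.
- exact: loops_disjoint tt.
- exists (Aup t, 0); split.
    left; exists 0; last by rewrite /flow_up spiral0.
    by case/andP: tp => *; rewrite lexx ltW.
  by apply: ax; [lra|apply: Aup_lt => //; [case/andP: tp|case/andP: tp']].
Qed.

Lemma focus_inside_loop t s : crossing_cycle t s ->
  inside (loop t s) (- (1 / 5), - (49 / 50)).
Proof. by move=> /loop_interior[I [sub _ h _]]; exact: sub. Qed.

Lemma box_limit_cycle e kappa t1 t2 s1 s2 : @cycle_box R e kappa t1 t2 s1 s2 ->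
  exists t s, [/\ t1 < t < t2, crossing_cycle t s &
    limit_cycle (@Xup R) (@Xlow R) (loop t s)].
Proof.
move=> bx; have [t [s [ht hs EA EB]]] := box_exists bx.
have cyc := box_crossing_cycle bx ht hs EA EB.
exists t, s; split=> //; split; first exact: loop_periodic_orbit.
exists (box_nbhd t1 t2 s1 s2); split.
- exact: open_box_nbhd.
- exact: loop_sub_nbhd bx ht hs EA EB.
- by move=> G; exact: (box_unique bx ht hs EA EB).
Qed.

End Nested.

(** * Numerical enclosures *)

Section Taylor.
Context {R : realType}.
Implicit Types (x : R) (n k : nat).

Fixpoint taylor_term k x : R := if k is k'.+1 then taylor_term k' x * (x / k%:R) else 1.

Lemma taylor_term_derive k x :
  is_derive x 1 (taylor_term k.+1) (taylor_term k x).
Proof.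
elim: k => [|k IH]; first by rewrite /=; derive_tac; field.
suff -> : taylor_term k.+2 = fun x => taylor_term k.+1 x * (x / k.+2%:R) by
  derive_tac; rewrite /= -!natr1; field; rewrite !natr1 !pnatr_eq0.
by [].
Qed.

Lemma taylor_term0 k : taylor_term k.+1 0 = 0.
Proof. by rewrite /= mul0r mulr0. Qed.

(** The expansion is that of exp(-x), whose partial sums alternate around the limit for x >= 0. *)
Definition taylor_exp n x := \sum_(i < n) (-1) ^+ i * taylor_term i x.
Definition taylor_sin n x := \sum_(i < n) (-1) ^+ i * taylor_term i.*2.+1 x.
Definition taylor_cos n x := \sum_(i < n) (-1) ^+ i * taylor_term i.*2 x.

Lemma taylor_exp_derive n x : is_derive x 1 (taylor_exp n.+1) (- taylor_exp n x).
Proof.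
elim: n => [|n IH].
  have -> : taylor_exp 1 = fun=> 1.
    by apply/funext => y; rewrite /taylor_exp big_ord1 mul1r.
  by derive_tac; rewrite /taylor_exp big_ord0 oppr0.
have -> : taylor_exp n.+2 = fun y => taylor_exp n.+1 y + (-1) ^+ n.+1 * taylor_term n.+1 y.
  by apply/funext => y; rewrite /taylor_exp big_ord_recr.
have ? := taylor_term_derive n x.
derive_tac; rewrite /taylor_exp [in RHS]big_ord_recr /= exprS; ring.
Qed.

Lemma taylor_sin_derive n x : is_derive x 1 (taylor_sin n) (taylor_cos n x).
Proof.
elim: n => [|n IH].
  have -> : taylor_sin 0 = fun=> 0.
    by apply/funext => y; rewrite /taylor_sin big_ord0.
  by derive_tac; rewrite /taylor_cos big_ord0.
have -> : taylor_sin n.+1 = fun y => taylor_sin n y + (-1) ^+ n * taylor_term n.*2.+1 y.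
  by apply/funext => y; rewrite /taylor_sin big_ord_recr.
have ? := taylor_term_derive n.*2 x.
derive_tac; rewrite /taylor_cos [in RHS]big_ord_recr /=; ring.
Qed.

Lemma taylor_cos_derive n x : is_derive x 1 (taylor_cos n.+1) (- taylor_sin n x).
Proof.
elim: n => [|n IH].
  have -> : taylor_cos 1 = fun=> 1.
    by apply/funext => y; rewrite /taylor_cos big_ord1 mul1r.
  by derive_tac; rewrite /taylor_sin big_ord0 oppr0.
have -> : taylor_cos n.+2 = fun y => taylor_cos n.+1 y + (-1) ^+ n.+1 * taylor_term n.+1.*2 y.
  by apply/funext => y; rewrite /taylor_cos big_ord_recr.
have ? := taylor_term_derive n.*2.+1 x.
derive_tac; rewrite /taylor_sin [in RHS]big_ord_recr /= exprS; ring.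
Qed.

(** Each signed remainder vanishes at 0 and has the preceding one as its derivative. *)
Lemma taylor_exp_alternates n x : 0 <= x -> 0 <= (-1) ^+ n * (expR (- x) - taylor_exp n x).
Proof.
elim: n x => [|n IH] x x0.
  by rewrite /taylor_exp big_ord0 subr0 mul1r expR_ge0.
have -> : 0 = (-1) ^+ n.+1 * (expR (- 0) - taylor_exp n.+1 0) :> R.
  rewrite /taylor_exp big_ord_recl big1 => [|i _]; last by rewrite taylor_term0 mulr0.
  by rewrite oppr0 expR0 mul1r addr0 subrr mulr0.
apply: (derive_ge0_le (f := fun y => (-1) ^+ n.+1 * (expR (- y) - taylor_exp n.+1 y))
  (df := fun y => (-1) ^+ n * (expR (- y) - taylor_exp n y)) _ _ x0).
  by move=> y _; have ? := taylor_exp_derive n y; derive_tac; rewrite exprS; ring.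
by move=> y /andP[y0 _]; exact/IH/ltW.
Qed.

(** Integration from 0 leads from a cosine remainder to the sine remainder of the same order, and
    from there to the next cosine remainder; the start is cos <= 1. *)
Lemma taylor_trig_alternates n x : 0 <= x ->
  0 <= (-1) ^+ n.+1 * (cos x - taylor_cos n.+1 x) /\
  0 <= (-1) ^+ n.+1 * (sin x - taylor_sin n.+1 x).
Proof.
have cos_sin k y : (forall z, 0 <= z -> 0 <= (-1) ^+ k * (cos z - taylor_cos k z)) ->
    0 <= y -> 0 <= (-1) ^+ k * (sin y - taylor_sin k y).
  move=> h y0; have -> : 0 = (-1) ^+ k * (sin 0 - taylor_sin k 0) :> R.
    rewrite /taylor_sin big1 => [|i _]; last by rewrite taylor_term0 mulr0.
    by rewrite sin0 subrr mulr0.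
  apply: (derive_ge0_le (f := fun y => (-1) ^+ k * (sin y - taylor_sin k y))
    (df := fun y => (-1) ^+ k * (cos y - taylor_cos k y)) _ _ y0).
    by move=> z _; have ? := taylor_sin_derive k z; derive_tac; ring.
  by move=> z /andP[z0 _]; exact/h/ltW.
have main : forall x, 0 <= x -> 0 <= (-1) ^+ n.+1 * (cos x - taylor_cos n.+1 x).
  elim: n => [|k IH] y y0.
    rewrite expr1 /taylor_cos big_ord1 !mul1r mulN1r opprB subr_ge0; exact: cos_le1.
  have -> : 0 = (-1) ^+ k.+2 * (cos 0 - taylor_cos k.+2 0) :> R.
    rewrite /taylor_cos big_ord_recl big1 => [|i _]; last by rewrite taylor_term0 mulr0.
    by rewrite cos0 mul1r addr0 subrr mulr0.
  apply: (derive_ge0_le (f := fun y => (-1) ^+ k.+2 * (cos y - taylor_cos k.+2 y))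
    (df := fun y => (-1) ^+ k.+1 * (sin y - taylor_sin k.+1 y)) _ _ y0).
    by move=> z _; have ? := taylor_cos_derive k.+1 z; derive_tac; rewrite !exprS; ring.
  by move=> z /andP[z0 _]; apply: cos_sin (ltW z0).
by move=> x0; split; [exact: main|exact: cos_sin].
Qed.

(** Consecutive Taylor polynomials in Horner form, of degrees 7 and 6 for exp(-x), 11 and 9 for sin,
    10 and 8 for cos; those ending on a negative term are the lower bounds. *)
Definition expN_lo x : R :=
  1 - x * (1 - x / 2 * (1 - x / 3 * (1 - x / 4 * (1 - x / 5 * (1 - x / 6 * (1 - x / 7)))))).
Definition expN_hi x : R :=
  1 - x * (1 - x / 2 * (1 - x / 3 * (1 - x / 4 * (1 - x / 5 * (1 - x / 6))))).
Definition sin_lo x : R := x * (1 - x * x / 6 * (1 - x * x / 20 * (1 - x * x / 42 *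
  (1 - x * x / 72 * (1 - x * x / 110))))).
Definition sin_hi x : R :=
  x * (1 - x * x / 6 * (1 - x * x / 20 * (1 - x * x / 42 * (1 - x * x / 72)))).
Definition cos_lo x : R :=
  1 - x * x / 2 * (1 - x * x / 12 * (1 - x * x / 30 * (1 - x * x / 56 * (1 - x * x / 90)))).
Definition cos_hi x : R :=
  1 - x * x / 2 * (1 - x * x / 12 * (1 - x * x / 30 * (1 - x * x / 56))).

Lemma expRN_bounds x : 0 <= x -> expN_lo x <= expR (- x) <= expN_hi x.
Proof.
move=> x0; have h7 := taylor_exp_alternates 7 x0; have h8 := taylor_exp_alternates 8 x0.
move: h7 h8; rewrite /taylor_exp !big_ord_recr !big_ord0 /= => h7 h8.
by rewrite /expN_lo /expN_hi; apply/andP; split; lra.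
Qed.

Lemma sin_bounds x : 0 <= x -> sin_lo x <= sin x <= sin_hi x.
Proof.
move=> x0; have [_ h5] := taylor_trig_alternates 4 x0.
have [_ h6] := taylor_trig_alternates 5 x0.
move: h5 h6; rewrite /taylor_sin !big_ord_recr !big_ord0 /= !doubleS double0 /= => h5 h6.
by rewrite /sin_lo /sin_hi /cos_lo /cos_hi; apply/andP; split; lra.
Qed.

Lemma cos_bounds x : 0 <= x -> cos_lo x <= cos x <= cos_hi x.
Proof.
move=> x0; have [h5 _] := taylor_trig_alternates 4 x0.
have [h6 _] := taylor_trig_alternates 5 x0.
move: h5 h6; rewrite /taylor_cos !big_ord_recr !big_ord0 /= !doubleS double0 /= => h5 h6.
by rewrite /sin_lo /sin_hi /cos_lo /cos_hi; apply/andP; split; lra.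
Qed.

(** The Taylor bounds give cos(157/100) > 0 > cos(11/7), and cos decreases through 0 at pi / 2. *)
Lemma pi_bounds : (157 / 50 < pi :> R) /\ (pi < 22 / 7 :> R).
Proof.
have p2 := @pi_ge2 R; have p4 := @pi_lt4 R.
have mono (x y : R) : 0 <= x <= pi -> 0 <= y <= pi -> cos x < cos y -> y < x.
  by move=> xp yp h; rewrite -ltr_cos // in_itv.
have hp : 0 <= (pi : R) / 2 <= pi by apply/andP; split; lra.
split.
  suff : 157 / 100 < pi / 2 :> R by lra.
  have x0 : 0 <= 157 / 100 :> R by lra.
  apply: mono => //; first by rewrite x0 /=; lra.
  rewrite cos_pihalf; have /andP[h _] := cos_bounds x0.
  by apply: lt_le_trans h; rewrite /cos_lo; lra.
suff : pi / 2 < 11 / 7 :> R by lra.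
have x0 : 0 <= 11 / 7 :> R by lra.
apply: mono => //; first by rewrite x0 /=; lra.
rewrite cos_pihalf; have /andP[_ h] := cos_bounds x0.
by apply: le_lt_trans h _; rewrite /cos_hi; lra.
Qed.

End Taylor.

(** * Sign tests at rational points, and the three boxes *)

Section Numerics.
Context {R : realType}.
Implicit Types (t s q kappa : R).

Lemma Aup_subE t q : sin t != 0 -> Aup t - q =
  (833 / 125 * (expR (- (3 / 8 * t)) - cos t) - (q - 67 / 50) * sin t) / sin t.
Proof.
move=> s0; rewrite /Aup /flight mul1r mulNr; field.
by [].
Qed.

Lemma Bup_subE t q : sin t != 0 -> Bup t - q =
  (- (833 / 125) * (expR (3 / 8 * t) - cos t) - (q - 67 / 50) * sin t) / sin t.
Proof.
move=> s0; rewrite /Bup /flight mul1r; field.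
by [].
Qed.

Lemma sin_supp s : sin (pi - s) = sin s.
Proof. by rewrite addrC sinDpi sinN opprK. Qed.

Lemma cos_supp s : cos (pi - s) = - cos s.
Proof. by rewrite addrC cosDpi cosN. Qed.

(** With the reflected parameter pi - s the trigonometric arguments are small rationals, and pi
    survives only in the exponent, where rational bounds for it suffice. *)
Lemma Alow_subE s q : sin s != 0 -> Alow (pi - s) - q =
  (49 / 50 * (expR (- ((pi + s) / 5)) + cos s) - (q + 1 / 5) * sin s) / sin s.
Proof.
move=> s0; rewrite /Alow /flight klowV sin_supp cos_supp -expRD opprK.
have -> : - (2 / 5 * pi) + 1 / 5 * (pi - s) = - ((pi + s) / 5) by lra.
by field.
Qed.

Lemma Blow_subE s q : sin s != 0 -> Blow (pi - s) - q =
  (- (49 / 50) * (expR ((pi + s) / 5) + cos s) - (q + 1 / 5) * sin s) / sin s.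
Proof.
move=> s0; rewrite /Blow /flight /klow sin_supp cos_supp -expRD opprK.
have -> : 2 / 5 * pi + - (1 / 5) * (pi - s) = (pi + s) / 5 by lra.
by field.
Qed.

Lemma gap_upE kappa t : gap_up kappa t =
  kappa * (1 - expR (- (3 / 8 * t)) * (3 / 8 * sin t + cos t)) -
  (1 + expR (3 / 8 * t) * (3 / 8 * sin t - cos t)).
Proof. rewrite /gap_up /slope_gap /flight_slope invr1 !mul1r mulNr; ring. Qed.

Lemma gap_lowE kappa s : gap_low kappa (pi - s) =
  kappa * (1 + expR (- ((pi + s) / 5)) * (1 / 5 * sin s + cos s)) -
  (1 + expR ((pi + s) / 5) * (- (1 / 5) * sin s + cos s)).
Proof.
rewrite /gap_low /slope_gap /flight_slope invrK klowV /klow sin_supp cos_supp -!expRD !opprK.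
have -> : - (2 / 5 * pi) + 1 / 5 * (pi - s) = - ((pi + s) / 5) by lra.
by have -> : 2 / 5 * pi + - (1 / 5) * (pi - s) = (pi + s) / 5 by lra.
Qed.

(** Growing exponentials are bounded through the product with their decaying inverses, which avoids
    quotients of polynomials. *)
Lemma expR_recip_bounds (x a b : R) : 0 <= a -> expR (- x) <= b -> a <= expR (- x) ->
  [/\ 0 < expR x, a * expR x <= 1 & 1 <= b * expR x].
Proof.
move=> a0 hb ha; have e0 := expR_gt0 x; have e1 := expR_gt0 (- x).
have E : expR (- x) * expR x = 1 by rewrite -expRD addNr expR0.
by rewrite -E !ler_wpM2r // ltW.
Qed.

Lemma up_enclosure t : 0 <= t -> 0 <= expN_lo (3 / 8 * t) ->
  [/\ sin_lo t <= sin t <= sin_hi t, cos_lo t <= cos t <= cos_hi t,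
   expN_lo (3 / 8 * t) <= expR (- (3 / 8 * t)) <= expN_hi (3 / 8 * t) &
   [/\ 0 < expR (3 / 8 * t), expN_lo (3 / 8 * t) * expR (3 / 8 * t) <= 1 &
       1 <= expN_hi (3 / 8 * t) * expR (3 / 8 * t)]].
Proof.
move=> t0 e0; have x0 : 0 <= 3 / 8 * t by lra.
have hE := expRN_bounds x0; split=> //; [exact: sin_bounds|exact: cos_bounds|].
by case/andP: hE => h1 h2; exact: expR_recip_bounds.
Qed.

Lemma low_enclosure s : 0 <= s -> 0 <= expN_lo ((22 / 7 + s) / 5) ->
  [/\ sin_lo s <= sin s <= sin_hi s, cos_lo s <= cos s <= cos_hi s,
   expN_lo ((22 / 7 + s) / 5) <= expR (- ((pi + s) / 5)) <= expN_hi ((157 / 50 + s) / 5) &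
   [/\ 0 < expR ((pi + s) / 5), expN_lo ((22 / 7 + s) / 5) * expR ((pi + s) / 5) <= 1 &
       1 <= expN_hi ((157 / 50 + s) / 5) * expR ((pi + s) / 5)]].
Proof.
move=> s0 e0; have [p1 p2] := @pi_bounds R.
have x1 : 0 <= (157 / 50 + s) / 5 by lra.
have x2 : 0 <= (22 / 7 + s) / 5 by lra.
have /andP[h1 _] := expRN_bounds x2; have /andP[_ h2] := expRN_bounds x1.
have h3 : expR (- ((22 / 7 + s) / 5)) <= expR (- ((pi + s) / 5)) by rewrite ler_expR; lra.
have h4 : expR (- ((pi + s) / 5)) <= expR (- ((157 / 50 + s) / 5)) by rewrite ler_expR; lra.
have h5 := le_trans h1 h3; have h6 := le_trans h4 h2.
split; [exact: sin_bounds|exact: cos_bounds|by rewrite h5 h6|exact: expR_recip_bounds].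
Qed.

(** The gap decreases as long as kappa <= exp(3/4 y); the hypothesis implies this for y >= t1
    through 1 + x <= exp x. *)
Lemma gap_up_decr kappa t1 t2 x : 0 < kappa -> 0 <= t1 -> t1 < x -> x < t2 -> t2 < pi ->
  kappa <= (1 + 3 / 8 * t1) ^+ 2 ->
  gap_up kappa t2 <= gap_up kappa x /\ gap_up kappa x <= gap_up kappa t1.
Proof.
move=> k0 t10 t1x xt2 t2p hk.
have h y : t1 < y -> kappa * (1 * expR (- (3 / 8) * y)) <= 1^-1 * expR (3 / 8 * y).
  move=> t1y; rewrite invr1 !mul1r mulNr expRN ler_pdivrMr ?expR_gt0 // -expr2.
  apply: le_trans hk _; rewrite ler_pXn2r ?nnegrE ?expR_ge0 //; last by lra.
  by apply: le_trans (expR_ge1Dx _); lra.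
split; apply: slope_gap_le => //; try lra.
  by move=> y /andP[y1 _]; apply: h; lra.
by move=> y /andP[y1 _]; apply: h; lra.
Qed.

(** Here the condition is kappa <= exp(2 (2 pi / 5 - y / 5)), and for y < pi the right-hand side
    exceeds (1 + pi / 5)^2 > 2. *)
Lemma gap_low_decr kappa s1 s2 x : 0 < kappa -> 0 <= s1 -> s1 < x -> x < s2 -> s2 < pi ->
  kappa <= 2 ->
  gap_low kappa s2 <= gap_low kappa x /\ gap_low kappa x <= gap_low kappa s1.
Proof.
move=> k0 s10 s1x xs2 s2p hk; have p2 := @pi_ge2 R.
have h y : y < pi -> kappa * (klow^-1 * expR (- - (1 / 5) * y)) <=
    klow^-1^-1 * expR (- (1 / 5) * y).
  move=> yp; rewrite invrK klowV /klow -!expRD opprK.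
  have -> : - (2 / 5 * pi) + 1 / 5 * y = - (2 / 5 * pi + - (1 / 5) * y) by lra.
  rewrite expRN ler_pdivrMr ?expR_gt0 // -expr2.
  have e1 : 1 + 1 / 5 * pi <= expR (2 / 5 * pi + - (1 / 5) * y).
    by apply: le_trans (expR_ge1Dx _); lra.
  have [p1 _] := @pi_bounds R.
  have e2 : 3 / 2 <= expR (2 / 5 * pi + - (1 / 5) * y) by lra.
  by rewrite expr2; move: (expR _) e2 => E e2; nra.
split; apply: slope_gap_le => //; rewrite ?invr_gt0 ?klow_gt0 //; try lra.
  by move=> y /andP[_ y1]; apply: h; lra.
by move=> y /andP[_ y1]; apply: h; lra.
Qed.

Lemma sub_quotient (x q N S : R) : 0 < S -> x - q = N / S ->
  (0 < N -> q < x) /\ (N < 0 -> x < q).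
Proof.
move=> S0 E; split=> h; [rewrite -subr_gt0|rewrite -subr_lt0]; rewrite E.
  exact: divr_gt0.
by rewrite pmulr_llt0 ?invr_gt0.
Qed.

(** Testing an affine inequality at both ends of an enclosure spares any knowledge of the sign of
    X. *)
Lemma mul_lt_ends (X S S1 S2 Y : R) : S1 <= S <= S2 -> X * S1 < Y -> X * S2 < Y -> X * S < Y.
Proof.
move=> /andP[h1 h2] y1 y2; have [X0|/ltW X0] := leP 0 X.
  by apply: le_lt_trans y2; rewrite ler_wpM2l.
by apply: le_lt_trans y1; rewrite ler_wnM2l.
Qed.

Lemma mul_gt_ends (X S S1 S2 Y : R) : S1 <= S <= S2 -> Y < X * S1 -> Y < X * S2 -> Y < X * S.
Proof.
move=> /andP[h1 h2] y1 y2; have [X0|/ltW X0] := leP 0 X.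
  by apply: lt_le_trans y1 _; rewrite ler_wpM2l.
by apply: lt_le_trans y2 _; rewrite ler_wnM2l.
Qed.

Section UpperPoint.
Variable t : R.
Let x := 3 / 8 * t.
Hypothesis t0 : 0 <= t.
Hypothesis F0 : 0 < expN_lo x.
Hypothesis S0 : 0 < sin_lo t.

Let sin_gt0 : 0 < sin t.
Proof. by have [/andP[h _] _ _ _] := up_enclosure t0 (ltW F0); exact: lt_le_trans h. Qed.

Lemma Aup_gt q : (q - 67 / 50) * sin_lo t < 833 / 125 * (expN_lo x - cos_hi t) ->
  (q - 67 / 50) * sin_hi t < 833 / 125 * (expN_lo x - cos_hi t) -> q < Aup t.
Proof.
have [hS /andP[_ C2] /andP[F1 _] _] := up_enclosure t0 (ltW F0).
move=> h1 h2; have h := mul_lt_ends hS h1 h2.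
apply: (proj1 (sub_quotient sin_gt0 (Aup_subE q (lt0r_neq0 sin_gt0)))).
by rewrite -/x in F1 *; lra.
Qed.

Lemma Aup_lt_num q : 833 / 125 * (expN_hi x - cos_lo t) < (q - 67 / 50) * sin_lo t ->
  833 / 125 * (expN_hi x - cos_lo t) < (q - 67 / 50) * sin_hi t -> Aup t < q.
Proof.
have [hS /andP[C1 _] /andP[_ F2] _] := up_enclosure t0 (ltW F0).
move=> h1 h2; have h := mul_gt_ends hS h1 h2.
apply: (proj2 (sub_quotient sin_gt0 (Aup_subE q (lt0r_neq0 sin_gt0)))).
by rewrite -/x in F2 *; lra.
Qed.

Lemma Bup_gt q :
  (expN_lo x * (q - 67 / 50)) * sin_lo t < 833 / 125 * (expN_lo x * cos_lo t - 1) ->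
  (expN_lo x * (q - 67 / 50)) * sin_hi t < 833 / 125 * (expN_lo x * cos_lo t - 1) ->
  q < Bup t.
Proof.
have [hS /andP[C1 _] _ [G0 G1 _]] := up_enclosure t0 (ltW F0).
move=> h1 h2; have h := mul_lt_ends hS h1 h2.
apply: (proj1 (sub_quotient sin_gt0 (Bup_subE q (lt0r_neq0 sin_gt0)))).
rewrite -(pmulr_rgt0 _ F0) -/x.
have C1' : expN_lo x * cos_lo t <= expN_lo x * cos t by rewrite ler_pM2l.
by rewrite -/x in G1 *; lra.
Qed.

Lemma Bup_lt_num q :
  833 / 125 * (expN_hi x * cos_hi t - 1) < (expN_hi x * (q - 67 / 50)) * sin_lo t ->
  833 / 125 * (expN_hi x * cos_hi t - 1) < (expN_hi x * (q - 67 / 50)) * sin_hi t ->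
  Bup t < q.
Proof.
have [hS /andP[_ C2] /andP[F1 F2] [G0 _ G2]] := up_enclosure t0 (ltW F0).
move=> h1 h2; have h := mul_gt_ends hS h1 h2.
have F0' : 0 < expN_hi x by apply: lt_le_trans F0 (le_trans F1 F2).
apply: (proj2 (sub_quotient sin_gt0 (Bup_subE q (lt0r_neq0 sin_gt0)))).
rewrite -(pmulr_rlt0 _ F0') -/x.
have C2' : expN_hi x * cos t <= expN_hi x * cos_hi t by rewrite ler_pM2l.
by rewrite -/x in G2 *; lra.
Qed.

(** After multiplication by F = exp(-x) the gap is quadratic in F. Bounding one factor F inside X
    leaves an inequality affine in F, tested at the ends of its enclosure. *)
Lemma gap_up_lt0 kappa : 0 <= kappa -> 0 <= 3 / 8 * sin_lo t + cos_lo t ->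
  let X := kappa * (1 - expN_lo x * (3 / 8 * sin_lo t + cos_lo t)) - 1 in
  X * expN_lo x < 3 / 8 * sin_lo t - cos_hi t ->
  X * expN_hi x < 3 / 8 * sin_lo t - cos_hi t -> gap_up kappa t < 0.
Proof.
have [/andP[S1 S2] /andP[C1 C2] hF [G0 _ _]] := up_enclosure t0 (ltW F0).
move=> k0 w0 X h1 h2; have h := mul_lt_ends hF h1 h2.
have E : expR (- x) * expR x = 1 by rewrite -expRD addNr expR0.
have f0 := expR_gt0 (- x); case/andP: hF => F1 F2.
rewrite gap_upE -/x -(pmulr_rlt0 _ f0).
have h3 : expN_lo x * (3 / 8 * sin_lo t + cos_lo t) <=
    expR (- x) * (3 / 8 * sin t + cos t).
  by apply: ler_pM => //; [exact: ltW|lra].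
have h4 : kappa * (1 - expR (- x) * (3 / 8 * sin t + cos t)) - 1 <= X.
  by rewrite lerD2r; apply: ler_wpM2l => //; lra.
have h5 := ler_wpM2l (ltW f0) h4.
set u := _ - (1 + _); have -> : expR (- x) * u =
    expR (- x) * (kappa * (1 - expR (- x) * (3 / 8 * sin t + cos t)) - 1) -
    (expR (- x) * expR x) * (3 / 8 * sin t - cos t) by rewrite /u; ring.
by rewrite E; rewrite -/x in h; lra.
Qed.

Lemma gap_up_gt0 kappa : 0 <= kappa -> 0 <= 3 / 8 * sin_lo t + cos_lo t ->
  let X := kappa * (1 - expN_hi x * (3 / 8 * sin_hi t + cos_hi t)) - 1 in
  3 / 8 * sin_hi t - cos_lo t < X * expN_lo x ->
  3 / 8 * sin_hi t - cos_lo t < X * expN_hi x -> 0 < gap_up kappa t.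
Proof.
have [/andP[S1 S2] /andP[C1 C2] hF [G0 _ _]] := up_enclosure t0 (ltW F0).
move=> k0 w0 X h1 h2; have h := mul_gt_ends hF h1 h2.
have E : expR (- x) * expR x = 1 by rewrite -expRD addNr expR0.
have f0 := expR_gt0 (- x); case/andP: hF => F1 F2.
rewrite gap_upE -/x -(pmulr_rgt0 _ f0).
have h3 : expR (- x) * (3 / 8 * sin t + cos t) <=
    expN_hi x * (3 / 8 * sin_hi t + cos_hi t).
  by apply: ler_pM => //; lra.
have h4 : X <= kappa * (1 - expR (- x) * (3 / 8 * sin t + cos t)) - 1.
  by rewrite lerD2r; apply: ler_wpM2l => //; lra.
have h5 := ler_wpM2l (ltW f0) h4.
set u := _ - (1 + _); have -> : expR (- x) * u =
    expR (- x) * (kappa * (1 - expR (- x) * (3 / 8 * sin t + cos t)) - 1) -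
    (expR (- x) * expR x) * (3 / 8 * sin t - cos t) by rewrite /u; ring.
by rewrite E; rewrite -/x in h; lra.
Qed.

End UpperPoint.

Section LowerPoint.
Variable s : R.
Let lo := expN_lo ((22 / 7 + s) / 5).
Let hi := expN_hi ((157 / 50 + s) / 5).
Hypothesis s0 : 0 <= s.
Hypothesis F0 : 0 < lo.
Hypothesis S0 : 0 < sin_lo s.

Let sin_gt0 : 0 < sin s.
Proof. by have [/andP[h _] _ _ _] := low_enclosure s0 (ltW F0); exact: lt_le_trans h. Qed.

Lemma Alow_gt q : (q + 1 / 5) * sin_lo s < 49 / 50 * (lo + cos_lo s) ->
  (q + 1 / 5) * sin_hi s < 49 / 50 * (lo + cos_lo s) -> q < Alow (pi - s).
Proof.
have [hS /andP[C1 _] /andP[F1 _] _] := low_enclosure s0 (ltW F0).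
move=> h1 h2; have h := mul_lt_ends hS h1 h2.
apply: (proj1 (sub_quotient sin_gt0 (Alow_subE q (lt0r_neq0 sin_gt0)))).
by rewrite -/lo in F1 *; lra.
Qed.

Lemma Alow_lt_num q : 49 / 50 * (hi + cos_hi s) < (q + 1 / 5) * sin_lo s ->
  49 / 50 * (hi + cos_hi s) < (q + 1 / 5) * sin_hi s -> Alow (pi - s) < q.
Proof.
have [hS /andP[_ C2] /andP[_ F2] _] := low_enclosure s0 (ltW F0).
move=> h1 h2; have h := mul_gt_ends hS h1 h2.
apply: (proj2 (sub_quotient sin_gt0 (Alow_subE q (lt0r_neq0 sin_gt0)))).
by rewrite -/hi in F2 *; lra.
Qed.

Lemma Blow_gt q :
  (lo * (q + 1 / 5)) * sin_lo s < - (49 / 50) * (lo * cos_hi s + 1) ->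
  (lo * (q + 1 / 5)) * sin_hi s < - (49 / 50) * (lo * cos_hi s + 1) -> q < Blow (pi - s).
Proof.
have [hS /andP[_ C2] _ [G0 G1 _]] := low_enclosure s0 (ltW F0).
move=> h1 h2; have h := mul_lt_ends hS h1 h2.
apply: (proj1 (sub_quotient sin_gt0 (Blow_subE q (lt0r_neq0 sin_gt0)))).
rewrite -(pmulr_rgt0 _ F0).
have C2' : lo * cos s <= lo * cos_hi s by rewrite ler_pM2l.
by rewrite -/lo in G1 *; lra.
Qed.

Lemma Blow_lt_num q :
  - (49 / 50) * (hi * cos_lo s + 1) < (hi * (q + 1 / 5)) * sin_lo s ->
  - (49 / 50) * (hi * cos_lo s + 1) < (hi * (q + 1 / 5)) * sin_hi s -> Blow (pi - s) < q.
Proof.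
have [hS /andP[C1 _] /andP[F1 F2] [G0 _ G2]] := low_enclosure s0 (ltW F0).
move=> h1 h2; have h := mul_gt_ends hS h1 h2.
have F0' : 0 < hi by apply: lt_le_trans F0 (le_trans F1 F2).
apply: (proj2 (sub_quotient sin_gt0 (Blow_subE q (lt0r_neq0 sin_gt0)))).
rewrite -(pmulr_rlt0 _ F0').
have C1' : hi * cos_lo s <= hi * cos s by rewrite ler_pM2l.
by rewrite -/hi in G2 *; lra.
Qed.

Lemma gap_low_gt0 kappa : 0 <= kappa -> 0 <= 1 / 5 * sin_lo s + cos_lo s ->
  let X := kappa * (1 + lo * (1 / 5 * sin_lo s + cos_lo s)) - 1 in
  - (1 / 5) * sin_lo s + cos_hi s < X * lo ->
  - (1 / 5) * sin_lo s + cos_hi s < X * hi -> 0 < gap_low kappa (pi - s).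
Proof.
have [/andP[S1 S2] /andP[C1 C2] hF [G0 _ _]] := low_enclosure s0 (ltW F0).
move=> k0 w0 X h1 h2; have h := mul_gt_ends hF h1 h2.
set x := (pi + s) / 5 in hF h *.
have E : expR (- x) * expR x = 1 by rewrite -expRD addNr expR0.
have f0 := expR_gt0 (- x); case/andP: hF => F1 F2.
rewrite gap_lowE -/x -(pmulr_rgt0 _ f0).
have h3 : lo * (1 / 5 * sin_lo s + cos_lo s) <= expR (- x) * (1 / 5 * sin s + cos s).
  by apply: ler_pM => //; [exact: ltW|lra].
have h4 : X <= kappa * (1 + expR (- x) * (1 / 5 * sin s + cos s)) - 1.
  by rewrite lerD2r; apply: ler_wpM2l => //; lra.
have h5 := ler_wpM2l (ltW f0) h4.
set u := _ - (1 + _); have -> : expR (- x) * u =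
    expR (- x) * (kappa * (1 + expR (- x) * (1 / 5 * sin s + cos s)) - 1) -
    (expR (- x) * expR x) * (- (1 / 5) * sin s + cos s) by rewrite /u; ring.
by rewrite E; lra.
Qed.

Lemma gap_low_lt0 kappa : 0 <= kappa -> 0 <= 1 / 5 * sin_lo s + cos_lo s ->
  let X := kappa * (1 + hi * (1 / 5 * sin_hi s + cos_hi s)) - 1 in
  X * lo < - (1 / 5) * sin_hi s + cos_lo s ->
  X * hi < - (1 / 5) * sin_hi s + cos_lo s -> gap_low kappa (pi - s) < 0.
Proof.
have [/andP[S1 S2] /andP[C1 C2] hF [G0 _ _]] := low_enclosure s0 (ltW F0).
move=> k0 w0 X h1 h2; have h := mul_lt_ends hF h1 h2.
set x := (pi + s) / 5 in hF h *.
have E : expR (- x) * expR x = 1 by rewrite -expRD addNr expR0.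
have f0 := expR_gt0 (- x); case/andP: hF => F1 F2.
rewrite gap_lowE -/x -(pmulr_rlt0 _ f0).
have h3 : expR (- x) * (1 / 5 * sin s + cos s) <= hi * (1 / 5 * sin_hi s + cos_hi s).
  by apply: ler_pM => //; lra.
have h4 : kappa * (1 + expR (- x) * (1 / 5 * sin s + cos s)) - 1 <= X.
  by rewrite lerD2r; apply: ler_wpM2l => //; lra.
have h5 := ler_wpM2l (ltW f0) h4.
set u := _ - (1 + _); have -> : expR (- x) * u =
    expR (- x) * (kappa * (1 + expR (- x) * (1 / 5 * sin s + cos s)) - 1) -
    (expR (- x) * expR x) * (- (1 / 5) * sin s + cos s) by rewrite /u; ring.
by rewrite E; lra.
Qed.

End LowerPoint.

Ltac numeric := rewrite /sin_lo /sin_hi /cos_lo /cos_hi /expN_lo /expN_hi; lra.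

(** The rationals q separate the ends of the two curves, so each comparison splits into two
    one-sided tests. The gaps decrease, hence are tested where they are largest ([t1]) and smallest
    (pi - s2); in [attracting_box] it is the other way round. *)
Lemma repelling_box kappa t1 t2 s1 s2 (qA1 qA2 qB1 qB2 : R) :
  0 < kappa -> kappa <= 2 -> kappa <= (1 + 3 / 8 * t1) ^+ 2 ->
  0 < t1 -> t1 < t2 -> t2 < 3 -> 0 < s2 -> s2 < s1 -> s1 <= 157 / 100 ->
  qA1 < Aup t1 -> Alow (pi - s1) < qA1 -> Aup t2 < qA2 -> qA2 < Alow (pi - s2) ->
  qB1 < Bup t1 -> Blow (pi - s1) < qB1 -> Bup t2 < qB2 -> qB2 < Blow (pi - s2) ->
  gap_up kappa t1 < 0 -> 0 < gap_low kappa (pi - s2) ->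
  0 < Alow (pi - s1) -> Bup t1 < - 2 ->
  cycle_box 1 kappa t1 t2 (pi - s1) (pi - s2).
Proof.
move=> k0 k2 kt t0 t12 t23 s0 s21 s1p a1 a1' a2 a2' b1 b1' b2 b2' gu gl r l.
have [p1 p2] := @pi_bounds R.
have t2p : t2 < pi by clear - t23 p1; lra.
have s1p' : pi / 2 <= pi - s1 by clear - s1p p1; lra.
have s2p : pi - s2 < pi by clear - s0; lra.
have s12 : pi - s1 < pi - s2 by clear - s21; lra.
have s10 : 0 <= pi - s1 by clear - s1p' p1; lra.
split; rewrite ?mul1r ?subr_gt0 //.
- by left.
- exact: lt_trans a1.
- exact: lt_trans a2'.
- exact: lt_trans b1.
- exact: lt_trans b2'.
- move=> x /andP[x1 x2]; rewrite mulN1r oppr_gt0.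
  by have [_ h] := gap_up_decr k0 (ltW t0) x1 x2 t2p kt; exact: le_lt_trans gu.
- move=> x /andP[x1 x2]; rewrite mul1r.
  by have [h _] := gap_low_decr k0 s10 x1 x2 s2p k2; exact: lt_le_trans h.
Qed.

Lemma attracting_box kappa t1 t2 s1 s2 (qA1 qA2 qB1 qB2 : R) :
  0 < kappa -> kappa <= 2 -> kappa <= (1 + 3 / 8 * t1) ^+ 2 ->
  0 < t1 -> t1 < t2 -> t2 < 3 -> 0 < s2 -> s2 < s1 -> s1 <= 157 / 100 ->
  Aup t1 < qA1 -> qA1 < Alow (pi - s1) -> qA2 < Aup t2 -> Alow (pi - s2) < qA2 ->
  Bup t1 < qB1 -> qB1 < Blow (pi - s1) -> qB2 < Bup t2 -> Blow (pi - s2) < qB2 ->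
  0 < gap_up kappa t2 -> gap_low kappa (pi - s1) < 0 ->
  0 < Alow (pi - s1) -> Bup t1 < - 2 ->
  cycle_box (- 1) kappa t1 t2 (pi - s1) (pi - s2).
Proof.
move=> k0 k2 kt t0 t12 t23 s0 s21 s1p a1 a1' a2 a2' b1 b1' b2 b2' gu gl r l.
have [p1 p2] := @pi_bounds R.
have t2p : t2 < pi by clear - t23 p1; lra.
have s1p' : pi / 2 <= pi - s1 by clear - s1p p1; lra.
have s2p : pi - s2 < pi by clear - s0; lra.
have s12 : pi - s1 < pi - s2 by clear - s21; lra.
have s10 : 0 <= pi - s1 by clear - s1p' p1; lra.
split.
- by right.
- exact: k0.
- by split.
- by split.
- by rewrite mulN1r opprB subr_gt0; exact: lt_trans a1'.
- by rewrite mulN1r opprB subr_gt0; exact: lt_trans a2.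
- by rewrite mulN1r opprB subr_gt0; exact: lt_trans b1'.
- by rewrite mulN1r opprB subr_gt0; exact: lt_trans b2.
- move=> x /andP[x1 x2]; rewrite opprK mul1r.
  by have [h _] := gap_up_decr k0 (ltW t0) x1 x2 t2p kt; exact: lt_le_trans h.
- move=> x /andP[x1 x2]; rewrite mulN1r oppr_gt0.
  by have [_ h] := gap_low_decr k0 s10 x1 x2 s2p k2; exact: le_lt_trans gl.
- exact: r.
- exact: l.
Qed.

(** In each of the three boxes the separators also enclose the cycle on the line; here it crosses
    between 11/50 and 27/50 and between -91/30 and -27/10. *)
Lemma inner_box : @cycle_box R 1 (8 / 7) (19 / 50) (23 / 50) (pi - 31 / 20) (pi - 5 / 4).
Proof.
apply: (@repelling_box (8 / 7) _ _ _ _ (11 / 50) (27 / 50) (- (27 / 10)) (- (91 / 30)));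
  try lra.
- by apply: Aup_gt; numeric.
- by apply: Alow_lt_num; numeric.
- by apply: Aup_lt_num; numeric.
- by apply: Alow_gt; numeric.
- by apply: Bup_gt; numeric.
- by apply: Blow_lt_num; numeric.
- by apply: Bup_lt_num; numeric.
- by apply: Blow_gt; numeric.
- by apply: gap_up_lt0; numeric.
- by apply: gap_low_gt0; numeric.
- by apply: Alow_gt; numeric.
- by apply: Bup_lt_num; numeric.
Qed.

Lemma middle_box :
  @cycle_box R (- 1) (61 / 40) (13 / 20) (41 / 50) (pi - 43 / 50) (pi - 33 / 50).
Proof.
apply: (@attracting_box (61 / 40) _ _ _ _ (17 / 14) (20 / 11) (- (59 / 15)) (- (34 / 7)));
  try lra.
- by apply: Aup_lt_num; numeric.
- by apply: Alow_gt; numeric.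
- by apply: Aup_gt; numeric.
- by apply: Alow_lt_num; numeric.
- by apply: Bup_lt_num; numeric.
- by apply: Blow_gt; numeric.
- by apply: Bup_gt; numeric.
- by apply: Blow_lt_num; numeric.
- by apply: gap_up_gt0; numeric.
- by apply: gap_low_lt0; numeric.
- by apply: Alow_gt; numeric.
- by apply: Bup_lt_num; numeric.
Qed.

Lemma outer_box : @cycle_box R 1 (39 / 20) (3 / 2) (7 / 4) (pi - 3 / 10) (pi - 23 / 100).
Proof.
apply: (@repelling_box (39 / 20) _ _ _ _ (93 / 20) (61 / 10) (- (149 / 15)) (- (103 / 8)));
  try lra.
- by apply: Aup_gt; numeric.
- by apply: Alow_lt_num; numeric.
- by apply: Aup_lt_num; numeric.
- by apply: Alow_gt; numeric.
- by apply: Bup_gt; numeric.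
- by apply: Blow_lt_num; numeric.
- by apply: Bup_lt_num; numeric.
- by apply: Blow_gt; numeric.
- by apply: gap_up_lt0; numeric.
- by apply: gap_low_gt0; numeric.
- by apply: Alow_gt; numeric.
- by apply: Bup_lt_num; numeric.
Qed.

End Numerics.

Theorem mainTheorem4 (R : realType) :
  let Aup : R[i] := (3 / 8) +i* 1 in
  let Bup : R[i] := (- (14333 / 2000)) +i* (1159 / 1000) in
  let Alow : R[i] := (- (1 / 5)) +i* 1 in
  let Blow : R[i] := (- (51 / 50)) +i* (1 / 250) in
  let Xup : R * R -> R * R := holo_field Aup Bup in
  let Xlow : R * R -> R * R := holo_field Alow Blow in
  let p : R * R := (- (1 / 5), - (49 / 50)) in
  (focus Alow Blow p /\ p.2 < 0) /\
  exists G : 'I_3 -> set (R * R),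
    [/\ forall i, limit_cycle Xup Xlow (G i),
        forall i, inside (G i) p &
        forall i j : 'I_3, (i < j)%N -> G i `<=` inside (G j)].
Proof.
move=> A1 B1 A2 B2 X1 X2 p.
have E1 : X1 = Xup := holo_field_up.
have E2 : X2 = Xlow := holo_field_low.
split.
  split; last by rewrite /p /=; lra.
  split; rewrite /A2 /=; last exact: oner_neq0.
    by rewrite -/X2 E2 /p /Xlow /spiral_field /=; congr pair; lra.
  by rewrite oppr_eq0 gt_eqF //; lra.
have [t0 [s0 [/andP[_ h0] c0 l0]]] := box_limit_cycle (@inner_box R).
have [t1 [s1 [/andP[h1 h1'] c1 l1]]] := box_limit_cycle (@middle_box R).
have [t2 [s2 [/andP[h2 _] c2 l2]]] := box_limit_cycle (@outer_box R).
(* The three ranges of upper flight times are disjoint, and their order is the order of nesting. *)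
have t01 : t0 < t1 by move: h0 h1; clear; lra.
have t12 : t1 < t2 by move: h1' h2; clear; lra.
rewrite E1 E2.
exists (fun i : 'I_3 => nth set0 [:: loop t0 s0; loop t1 s1; loop t2 s2] i); split.
- by case=> [[|[|[|//]]] ?].
- by case=> [[|[|[|//]]] ?] /=; exact: focus_inside_loop.
- case=> [[|[|[|//]]] ?] [[|[|[|//]]] ?] //= _.
  + exact: loops_nested t01.
  + by apply: (loops_nested c0 c2); exact: lt_trans t12.
  + exact: loops_nested t12.
Qed.
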